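(* Let $(U_t)_{t\in\mathbb R}$ be a reflection positive unitary one-parameter group on $(\mathcal E,\mathcal E_+,\theta)$ for which $\mathcal E_+$ is $U$-cyclic and $\mathcal E_{\rm fix}:=\{v\in\mathcal E: U_tv=v\ \forall t\in\mathbb R\}=\{0\}$. Then $\mathcal E_+$ is outgoing, so that $(U,\mathcal E)$ is unitarily equivalent to the translation representation on $L^2(\mathbb R,\mathcal M)$ for some Hilbert space $\mathcal M$. This realization is unique up to isomorphism of $\mathcal M$.
   Context: A reflection positive Hilbert space is a triple $(\mathcal E,\mathcal E_+,\theta)$ where $\mathcal E$ is a Hilbert space, $\theta$ is a unitary involution on $\mathcal E$ and $\mathcal E_+\subseteq\mathcal E$ is a closed subspace with $\langle\eta,\theta\eta\rangle\ge 0$ for all $\eta\in\mathcal E_+$. A reflection positive unitary one-parameter group on it is a strongly continuous unitary one-parameter group $(U_t)_{t\in\mathbb R}$ on $\mathcal E$ with $U_t\mathcal E_+\subseteq\mathcal E_+$ for $t>0$ and $\theta U_t\theta=U_{-t}$ for $t\in\mathbb R$. $\mathcal E_+$ is $U$-cyclic if $\bigcup_{t\in\mathbb R}U_t\mathcal E_+$ spans a dense subspace of $\mathcal E$. For a unitary representation $(U,\mathcal E)$ of $\mathbb R$, a closed subspace $\mathcal E_+\subseteq\mathcal E$ is called outgoing if (LP1) $U_t\mathcal E_+\subseteq\mathcal E_+$ for $t>0$; (LP2) $\bigcap_{t>0}U_t\mathcal E_+=\{0\}$; (LP3) $\bigcup_{t<0}U_t\mathcal E_+$ is dense in $\mathcal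 E$. The translation representation of $\mathbb R$ on $L^2(\mathbb R,\mathcal M)$ is $(V_tf)(x)=f(x-t)$. *)

(* Defs.v *)
From HB Require Import structures.
From mathcomp Require Import all_boot all_order all_algebra.
From mathcomp Require Import sesquilinear.
From mathcomp Require Export complex.
From mathcomp Require Import all_classical all_reals all_analysis.

Set Implicit Arguments.
Unset Strict Implicit.
Unset Printing Implicit Defensive.

Import Order.TTheory GRing.Theory Num.Theory.
Import numFieldNormedType.Exports.

Local Open Scope classical_set_scope.
Local Open Scope ring_scope.
Local Open Scope complex_scope.

(** Complex Hilbert spaces.  The inner product is linear in its first argument
    and conjugate-linear in the second. *)
HB.mixin Record NormedModule_isHilbert (R : realType) H
    of NormedModule R[i] H := {
  inner : {dot H for (@Num.conj R[i])} ;
  sqr_normE : forall x : H, `|x| ^+ 2 = inner x x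
}.

#[short(type="hilbertType")]
HB.structure Definition Hilbert (R : realType) :=
  {H of CompleteNormedModule R[i] H & NormedModule_isHilbert R H}.

Definition unitary_map (R : realType) (H K : hilbertType R)
    (W : {linear H -> K}) : Prop :=
  (forall u v : H, inner (W u) (W v) = inner u v) /\
  (forall y : K, exists x : H, W x = y).

Definition hilbert_isomorphic (R : realType) (H K : hilbertType R) : Prop :=
  exists W : {linear H -> K}, unitary_map W.

Definition linear_subspace (R : realType) (E : hilbertType R) (S : set E) :
  Prop := S 0 /\ forall (a : R[i]) (u v : E), S u -> S v -> S (a *: u + v).

Definition linear_span (R : realType) (E : hilbertType R) (A : set E) : set E :=
  smallest (@linear_subspace R E) A.

Definition closed_subspace (R : realType) (E : hilbertType R) (S : set E) :
  Prop := linear_subspace S /\ closed S.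

Section OneParameterGroups.
Context (R : realType) (E : hilbertType R).
Implicit Types (U : R -> {linear E -> E}) (Ep : set E) (theta : {linear E -> E}).

Definition unitary_one_parameter_group U : Prop :=
  [/\ forall t, unitary_map (U t),
      forall v, U 0 v = v,
      forall s t v, U (s + t) v = U s (U t v)
    & forall v, continuous (fun t : R => U t v)].

(** The order on [R[i]] makes [0 <= z] say that [z] is real and nonnegative. *)
Definition reflection_positive_space Ep theta : Prop :=
  [/\ closed_subspace Ep,
      unitary_map theta,
      involutive theta
    & forall eta, Ep eta -> 0 <= inner eta (theta eta)].

Definition reflection_positive_group Ep theta U : Prop :=
  [/\ unitary_one_parameter_group U,
      forall t, 0 < t -> U t @` Ep `<=` Ep
    & forall t v, theta (U t (theta v)) = U (- t) v].

Definition cyclic_subspace Ep U : Prop :=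
  dense (linear_span (\bigcup_(t in [set: R]) (U t @` Ep))).

Definition fixed_vectors U : set E := [set v | forall t, U t v = v].

Definition outgoing Ep U : Prop :=
  [/\ closed_subspace Ep,
      forall t, 0 < t -> U t @` Ep `<=` Ep,
      \bigcap_(t in [set t : R | 0 < t]) (U t @` Ep) = [set 0]
    & dense (\bigcup_(t in [set t : R | t < 0]) (U t @` Ep))].

End OneParameterGroups.

Section L2.
Context (R : realType) (M : hilbertType R).
Implicit Types f g : R -> M.

Definition simple_map f : Prop :=
  finite_set (range f) /\
  forall y, measurable (f @^-1` [set y] : set (measurableTypeR R)).

(** Strong (Bochner) measurability; it forces separable range, so that [M]
    itself may be nonseparable.  Every class modulo null sets of Lebesgue
    strongly measurable functions has a representative of this form. *)
Definition strongly_measurable f : Prop :=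
  exists s : nat -> R -> M,
    (forall n, simple_map (s n)) /\ (forall x, s n x @[n --> \oo] --> f x).

(** The functions representing the elements of [L^2(R, M)]; equality in
    [L^2(R, M)] is equality almost everywhere. *)
Definition L2 : set (R -> M) :=
  [set f | strongly_measurable f /\
    (\int[lebesgue_measure]_x (complex.Re (inner (f x) (f x)))%:E < +oo)%E].

Definition L2_inner f g : R[i] :=
  (\int[lebesgue_measure]_x complex.Re (inner (f x) (g x)))
  +i* (\int[lebesgue_measure]_x complex.Im (inner (f x) (g x))).

Definition translation (t : R) f : R -> M := fun x => f (x - t).

End L2.

(** [W v] is a representative of the image of [v] under a unitary operator from
    [E] onto [L^2(R, M)] that intertwines [U] with the translations. *)
Definition equivalent_to_translation (R : realType) (E : hilbertType R)
    (U : R -> {linear E -> E}) (M : hilbertType R) : Prop :=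
  exists W : E -> R -> M,
    [/\ forall v, L2 (W v),
        forall (a : R[i]) u v,
          W (a *: u + v) = (fun x => a *: W u x + W v x)
            %[ae (@lebesgue_measure R)],
        forall u v, L2_inner (W u) (W v) = inner u v,
        forall f, L2 f -> exists v, W v = f %[ae (@lebesgue_measure R)]
      & forall t v,
          W (U t v) = translation t (W v) %[ae (@lebesgue_measure R)]].

(* Main.v *)
(** Let [q u w = <u, theta w>].  If [U t v] lies in [Ep] for every [t], then
    positivity of [q] on the vectors [U t v - v] says that the bounded function
    [a t = q (U t v) v - q v v] satisfies [2 a t <= a (2 t)]; hence [a <= 0],
    then [a = 0], so [U t v - v] is a null vector of [q], and it is [0] because
    [Ep] is cyclic.  This is (LP2).

    For the cogenerator [V] of an outgoing [U], the vectors [m] of [Ep]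
    orthogonal to [V Ep] satisfy [<m, U t n> = exp (- |t|) <m, n>], and by the
    Wold decomposition their orbits are total.  The functions
    [sqrt 2 exp (t - x) m] on [x > t] have the same Gram matrix and are total
    in [L^2(R, M)], which gives the translation representation.

    Any other representation, on [L^2(R, N)], makes [N] a wandering subspace
    of the same bilateral shift [V].  For orthonormal bases [b] of [M] and [c] of
    [N], Parseval makes the matrix [sum_p |<b_i, V^p c_j>|^2] doubly stochastic,
    so that the bases are equipotent. *)

Require Import Defs.
From HB Require Import structures.
From mathcomp Require Import all_boot all_order all_algebra.
From mathcomp Require Import sesquilinear finmap.
From mathcomp Require Import all_classical all_reals all_analysis measurable_realfun.
From mathcomp Require Import ring lra.

Set Implicit Arguments.
Unset Strict Implicit.
Unset Printing Implicit Defensive.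

Import Order.TTheory GRing.Theory Num.Theory.
Import numFieldNormedType.Exports.

Local Open Scope classical_set_scope.
Local Open Scope ring_scope.
Local Open Scope complex_scope.

(** * Real part of the inner product and the real-valued norm *)

Section RealInner.
Context {R : realType} {E : hilbertType R}.
Implicit Types (u v w : E) (a : R[i]) (k : R).

(** A continuous semigroup offers no single difference of [Ep] and [U t Ep] to serve as multiplicity
    space; the single isometry [V] does, and subspaces pass between [V] and [U]: forward invariance
    under [U] gives invariance under [V], and what [V] reduces, [U] reduces. [V] is obtained without
    the spectral theorem: the resolvent at 1 is the Riesz representative of a weak Laplace integral,
    and statements about the unbounded generator become scalar differential equations for
    [re (U t x) z], where boundedness excludes the growing solution. As the calculus is that of real
    functions, the arguments run with [re] and are lifted to [inner] by inserting multiples by ['i].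
    Existence and uniqueness meet in [exp_system], a copy of [M] in [E] whose orbits have the Gram
    kernel [expR (- |t|)]. An outgoing subspace yields such a system, a system yields the
    translation representation, and every translation representation yields one back. Uniqueness
    thus compares two systems inside the same [E], with no Fourier transform. *)

Definition re u v : R := complex.Re (inner u v).
Definition nrm u : R := Num.sqrt (re u u).

Lemma innerC u v : inner v u = (inner u v)^*.
Proof. by rewrite hermC /= expr0 mul1r. Qed.

Lemma innerDl u v w : inner (u + v) w = inner u w + inner v w.
Proof. exact: linearDl. Qed.
Lemma innerDr u v w : inner w (u + v) = inner w u + inner w v.
Proof. exact: linearDr. Qed.
Lemma innerNl u v : inner (- u) v = - inner u v.
Proof. exact: linearNl. Qed.
Lemma innerNr u v : inner u (- v) = - inner u v.
Proof. exact: linearNr. Qed.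
Lemma innerBl u v w : inner (u - v) w = inner u w - inner v w.
Proof. exact: linearBl. Qed.
Lemma innerBr u v w : inner w (u - v) = inner w u - inner w v.
Proof. exact: linearBr. Qed.
Lemma innerZl a u v : inner (a *: u) v = a * inner u v.
Proof. exact: linearZl_LR. Qed.
Lemma innerZr a u v : inner u (a *: v) = a^* * inner u v.
Proof. exact: linearZr_LR. Qed.
Lemma inner0l u : inner 0 u = 0.
Proof. exact: linear0l. Qed.
Lemma inner0r u : inner u 0 = 0.
Proof. exact: linear0r. Qed.

Lemma reC u v : re u v = re v u.
Proof. by rewrite /re [inner v u]innerC; case: (inner u v). Qed.
Lemma reDl u v w : re (u + v) w = re u w + re v w.
Proof. by rewrite /re innerDl raddfD. Qed.
Lemma reDr u v w : re w (u + v) = re w u + re w v.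
Proof. by rewrite /re innerDr raddfD. Qed.
Lemma reNl u v : re (- u) v = - re u v.
Proof. by rewrite /re innerNl raddfN. Qed.
Lemma reNr u v : re u (- v) = - re u v.
Proof. by rewrite /re innerNr raddfN. Qed.
Lemma reZl k u v : re (k%:C *: u) v = k * re u v.
Proof. by rewrite /re innerZl; case: (inner u v) => x y /=; ring. Qed.
Lemma reZr k u v : re u (k%:C *: v) = k * re u v.
Proof. by rewrite reC reZl reC. Qed.
Lemma re0l u : re 0 u = 0. Proof. by rewrite /re inner0l. Qed.
Lemma re0r u : re u 0 = 0. Proof. by rewrite reC re0l. Qed.
Definition reE := (reDl, reDr, reNl, reNr, reZl, reZr, re0l, re0r).

Lemma im_inner u v : complex.Im (inner u v) = re u ('i *: v).
Proof. by rewrite /re innerZr; case: (inner u v) => x y /=; ring. Qed.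

(** Because ['i] is conjugated in the second slot, the imaginary part is again a value of [re]. A
    claim about [re] proved for all vectors of a complex subspace therefore holds for [inner]. *)
Lemma inner_re u v : inner u v = re u v +i* re u ('i *: v).
Proof. by rewrite -im_inner /re; case: (inner u v). Qed.

(** The norm has values in [R[i]]; nonnegativity there forces a zero imaginary part. *)
Lemma normE u : `|u| = (nrm u)%:C.
Proof.
have h := sqr_normE u.
have : 0 <= `|u| by [].
rewrite /nrm /re -h; case: `|u| => x y; rewrite lecE /= => /andP[/eqP-> x0].
by rewrite mulr0 subr0 -expr2 sqrtr_sqr ger0_norm.
Qed.

Lemma inner_self u : inner u u = (nrm u ^+ 2)%:C.
Proof. by rewrite -sqr_normE normE rmorphXn. Qed.

Lemma nrm_sqr u : nrm u ^+ 2 = re u u.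
Proof. by rewrite /re inner_self. Qed.

Lemma re_ge0 u : 0 <= re u u. Proof. by rewrite -nrm_sqr sqr_ge0. Qed.
Lemma nrm_ge0 u : 0 <= nrm u. Proof. exact: sqrtr_ge0. Qed.
Hint Resolve nrm_ge0 re_ge0 : core.

Lemma nrm0_eq0 u : nrm u = 0 -> u = 0.
Proof. by move=> h; apply/eqP; rewrite -normr_eq0 normE h. Qed.
Lemma re0_eq0 u : re u u = 0 -> u = 0.
Proof. by move=> h; apply: nrm0_eq0; rewrite /nrm h sqrtr0. Qed.

Lemma nrmN u : nrm (- u) = nrm u.
Proof. by rewrite /nrm !reE opprK. Qed.
Lemma nrmB u v : nrm (u - v) = nrm (v - u).
Proof. by rewrite -nrmN opprB. Qed.
Lemma nrm0 : nrm 0 = 0. Proof. by rewrite /nrm re0l sqrtr0. Qed.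

Lemma nrmZ a u : nrm (a *: u) = Normc.normc a * nrm u.
Proof. by have := normrZ a u; rewrite !normE normc_def -rmorphM => /complexI ->; case: a. Qed.
Lemma nrmZr k u : nrm (k%:C *: u) = `|k| * nrm u.
Proof. by rewrite nrmZ /= expr0n addr0 sqrtr_sqr. Qed.

Lemma nrmD u v : nrm (u + v) <= nrm u + nrm v.
Proof. by have := ler_normD u v; rewrite !normE -rmorphD lecR. Qed.

(** The triangle inequality is given with the norm, and this is its consequence: squaring it for
    [u + s v] with [s = 1] and [s = -1] leaves the cross term. *)
Lemma cauchy_schwarz u v : `|re u v| <= nrm u * nrm v.
Proof.
have h (s : R) : s ^+ 2 = 1 -> s * re u v <= nrm u * nrm v.
  move=> s1; have := nrmD u (s%:C *: v).
  have ns : nrm (s%:C *: v) = nrm v.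
    rewrite nrmZr; have : `|s| ^+ 2 == 1 ^+ 2 by rewrite -normrX s1 normr1 expr1n.
    by rewrite eqrXn2// => /eqP ->; rewrite mul1r.
  rewrite ns => hh; have : nrm (u + s%:C *: v) ^+ 2 <= (nrm u + nrm v) ^+ 2.
    by apply: lerXn2r; rewrite ?nnegrE ?addr_ge0.
  rewrite sqrrD !nrm_sqr !reE (reC v u) => {}hh.
  have e : s * (s * re v v) = re v v by rewrite mulrA -expr2 s1 mul1r.
  move: hh; rewrite e mulr2n; lra.
rewrite ler_norml; apply/andP; split.
  by have := h (-1); rewrite sqrrN expr1n => /(_ erefl); rewrite mulN1r lerNl.
by have := h 1 (expr1n _ _); rewrite mul1r.
Qed.

Lemma re_le_nrm u v : re u v <= nrm u * nrm v.
Proof. exact: le_trans (ler_norm _) (cauchy_schwarz _ _). Qed.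

Lemma inner_eq0P u v : inner u v = 0 <-> re u v = 0 /\ re u ('i *: v) = 0.
Proof.
rewrite inner_re; split; first by case=> -> ->.
by case=> -> ->.
Qed.

End RealInner.
#[global] Hint Resolve nrm_ge0 re_ge0 : core.

(** * Topology and completeness in terms of the real norm *)

Section RealMetric.
Context {R : realType} {E : hilbertType R}.
Implicit Types (u v w : E) (S K : set E) (k e : R).

Lemma gt0_complexP (z : R[i]) : 0 < z -> exists2 e : R, 0 < e & z = e%:C.
Proof. by case: z => x y; rewrite ltcE /= => /andP[/eqP -> x0]; exists x. Qed.

Lemma nbhs_nrm v S :
  nbhs v S <-> exists2 e, 0 < e & forall u, nrm (v - u) < e -> S u.
Proof.
split.
  move=> /nbhs_ballP[z /= /gt0_complexP[e e0 ->] h]; exists e => // u vu.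
  by apply: h; rewrite -ball_normE /= normE ltcR.
move=> [e e0 h]; apply/nbhs_ballP; exists e%:C; first by rewrite /= ltcR.
by move=> u; rewrite -ball_normE /= normE ltcR; exact: h.
Qed.

Lemma closure_nrm S v :
  closure S v <-> forall e, 0 < e -> exists2 u, S u & nrm (v - u) < e.
Proof.
split=> [h e e0|h B /nbhs_nrm[e e0 hB]].
  have [] := h [set u | nrm (v - u) < e]; first by apply/nbhs_nrm; exists e.
  by move=> u [Su uv]; exists u.
by have [u Su uv] := h e e0; exists u; split => //; exact: hB.
Qed.

Lemma closed_nrm S : closed S <->
  forall v, (forall e, 0 < e -> exists2 u, S u & nrm (v - u) < e) -> S v.
Proof.
by split=> h v; [move=> hv; apply: h; apply/closure_nrm|move=> /closure_nrm/h].
Qed.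

Lemma dense_nrm S : dense S <->
  forall v e, 0 < e -> exists2 u, S u & nrm (v - u) < e.
Proof.
split=> [h v e e0|h O [v Ov] oO].
  have := h [set u | nrm (v - u) < e]^°.
  have n0 : nbhs v [set u | nrm (v - u) < e] by apply/nbhs_nrm; exists e.
  move=> /(_ _ (open_interior _))[|u [/interior_subset uv Su]]; last by exists u.
  by exists v.
have /nbhs_nrm[e e0 hO] : nbhs v O by exact: open_nbhs_nbhs.
by have [u Su /hO Ou] := h v e e0; exists u.
Qed.

Definition tends (x : nat -> E) v :=
  forall e, 0 < e -> exists N, forall n, (N <= n)%N -> nrm (x n - v) < e.

Lemma cvg_tends (x : nat -> E) v : x n @[n --> \oo] --> v <-> tends x v.
Proof.
split=> [h e e0|h].
  have := h [set u | nrm (v - u) < e] => -[]; first by apply/nbhs_nrm; exists e.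
  by move=> N _ hN; exists N => n Nn; rewrite nrmB; exact: hN.
move=> B /nbhs_nrm[e e0 hB]; have [N hN] := h e e0.
by exists N => // n /= Nn; apply: hB; rewrite nrmB; exact: hN.
Qed.

Lemma complete_nrm (x : nat -> E) :
  (forall e, 0 < e -> exists N, forall m n,
     (N <= m)%N -> (N <= n)%N -> nrm (x m - x n) < e) ->
  exists v, tends x v.
Proof.
move=> h; have : cauchy (x @ \oo).
  apply/cauchy_ballP => z /gt0_complexP[e e0 ->].
  have [N hN] := h e e0.
  near=> p; rewrite -ball_normE /= normE ltcR.
  have -> : p = (p.1, p.2) by case: (p).
  near: p.
  exists ([set u | exists2 n, (N <= n)%N & x n = u],
          [set u | exists2 n, (N <= n)%N & x n = u]) => /=.
    by split; exists N => // n /= Nn; exists n.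
  by move=> [a b] /= [[m Nm <-] [n Nn <-]]; exact: hN.
by move=> /cauchy_cvg; move=> /cvg_ex[v xv]; exists v; apply/cvg_tends.
Unshelve. all: by end_near. Qed.

Lemma closed_tends S x v : closed S -> tends x v -> (forall n, S (x n)) -> S v.
Proof.
move=> /closed_nrm h xv Sx; apply: h => e e0; have [N hN] := xv e e0.
by exists (x N) => //; rewrite nrmB; exact: hN.
Qed.

End RealMetric.

(** * Riesz representation and orthogonal projection *)

Section Subspaces.
Context {R : realType} {E : hilbertType R}.
Implicit Types (u v w : E) (S K : set E) (k e : R) (a : R[i]).

Lemma subspace0 K : linear_subspace K -> K 0. Proof. by case. Qed.
Lemma subspaceZ K a u : linear_subspace K -> K u -> K (a *: u).
Proof. by move=> [h0 h] Ku; rewrite -[_ *: _]addr0; exact: h. Qed.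
Lemma subspaceD K u v : linear_subspace K -> K u -> K v -> K (u + v).
Proof. by move=> [h0 h] Ku Kv; rewrite -[u]scale1r; exact: h. Qed.
Lemma subspaceN K u : linear_subspace K -> K u -> K (- u).
Proof. by move=> hK Ku; rewrite -scaleN1r; exact: subspaceZ. Qed.
Lemma subspaceB K u v : linear_subspace K -> K u -> K v -> K (u - v).
Proof. by move=> hK Ku Kv; apply: subspaceD => //; exact: subspaceN. Qed.

(** The first variation at a minimum vanishes. It serves both the minimizer in the Riesz
    representation and null vectors of a semidefinite form. *)
Lemma quadratic_eq0 (b c : R) : (forall k : R, 0 <= 2 * k * b + k ^+ 2 * c) -> b = 0.
Proof.
move=> h; apply/eqP/negPn/negP => b0.
have b2 : 0 < b ^+ 2 by rewrite exprn_even_gt0.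
(* Adding 1 keeps [d] positive when [c = 0], and [c < 2 * d] makes the value at [- b / d]
   negative. *)
pose d := `|c| + 1; have d0 : 0 < d by rewrite /d; have := normr_ge0 c; lra.
have := h (- b / d).
have -> : 2 * (- b / d) * b + (- b / d) ^+ 2 * c = (b ^+ 2 / d) * (c / d - 2).
  by field; rewrite gt_eqF.
rewrite leNgt pmulr_rlt0 ?divr_gt0// subr_lt0 ltr_pdivrMr//.
by have := ler_norm c; have := normr_ge0 c; rewrite /d; lra.
Qed.

(** The representing vector minimizes [re u u - 2 * l u] over [K]. Linearity is real, so that
    integrals of real parts of orbits can be represented; [l := re v] gives the projection onto
    [K]. *)
Lemma riesz_representation K (l : E -> R) (C : R) : linear_subspace K -> closed K ->
  (forall k u v, K u -> K v -> l (u + k%:C *: v) = l u + k * l v) ->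
  (forall u, K u -> `|l u| <= C * nrm u) ->
  exists2 x, K x & forall u, K u -> re x u = l u.
Proof.
move=> hK cK ll lb; pose J u := re u u - 2 * l u.
have l0 : l 0 = 0.
  have := ll 1 0 0 (subspace0 hK) (subspace0 hK); rewrite scaler0 addr0; lra.
have lD u v : K u -> K v -> l (u + v) = l u + l v.
  by move=> Ku Kv; have := ll 1 u v Ku Kv; rewrite scale1r mul1r.
have lZ k u : K u -> l (k%:C *: u) = k * l u.
  by move=> Ku; have := ll k 0 u (subspace0 hK) Ku; rewrite add0r l0 add0r.
have lB u v : K u -> K v -> l (u - v) = l u - l v.
  move=> Ku Kv; have := ll (-1) u v Ku Kv.
  by rewrite rmorphN1 scaleN1r mulN1r.
have Jb u : K u -> - C ^+ 2 <= J u.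
  move=> Ku; rewrite /J -nrm_sqr; have := le_trans (ler_norm _) (lb u Ku).
  have : 0 <= (nrm u - C) ^+ 2 by rewrite sqr_ge0.
  by rewrite sqrrB; lra.
pose A := [set J u | u in K].
have iA : has_inf A.
  split; first by exists (J 0), 0 => //; exact: subspace0.
  by exists (- C ^+ 2) => _ [u Ku <-]; exact: Jb.
pose d := inf A.
have dJ u : K u -> d <= J u by move=> Ku; apply: (ge_inf iA.2); exists u.
have /choice[x hx] (n : nat) : exists u, K u /\ J u < d + n.+1%:R^-1.
  have [|_ [u Ku <-] h] := @inf_adherent _ A n.+1%:R^-1 _ iA; last by exists u.
  by rewrite invr_gt0 ltr0n.
(* Parallelogram law: the left side is [2 * J u + 2 * J v] minus four times [J] at the midpoint,
   where [J] is at least [d]. So the minimizing sequence is Cauchy. *)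
have par u v : K u -> K v -> re (u - v) (u - v) <= 2 * (J u - d) + 2 * (J v - d).
  move=> Ku Kv; have := dJ ((2^-1 : R)%:C *: (u + v)).
  move=> /(_ (subspaceZ _ hK (subspaceD hK Ku Kv))).
  rewrite /J lZ ?lD//; last exact: subspaceD.
  by rewrite !reE (reC v u); lra.
have small e : 0 < e -> exists N, forall n, (N <= n)%N -> n.+1%:R^-1 < e :> R.
  move=> e0; have [N hN] := @ltr_add_invr _ 0 e e0.
  exists N => n Nn; rewrite add0r in hN; apply: le_lt_trans hN.
  by rewrite lef_pV2 ?posrE ?ltr0n// ler_nat.
have [|y xy] := @complete_nrm R E x.
  move=> e e0; have e2 : 0 < e ^+ 2 / 4 by rewrite divr_gt0// exprn_gt0.
  have [N hN] := small _ e2; exists N => m n Nm Nn.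
  rewrite -(@ltr_pXn2r _ 2)// ?nnegrE ?nrm_ge0 ?ltW// nrm_sqr.
  have := par _ _ (hx m).1 (hx n).1.
  have jm : J (x m) < d + e ^+ 2 / 4 by apply: lt_trans (hx m).2 _; rewrite ltrD2l; exact: hN.
  have jn : J (x n) < d + e ^+ 2 / 4 by apply: lt_trans (hx n).2 _; rewrite ltrD2l; exact: hN.
  by lra.
have Ky : K y by apply: closed_tends cK xy _ => n; exact: (hx n).1.
have C0 : 0 <= `|C| by [].
have Jy : J y <= d.
  apply/ler_addgt0Pr => e e0.
  (* [B] is a Lipschitz bound for [J] between [y] and points at distance below 1: there
     [nrm (x n + y) <= 2 * nrm y + 1], and [l] contributes the rest. *)
  pose B := 2 * nrm y + 1 + 2 * `|C|.
  have B0 : 0 < B by rewrite /B; have := nrm_ge0 y; lra.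
  have e1 : 0 < Num.min 1 (e / 2 / B) by rewrite lt_min ltr01 divr_gt0// divr_gt0.
  have [N1 hN1] := xy _ e1.
  have e20 : 0 < e / 2 by lra.
  have [N2 hN2] := small _ e20.
  pose n := maxn N1 N2; have := hN1 n (leq_maxl _ _); have h2 := hN2 n (leq_maxr _ _).
  rewrite lt_min => /andP[h1 h3]; have [Kn hn0] := hx n.
  have hn : J (x n) < d + e / 2 by apply: lt_trans hn0 _; rewrite ltrD2l.
  have Kz : K (x n - y) by exact: subspaceB.
  have := lb _ Kz; have := cauchy_schwarz (x n - y) (x n + y).
  have -> : re (x n - y) (x n + y) = re (x n) (x n) - re y y.
    by rewrite !reE (reC y (x n)); lra.
  rewrite lB// => hl hq.
  have nn : nrm (x n + y) <= 2 * nrm y + 1.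
    have -> : x n + y = (x n - y) + (y + y) by rewrite addrA subrK.
    by have := nrmD (x n - y) (y + y); have := nrmD y y; lra.
  have pz := nrm_ge0 (x n - y).
  have : nrm (x n - y) * B <= e / 2 by rewrite -ler_pdivlMr// ltW.
  have := ler_wpM2l pz nn; have := ler_wpM2r pz (ler_norm C).
  move: hq hl hn; rewrite /J /B !ler_norml => /andP[q1 q2] /andP[l1 l2].
  by rewrite (mulrC `|C|) => {}hn i1 i2 i3; lra.
exists y => // u Ku; apply/eqP; rewrite -subr_eq0; apply/eqP.
(* As [y] is minimal, the increment of [J] in the direction [u] is a nonnegative quadratic
   polynomial in [k], so its linear coefficient vanishes. *)
apply: (@quadratic_eq0 _ (re u u)) => k.
have := dJ (y + k%:C *: u) (subspaceD hK Ky (subspaceZ _ hK Ku)).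
by rewrite /J ll// !reE (reC u y) => h; move: Jy; rewrite /J; lra.
Qed.

Lemma orthogonal_projection K v : closed_subspace K ->
  exists2 x, K x & forall u, K u -> inner (v - x) u = 0.
Proof.
move=> [hK cK]; have [||x Kx hx] := @riesz_representation K (re v) (nrm v) hK cK.
- by move=> k u w _ _; rewrite !reE.
- by move=> u _; exact: cauchy_schwarz.
exists x => // u Ku; apply/inner_eq0P; split.
  by rewrite !reE hx//; lra.
by rewrite !reE hx ?subrr//; exact: subspaceZ.
Qed.

(** The bipolar theorem: take for [w] the difference of [v] and its projection. This test against
    the orthogonal complement is the usual way to membership below. *)
Lemma mem_closed_subspace K v : closed_subspace K ->
  (forall w, (forall u, K u -> inner w u = 0) -> inner v w = 0) -> K v.
Proof.
move=> hK h; have [x Kx hx] := orthogonal_projection v hK.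
suff -> : v = x by [].
apply/eqP; rewrite -subr_eq0; apply/eqP/re0_eq0.
rewrite /re innerBl (innerC (v - x) x) hx// conjc0 subr0.
by rewrite h.
Qed.

End Subspaces.

(** * Calculus on the line and Laplace integrals *)

Section Calculus.
Context {R : realType}.
Implicit Types (f g phi psi : R -> R) (C D t y c k : R).

Lemma is_derive_of_small_o f t c :
  (forall e, 0 < e -> exists2 d, 0 < d &
     forall h, `|h| < d -> `|f (t + h) - f t - h * c| <= e * `|h|) ->
  is_derive t (1 : R) f c.
Proof.
move=> H.
have L : h^-1 *: (f (h *: 1 + t) - f t) @[h --> 0^'] --> c.
  apply/cvgrPdist_le => e e0.
  have [d d0 hd] := H e e0.
  near=> h.
  have h0 : h != 0 by near: h; exact: nbhs_dnbhs_neq.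
  have hd' : `|h| < d by near: h; apply: dnbhs0_lt.
  have hh := hd h hd'.
  rewrite /GRing.scale /= mulr1 [h + t]addrC.
  have -> : c - h^-1 * (f (t + h) - f t) = - (h^-1 * (f (t + h) - f t - h * c)).
    by field.
  by rewrite normrN normrM normfV [leLHS]mulrC ler_pdivrMr ?normr_gt0.
apply: DeriveDef; first by apply/cvg_ex; exists c.
by apply/cvg_lim => //; exact: Rhausdorff.
Unshelve. all: by end_near. Qed.

(** The hypothesis is one-sided because on an invariant subspace derivatives are known for
    nonnegative times only. *)
Lemma derive0_eq f (a b : R) : a <= b ->
  (forall x, a <= x -> is_derive x (1 : R) f 0) -> f a = f b.
Proof.
rewrite le_eqVlt => /predU1P[->//|ab] h.
have [||c _ /eqP] := @MVT R f (fun=> 0) a b ab.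
- by move=> x; rewrite in_itv /= => /andP[/ltW ax _]; exact: h.
- apply: derivable_within_continuous => x; rewrite in_itv /= => /andP[ax _].
  exact: (@ex_derive _ _ _ _ _ _ _ (h x ax)).
by rewrite mul0r subr_eq0 => /eqP.
Qed.

(** Let [y] tend to minus infinity. This is how boundedness removes the exponentially growing
    solution. *)
Lemma exp_dominated_eq0 (c C : R) : (forall y, `|c| <= C * expR y) -> c = 0.
Proof.
move=> h; apply/eqP/negPn/negP => c0.
have c1 : 0 < `|c| by rewrite normr_gt0.
have C0 : 0 <= C by have := h 0; rewrite expR0; lra.
(* At this [y], [expR q >= 1 + q] with [q = C / |c|] gives [|c| * expR q >= |c| + C], more than the
   bound [C]. *)
have := h (- (C / `|c|)); rewrite expRN.
have := expR_ge1Dx (C / `|c|); set q := C / `|c|; set E := expR q => hE.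
have q0 : 0 <= q by rewrite divr_ge0// ltW.
have E0 : 0 < E by exact: expR_gt0.
rewrite ler_pdivlMr// => hh.
have := ler_wpM2l (ltW c1) hE; rewrite mulrDr mulr1 mulrCA divff ?mulr1; last by rewrite gt_eqF.
lra.
Qed.

Lemma integrable_expR_Ny (y : R) :
  (@lebesgue_measure R).-integrable `]-oo, y] (EFin \o expR) /\
  \int[lebesgue_measure]_(x in `]-oo, y]) (expR x) = expR y.
Proof.
have I : (\int[@lebesgue_measure R]_(x in `]-oo, y]) (expR x)%:E = (expR y)%:E)%E.
  have -> : y = - (- y) by rewrite opprK.
  rewrite ge0_integration_by_substitutionNy; last 2 first.
  - exact/continuous_subspaceT/continuous_expR.
  - by move=> x _; exact: expR_ge0.
  have ex : forall x : R, is_derive x (1 : R) (fun x => - expR (- x)) (expR (- x)).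
    move=> x; apply: trigger_derive.
    by rewrite /GRing.scale /= mulrN1 opprK.
  rewrite (@ge0_continuous_FTC2y _ (expR \o -%R) (fun x => - expR (- x)) _ 0).
  - by rewrite sub0e EFinN oppeK.
  - by move=> x _; exact: expR_ge0.
  - apply/continuous_subspaceT => x; apply: continuous_comp; first exact: opp_continuous.
    exact: continuous_expR.
  - rewrite -oppr0; apply: cvgN; exact: cvgr_expR.
  - by move=> x _; exact: (@ex_derive _ _ _ _ _ _ _ (ex x)).
  - apply: cvg_at_right_filter.
    apply: cvgN; apply: (continuous_comp (f := -%R) (g := @expR R)).
      exact: opp_continuous.
    exact: continuous_expR.
  - by move=> x _; rewrite derive1E derive_val.
split; last by rewrite /Rintegral I.
apply/integrableP; split.
  by apply/measurable_EFinP; apply: measurable_funTS; exact: measurable_expR.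
under eq_integral do rewrite /= ger0_norm ?expR_ge0//.
by rewrite I ltry.
Qed.

(* [laplace phi y] is the integral of [expR s * phi (- s)] over [s <= y], so that
   [expR t * laplace phi (- t)] is the bounded solution of [y' = y - phi]. *)
Definition laplace (phi : R -> R) (y : R) : R :=
  \int[lebesgue_measure]_(s in `]-oo, y]) (expR s * phi (- s)).

Definition bounded_continuous (phi : R -> R) (C : R) :=
  continuous phi /\ forall t, `|phi t| <= C.

Lemma laplace_integrable phi C y : bounded_continuous phi C ->
  (@lebesgue_measure R).-integrable `]-oo, y]
    (EFin \o (fun s => expR s * phi (- s))).
Proof.
move=> [cphi bphi]; have [i _] := integrable_expR_Ny y.
have C0 : 0 <= C by apply: le_trans (bphi 0).
have iC : (@lebesgue_measure R).-integrable `]-oo, y] (fun x => (C%:E * (expR x)%:E)%E).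
  by apply: integrableZl.
apply: le_integrable iC => //.
  apply/measurable_EFinP; apply: measurable_funTS; apply: measurable_funM.
    exact: measurable_expR.
  apply: continuous_measurable_fun => x; apply: continuous_comp; last exact: cphi.
  exact: opp_continuous.
move=> x _ /=; rewrite lee_fin !normrM mulrC (ger0_norm (expR_ge0 x)) (ger0_norm C0).
by apply: ler_wpM2r; rewrite ?expR_ge0.
Qed.

Lemma laplace_bound phi C y : bounded_continuous phi C -> `|laplace phi y| <= C * expR y.
Proof.
move=> bc; have i := laplace_integrable y bc; have [iE <-] := integrable_expR_Ny y.
apply: le_trans (le_normr_Rintegral _ i) _ => //.
rewrite -RintegralZl//; apply: le_Rintegral => //.
- by move/integrable_norm : i; apply: eq_integrable.
- exact: (integrableZl _ C iE).
move=> x _; rewrite normrM (ger0_norm (expR_ge0 x)) mulrC.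
by apply: ler_wpM2r; rewrite ?expR_ge0//; case: bc.
Qed.

Lemma laplaceD phi psi C D k y :
  bounded_continuous phi C -> bounded_continuous psi D ->
  laplace (fun s => phi s + k * psi s) y = laplace phi y + k * laplace psi y.
Proof.
move=> h1 h2; rewrite /laplace -RintegralZl//; last exact: laplace_integrable h2.
rewrite -RintegralD//; last 2 first.
- exact: laplace_integrable h1.
- exact: (integrableZl _ k (laplace_integrable y h2)).
by apply: eq_Rintegral => x _; ring.
Qed.

Lemma laplace_derive phi C y : bounded_continuous phi C ->
  is_derive y (1 : R) (laplace phi) (expR y * phi (- y)).
Proof.
move=> h; have [] := @continuous_FTC1 R (fun s => expR s * phi (- s)) -oo%O y (y + 1).
- by rewrite ltrDl.
- exact: laplace_integrable h.
- by rewrite ltNyr.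
- apply: (@continuousM _ R expR (phi \o -%R)); first exact: continuous_expR.
  apply: continuous_comp; first exact: opp_continuous.
  exact: h.1.
by move=> d e; exact: (DeriveDef d (etrans (esym (derive1E _ _)) e)).
Qed.

Lemma laplace_solution phi C t : bounded_continuous phi C ->
  is_derive t (1 : R) (fun t => expR t * laplace phi (- t)) (expR t * laplace phi (- t) - phi t).
Proof.
move=> h; have D := laplace_derive (- t) h.
have Dc : is_derive t (1 : R) (fun t => laplace phi (- t)) (- (expR (- t) * phi t)).
  have Do : is_derive t (1 : R) (-%R : R -> R) (-1).
    by apply: trigger_derive.
  apply: (trigger_derive (is_derive1_comp D Do)).
  by rewrite opprK mulrN1.
apply: trigger_derive; rewrite /GRing.scale /= mulrN mulrA -expRD subrr expR0.
by rewrite mul1r addrC mulrC.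
Qed.

(** A change of variables obtained by uniqueness: with upper limits [y] and [y - t] both sides have
    the same derivative in [y], and their constant difference is dominated by a multiple of
    [expR y]. *)
Lemma laplace_shift phi C t : bounded_continuous phi C ->
  laplace (fun s => phi (s + t)) 0 = expR t * laplace phi (- t).
Proof.
move=> h; have h' : bounded_continuous (fun s => phi (s + t)) C.
  split=> [x|s]; last exact: h.2.
  apply: (continuous_comp (f := fun s => s + t)); last exact: h.1.
  by apply: cvgD; [exact: cvg_id|exact: cvg_cst].
pose G y := laplace (fun s => phi (s + t)) y - expR t * laplace phi (y - t).
have dG (x : R) : is_derive x (1 : R) G 0.
  have D1 := laplace_derive x h'; have D2 := laplace_derive (x - t) h.
  have D3 : is_derive x (1 : R) (fun y => laplace phi (y - t)) (expR (x - t) * phi (- (x - t))).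
    have Do : is_derive x (1 : R) (fun y => y - t) 1.
      by apply: trigger_derive; rewrite subr0.
    by apply: (trigger_derive (@is_derive1_comp _ (laplace phi) (fun y => y - t) x _ _ D2 Do)); rewrite mulr1.
  apply: trigger_derive; rewrite /GRing.scale /= mulrA -expRD subrKC opprB.
  by rewrite [t - x]addrC subrr.
have cG y : G 0 = G y by exact: is_derive_0_is_cst.
have : G 0 = 0.
  apply: (@exp_dominated_eq0 _ (2 * C)) => y; rewrite (cG y).
  apply: le_trans (ler_normB _ _) _; rewrite normrM (ger0_norm (expR_ge0 t)).
  have b1 := laplace_bound y h'.
  have := ler_wpM2l (expR_ge0 t) (laplace_bound (y - t) h).
  by rewrite mulrCA -expRD subrKC; lra.
by rewrite /G sub0r => /eqP; rewrite subr_eq0 => /eqP.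
Qed.

End Calculus.

(** * Strong derivatives of vector-valued curves *)

Section StrongDerivative.
Context {R : realType} {E : hilbertType R}.
Implicit Types (u v w da db : E) (a b : R -> E) (t h e : R).

(** An estimate in place of a limit of quotients: it makes sense at [h = 0] and survives linear
    isometries and contractions. *)
Definition strong_derive a t da := forall e, 0 < e -> exists2 d : R, 0 < d &
  forall h : R, `|h| < d -> nrm (a (t + h) - a t - h%:C *: da) <= e * `|h|.

Lemma strong_derive_cst v t : strong_derive (fun=> v) t 0.
Proof.
move=> e e0; exists 1 => // h _; rewrite subrr scaler0 subrr nrm0.
by rewrite mulr_ge0// ltW.
Qed.

Lemma strong_derive_re a b t da db : strong_derive a t da -> strong_derive b t db ->
  is_derive t (1 : R) (fun s => re (a s) (b s)) (re da (b t) + re (a t) db).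
Proof.
move=> ha hb; apply: is_derive_of_small_o => e e0.
(* [A] controls the term of order [h ^+ 2] and [B] the remainders; capping [e1] and [h] by 1 bounds
   the remainder of [b] where it occurs inside a product. *)
pose A := nrm da * nrm db; pose B := nrm (a t) + nrm da + nrm (b t) + nrm db + 1.
have A0 : 0 <= A by rewrite /A mulr_ge0 ?nrm_ge0.
have B0 : 0 < B.
  by rewrite /B; have := nrm_ge0 (a t); have := nrm_ge0 da;
     have := nrm_ge0 (b t); have := nrm_ge0 db; lra.
pose e1 := Num.min 1 (e / 2 / B).
have e10 : 0 < e1 by rewrite lt_min ltr01 !divr_gt0.
have [d1 d10 h1] := ha _ e10; have [d2 d20 h2] := hb _ e10.
have A1 : 0 < A + 1 by lra.
exists (Num.min 1 (Num.min (Num.min d1 d2) (e / 2 / (A + 1)))).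
  by rewrite !lt_min ltr01 d10 d20 !divr_gt0.
move=> h; rewrite !lt_min => /andP[hl1 /andP[/andP[hd1 hd2] hA]].
set r := a (t + h) - a t - h%:C *: da; set s := b (t + h) - b t - h%:C *: db.
have hr : nrm r <= e1 * `|h| := h1 h hd1.
have hs : nrm s <= e1 * `|h| := h2 h hd2.
have ea : a (t + h) = a t + h%:C *: da + r by rewrite /r -[_ - a t - _]addrA -opprD subrKC.
have eb : b (t + h) = b t + h%:C *: db + s by rewrite /s -[_ - b t - _]addrA -opprD subrKC.
have -> : re (a (t + h)) (b (t + h)) - re (a t) (b t) - h * (re da (b t) + re (a t) db) =
  h * (h * re da db) + re (a t + h%:C *: da) s + re r (b t + h%:C *: db + s).
  by rewrite ea eb !reE; ring.
have H0 := normr_ge0 h.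
have e11 : e1 <= 1 by rewrite ge_min lexx.
have e1B : e1 * B <= e / 2 by rewrite -ler_pdivlMr// ge_min lexx orbT.
have i1 : `|h * (h * re da db)| <= `|h| * (e / 2).
  rewrite normrM ler_wpM2l// normrM.
  have := cauchy_schwarz da db; rewrite -/A => hh.
  have : `|h| * (A + 1) <= e / 2 by rewrite -ler_pdivlMr// ltW.
  have := ler_wpM2l H0 hh; lra.
have na : nrm (a t + h%:C *: da) <= nrm (a t) + nrm da.
  apply: le_trans (nrmD _ _) _; rewrite lerD2l nrmZr.
  by rewrite -[leRHS]mul1r ler_wpM2r ?nrm_ge0// ltW.
have eh1 : e1 * `|h| <= 1.
  by rewrite -[leRHS]mulr1; apply: ler_pM => //; exact: ltW.
have nb : nrm (b t + h%:C *: db + s) <= nrm (b t) + nrm db + 1.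
  apply: le_trans (nrmD _ _) _; apply: lerD; last exact: le_trans hs eh1.
  apply: le_trans (nrmD _ _) _; rewrite lerD2l nrmZr.
  by rewrite -[leRHS]mul1r ler_wpM2r ?nrm_ge0// ltW.
have i2 : `|re (a t + h%:C *: da) s| <= (nrm (a t) + nrm da) * (e1 * `|h|).
  by apply: le_trans (cauchy_schwarz _ _) _; apply: ler_pM; rewrite ?nrm_ge0.
have i3 : `|re r (b t + h%:C *: db + s)| <= (e1 * `|h|) * (nrm (b t) + nrm db + 1).
  by apply: le_trans (cauchy_schwarz _ _) _; apply: ler_pM; rewrite ?nrm_ge0.
apply: le_trans (ler_normD _ _) _.
apply: le_trans (lerD (ler_normD _ _) (lexx _)) _.
have := ler_wpM2r H0 e1B; rewrite /B; lra.
Qed.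

End StrongDerivative.

(** * Generator of a unitary one-parameter group *)

Section Generator.
Context {R : realType} {E : hilbertType R}.
Implicit Types (U : R -> {linear E -> E}) (x y z u v w : E) (s t h e : R).

Section GroupBasics.
Context (U : R -> {linear E -> E}) (HU : unitary_one_parameter_group U).

Lemma U_inner t u v : inner (U t u) (U t v) = inner u v.
Proof. by case: HU => h _ _ _; case: (h t). Qed.
Lemma U_re t u v : re (U t u) (U t v) = re u v.
Proof. by rewrite /re U_inner. Qed.
Lemma U_nrm t u : nrm (U t u) = nrm u.
Proof. by rewrite /nrm U_re. Qed.
Lemma U_0 u : U 0 u = u. Proof. by case: HU. Qed.
Lemma U_D s t u : U (s + t) u = U s (U t u). Proof. by case: HU. Qed.
Lemma U_KN t u : U t (U (- t) u) = u.
Proof. by rewrite -U_D subrr U_0. Qed.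
Lemma U_adj t u v : inner (U t u) v = inner u (U (- t) v).
Proof. by rewrite -[v in LHS](U_KN t) U_inner. Qed.
Lemma U_readj t u v : re (U t u) v = re u (U (- t) v).
Proof. by rewrite /re U_adj. Qed.
Lemma U_comm s t u : U s (U t u) = U t (U s u).
Proof. by rewrite -!U_D addrC. Qed.

Lemma U_cont v e : 0 < e -> exists2 d : R, 0 < d &
  forall h, `|h| < d -> nrm (U h v - v) < e.
Proof.
move=> e0; have [_ _ _ /(_ v 0) h] := HU.
have : nbhs (U 0 v) [set u | nrm (U 0 v - u) < e] by apply/nbhs_nrm; exists e.
move=> /h /nbhs_ballP[d /= d0 hd]; exists d => // k kd.
have := hd k; rewrite /ball /= sub0r normrN => /(_ kd).
by rewrite /= U_0 nrmB.
Qed.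

End GroupBasics.

(** The group of adjoints; its cogenerator will be the adjoint and the inverse of that of [U]. *)
Definition reverse U t := U (- t).

Lemma reverse_group U : unitary_one_parameter_group U ->
  unitary_one_parameter_group (reverse U).
Proof.
move=> [h1 h2 h3 h4]; split => //; first by move=> t; exact: h1.
- by move=> v; rewrite /reverse oppr0.
- by move=> s t v; rewrite /reverse opprD.
- move=> v t; rewrite /reverse; apply: (continuous_comp (f := -%R) (g := fun t => U t v)).
    exact: opp_continuous.
  exact: h4.
Qed.

(** The graph of Stone's generator: the operator is unbounded, so it is kept as a relation between
    [x] in its domain and the value [y]. *)
Definition generator U x y := strong_derive (fun t => U t x) 0 y.

Lemma generatorP U x y : unitary_one_parameter_group U ->
  generator U x y <-> forall e, 0 < e -> exists2 d : R, 0 < d &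
    forall h, `|h| < d -> nrm (U h x - x - h%:C *: y) <= e * `|h|.
Proof.
move=> HU; split=> H e e0; have [d d0 hd] := H e e0; exists d => // h hhd.
  by have := hd h hhd; rewrite add0r U_0.
by rewrite add0r U_0//; exact: hd.
Qed.

Section GenTheory.
Context (U : R -> {linear E -> E}) (HU : unitary_one_parameter_group U).

Lemma generator_sder x y t : generator U x y -> strong_derive (fun s => U s x) t (U t y).
Proof.
move=> /(generatorP _ _ HU) H e e0; have [d d0 hd] := H e e0; exists d => // h hhd.
by rewrite (U_D HU) -(linearZZ (U t)) -!(linearB (U t)) (U_nrm HU); exact: hd.
Qed.

Lemma generator_U x y t : generator U x y -> generator U (U t x) (U t y).
Proof.
move=> /(generatorP _ _ HU) H; apply/(generatorP _ _ HU) => e e0.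
have [d d0 hd] := H e e0; exists d => // h hhd.
by rewrite (U_comm HU) -(linearZZ (U t)) -!(linearB (U t)) (U_nrm HU); exact: hd.
Qed.

Lemma generator_lin (k : R[i]) x y x' y' : generator U x y -> generator U x' y' ->
  generator U (k *: x + x') (k *: y + y').
Proof.
move=> /(generatorP _ _ HU) H /(generatorP _ _ HU) H'; apply/(generatorP _ _ HU) => e e0.
have c0 : 0 <= Normc.normc k by case: (k) => *; exact: sqrtr_ge0.
have c1 : 0 < 2 * (Normc.normc k + 1) by lra.
have e2 : 0 < e / 2 by lra.
have [d d0 hd] := H _ (divr_gt0 e0 c1); have [d' d'0 hd'] := H' _ e2.
exists (Num.min d d'); first by rewrite lt_min d0.
move=> h; rewrite lt_min => /andP[h1 h2].
have -> : U h (k *: x + x') - (k *: x + x') - h%:C *: (k *: y + y') =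
    k *: (U h x - x - h%:C *: y) + (U h x' - x' - h%:C *: y').
  rewrite linearP scalerDr !scalerBr !scalerA [h%:C * k]mulrC.
  by rewrite !opprD [RHS]addrACA; congr (_ + _); rewrite addrACA.
apply: le_trans (nrmD _ _) _; rewrite nrmZ.
have := hd h h1; have := hd' h h2 => i2 i1.
have := ler_wpM2l c0 i1.
have -> : Normc.normc k * (e / (2 * (Normc.normc k + 1)) * `|h|) =
   e / 2 * `|h| * (Normc.normc k / (Normc.normc k + 1)) by field; lra.
have q1 : Normc.normc k / (Normc.normc k + 1) <= 1.
  by rewrite ler_pdivrMr ?mul1r; lra.
have eh : 0 <= e / 2 * `|h| by rewrite mulr_ge0// ltW.
have := ler_wpM2l eh q1; lra.
Qed.

(** Differentiate the constant function [re (U s x) (U s x')] at 0. *)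
Lemma generator_skew x y x' y' : generator U x y -> generator U x' y' -> re y x' + re x y' = 0.
Proof.
move=> g g'; have := strong_derive_re g g'; rewrite !(U_0 HU) => -[_ <-].
have -> : (fun s => re (U s x) (U s x')) = cst (re x x').
  by apply/funext => s; rewrite U_re.
exact: derive_cst.
Qed.

Lemma generator0_eq y : generator U 0 y -> y = 0.
Proof.
move=> /(generatorP _ _ HU) H; apply: nrm0_eq0; apply/eqP; rewrite eq_le nrm_ge0 andbT.
apply/ler_addgt0Pr => e e0; have [d d0 hd] := H e e0.
have d2 : `|d / 2| = d / 2 by rewrite gtr0_norm// divr_gt0.
have dd : 0 < d / 2 by lra.
have ddd : d / 2 < d by lra.
have := hd (d / 2); rewrite d2 linear0 subrr sub0r nrmN nrmZr d2 => /(_ ddd).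
by rewrite add0r [leRHS]mulrC ler_pM2l.
Qed.

Lemma generator_re x y u t : generator U x y ->
  is_derive t (1 : R) (fun s => re (U s x) u) (re (U t y) u).
Proof.
move=> g; have := strong_derive_re (generator_sder t g) (@strong_derive_cst R E u t).
by rewrite re0r addr0.
Qed.

Lemma orbit_bounded w u : bounded_continuous (fun t => re (U t w) u) (nrm w * nrm u).
Proof.
split=> [t|t]; last by apply: le_trans (cauchy_schwarz _ _) _; rewrite (U_nrm HU).
apply/cvgrPdist_lt => e e0.
have c0 : 0 < nrm u + 1 by have := nrm_ge0 u; lra.
have [d d0 hd] := U_cont HU w (divr_gt0 e0 c0).
near=> s; have st : `|s - t| < d by rewrite distrC; near: s; apply/nbhs_ballP; exists d.
have -> : re (U t w) u - re (U s w) u = - re (U t (U (s - t) w - w)) u.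
  by rewrite linearB -(U_D HU) subrKC !reE; ring.
rewrite normrN; apply: le_lt_trans (cauchy_schwarz _ _) _; rewrite (U_nrm HU).
have := hd _ st; rewrite ltr_pdivlMr// => h; apply: le_lt_trans h.
by apply: ler_wpM2l; rewrite ?nrm_ge0 ?lerDl.
Unshelve. all: by end_near. Qed.

(* Weakly, [x] is the integral of [expR (- s) * U s w] over [s >= 0]. *)
Lemma generator_ex w : exists x, generator U x (x - w).
Proof.
pose l u := laplace (fun t => re (U t w) u) 0.
have [||||x _ hx] := @riesz_representation R E setT l (nrm w).
- by split.
- exact: closedT.
- move=> k u v _ _; rewrite /l -(laplaceD k 0 (orbit_bounded w u) (orbit_bounded w v)).
  by congr laplace; apply/funext => s; rewrite !reE.
- move=> u _; have := laplace_bound 0 (orbit_bounded w u).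
  by rewrite expR0 mulr1.
(* By [laplace_shift] the orbit of [x], paired with any [u], is the bounded solution of
   [y' = y - phi] with [phi] the paired orbit of [w]. This gives weak differentiability. *)
have yE u t : re (U t x) u = expR t * laplace (fun s => re (U s w) u) (- t).
  rewrite (U_readj HU) hx// /l -(laplace_shift t (orbit_bounded w u)).
  congr laplace; apply/funext => s.
  by rewrite -(U_readj HU) -(U_D HU) addrC.
exists x; apply/(generatorP _ _ HU) => e e0.
set z := x - w; have [d d0 hd] := U_cont HU z e0; exists d => // h hhd.
set r := U h x - x - h%:C *: z.
have dy u t : is_derive t (1 : R) (fun s => re (U s x) u) (re (U t z) u).
  have -> : (fun s => re (U s x) u) =
      (fun t => expR t * laplace (fun s => re (U s w) u) (- t)) by apply/funext => s.
  rewrite linearB reDl reNl yE; exact: laplace_solution (orbit_bounded w u).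
(* Weak differentiability becomes strong by testing with the remainder [r] itself: the mean value
   theorem bounds [re r r] by [e * |h| * nrm r], as [U c z - z] is small in norm for all [c] between
   0 and [h]. *)
have key : re r r <= e * `|h| * nrm r.
  pose f s := re (U s x) r - s * re z r.
  have df t : is_derive t (1 : R) f (re (U t z - z) r).
    have D := dy r t; apply: trigger_derive.
    by rewrite /GRing.scale /= !reE mulr1 mulr0 add0r.
  have fE : f h - f 0 = re r r.
    by rewrite /f (U_0 HU) mul0r {2}/r !reE; ring.
  have bound s : `|s| < d -> `|re (U s z - z) r| <= e * nrm r.
    move=> sd; apply: le_trans (cauchy_schwarz _ _) _; apply: ler_wpM2r; first exact: nrm_ge0.
    by apply: ltW; exact: hd.
  have [h0|h0|h0] := ltgtP 0 h; last first.
  - by rewrite -h0 subrr in fE; rewrite -fE -h0 normr0 mulr0 mul0r.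
  - have [|c /[!in_itv]/= /andP[c1 c2]] := @MVT R f (fun t => re (U t z - z) r) h 0 h0.
    + by apply: derivable_within_continuous => t _; exact: (@ex_derive _ _ _ _ _ _ _ (df t)).
    move=> eq1; rewrite -fE -opprB eq1 sub0r mulrN opprK ltr0_norm//.
    have cd : `|c| < d.
      by apply: le_lt_trans hhd; rewrite !ltr0_norm// lerN2 ltW.
    have := bound c cd; rewrite ler_norml => /andP[b1 _].
    have h0' : 0 <= - h by lra.
    have := ler_wpM2r h0' b1; lra.
  - have [|c /[!in_itv]/= /andP[c1 c2]] := @MVT R f (fun t => re (U t z - z) r) 0 h h0.
    + by apply: derivable_within_continuous => t _; exact: (@ex_derive _ _ _ _ _ _ _ (df t)).
    move=> eq1; rewrite -fE eq1 subr0 gtr0_norm//.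
    have cd : `|c| < d.
      by apply: le_lt_trans hhd; rewrite !gtr0_norm// ltW.
    have := bound c cd; rewrite ler_norml => /andP[_ b1].
    have := ler_wpM2r (ltW h0) b1; lra.
have [r0|r0] := eqVneq (nrm r) 0; first by rewrite r0 mulr_ge0// ltW.
have rp : 0 < nrm r by rewrite lt_neqAle eq_sym r0 nrm_ge0.
by move: key; rewrite -nrm_sqr expr2 ler_pM2r.
Qed.

End GenTheory.

End Generator.

(** * Resolvent and Cayley transform *)

Section Cayley.
Context {R : realType} {E : hilbertType R}.
Implicit Types (U : R -> {linear E -> E}) (x y z u v w m : E) (s t h e : R) (K : set E).

Definition resolvent U w : E := xget 0 [set x | generator U x (x - w)].

(* The cogenerator [(A + 1) / (A - 1)] of the group generated by [A], where
   [resolvent] is [1 / (1 - A)]. *)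
Definition cayley U w : E := w - (resolvent U w + resolvent U w).

Section CayleyIsometry.
Context (U : R -> {linear E -> E}) (HU : unitary_one_parameter_group U).

Lemma resolvent_gen w : generator U (resolvent U w) (resolvent U w - w).
Proof. by rewrite /resolvent; case: xgetP => // h; have [x hx] := generator_ex HU w; case: (h x hx). Qed.

(** The difference [d] of two solutions satisfies [A d = d], and skewness gives [2 * re d d = 0]. So
    the choice made in [resolvent] is immaterial. *)
Lemma resolvent_unique x w : generator U x (x - w) -> resolvent U w = x.
Proof.
move=> hx; have g := generator_lin HU (-1) hx (resolvent_gen w).
rewrite !scaleN1r in g; have := generator_skew HU g g.
have -> : - (x - w) + (resolvent U w - w) = - x + resolvent U w.
  by rewrite opprB [w - x]addrC addrACA subrr addr0.
rewrite reC -mulr2n => /eqP; rewrite mulrn_eq0 /= => /eqP /re0_eq0 /eqP.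
by rewrite addrC subr_eq0 => /eqP.
Qed.

Lemma resolvent_gen_eq x y : generator U x y -> resolvent U (x - y) = x.
Proof. by move=> g; apply: resolvent_unique; rewrite opprB addrC subrK. Qed.

Lemma resolvent_linear (a : R[i]) u v : resolvent U (a *: u + v) = a *: resolvent U u + resolvent U v.
Proof.
apply: resolvent_unique; have := generator_lin HU a (resolvent_gen u) (resolvent_gen v).
by rewrite scalerBr opprD [X in generator _ _ X]addrACA.
Qed.

Lemma resolvent_U t w : resolvent U (U t w) = U t (resolvent U w).
Proof. by apply: resolvent_unique; rewrite -linearB; exact/generator_U/resolvent_gen. Qed.

Lemma cayley_linear (a : R[i]) u v : cayley U (a *: u + v) = a *: cayley U u + cayley U v.
Proof.
rewrite /cayley resolvent_linear scalerBr scalerDr [X in _ = X]addrACA -opprD.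
by congr (_ - _); rewrite addrACA.
Qed.

Lemma cayleyZ (a : R[i]) u : cayley U (a *: u) = a *: cayley U u.
Proof.
have c0 : cayley U 0 = 0.
  have := cayley_linear 1 0 0; rewrite !scale1r addr0 => /eqP.
  by rewrite eq_sym -subr_eq0 addrK => /eqP.
by rewrite -[a *: u]addr0 cayley_linear c0 !addr0.
Qed.

Lemma cayleyB u v : cayley U (u - v) = cayley U u - cayley U v.
Proof. by rewrite [u - v]addrC -scaleN1r cayley_linear scaleN1r addrC. Qed.

Lemma cayley_U t w : cayley U (U t w) = U t (cayley U w).
Proof. by rewrite /cayley resolvent_U (linearB (U t)) (linearD (U t)). Qed.

(** With resolvents [x] and [y] of [u] and [v], expansion leaves [re u v] plus twice
    [2 * re x y - re x v - re u y], which vanishes by skewness. *)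
Lemma cayley_re u v : re (cayley U u) (cayley U v) = re u v.
Proof.
have := generator_skew HU (resolvent_gen u) (resolvent_gen v); rewrite /cayley !reE.
by lra.
Qed.

Lemma cayley_inner u v : inner (cayley U u) (cayley U v) = inner u v.
Proof. by rewrite !inner_re -cayleyZ !cayley_re. Qed.

Lemma cayley_nrm u : nrm (cayley U u) = nrm u.
Proof. by rewrite /nrm cayley_re. Qed.

(** Density of the domain of the generator. For the resolvent [x] of [z], skewness gives
    [re x x = re z x = 0]; then [A 0 = - z], hence [z = 0]. *)
Lemma resolvent_dense z : (forall w, re z (resolvent U w) = 0) -> z = 0.
Proof.
move=> h; have x0 : resolvent U z = 0.
  have := generator_skew HU (resolvent_gen z) (resolvent_gen z).
  rewrite !reE h (reC (resolvent U z) z) h => e.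
  by apply: re0_eq0; lra.
by have := resolvent_gen z; rewrite x0 sub0r => /(generator0_eq HU)/eqP; rewrite oppr_eq0 => /eqP.
Qed.

End CayleyIsometry.

Lemma generator_op U x y : unitary_one_parameter_group U -> generator (reverse U) x (- y) -> generator U x y.
Proof.
move=> HU /(generatorP _ _ (reverse_group HU)) H; apply/(generatorP _ _ HU) => e e0.
have [d d0 hd] := H e e0; exists d => // h hd'.
have := hd (- h); rewrite normrN /reverse opprK rmorphN scalerN scaleNr opprK.
exact.
Qed.

Lemma reverseK U : reverse (reverse U) = U.
Proof. by apply/funext => t; rewrite /reverse opprK. Qed.

Section CayleyInverse.
Context (U : R -> {linear E -> E}) (HU : unitary_one_parameter_group U).
Let HUo := reverse_group HU.

Lemma resolvent_op_gen w : generator U (resolvent (reverse U) w) (w - resolvent (reverse U) w).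
Proof. by apply: generator_op => //; rewrite opprB; exact: resolvent_gen. Qed.

Lemma resolvent_adj u v : re (resolvent U u) v = re u (resolvent (reverse U) v).
Proof.
have := generator_skew HU (resolvent_gen HU u) (resolvent_op_gen v); rewrite !reE.
lra.
Qed.

(** With [x + A x = w], the vector [- x] satisfies [(1 - A) (- x) = w - 2 x], so it is the resolvent
    of [U] at [cayley (reverse U) w]. *)
Lemma cayley_opK w : cayley U (cayley (reverse U) w) = w.
Proof.
set x := resolvent (reverse U) w; have g := resolvent_op_gen w; rewrite -/x in g.
have g' : generator U (- x) (x - w).
  have g0 : generator U 0 0.
    move=> e e0; exists 1 => // h _ /=.
    by rewrite !linear0 !addr0 nrm0 mulr_ge0// ltW.
  by have := generator_lin HU (-1) g g0; rewrite !scaleN1r !addr0 opprB.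
rewrite /cayley -/x (_ : resolvent U _ = - x).
  by rewrite -opprD opprK subrK.
by apply: resolvent_unique => //; rewrite opprB -[x + x - w]addrA addKr.
Qed.

Lemma cayleyK_op w : cayley (reverse U) (cayley U w) = w.
Proof.
apply/eqP; rewrite -subr_eq0; apply/eqP/nrm0_eq0.
by rewrite -(cayley_nrm HU) cayleyB// cayley_opK subrr nrm0.
Qed.

Lemma cayley_adj u v : inner (cayley U u) v = inner u (cayley (reverse U) v).
Proof. by rewrite -{1}[v]cayley_opK cayley_inner. Qed.

(** This carries invariance of a subspace from [cayley] to the resolvents, and through them to the
    generator. *)
Lemma resolvent_cayley w : resolvent U w = (2^-1 : R)%:C *: (w - cayley U w).
Proof.
rewrite /cayley subKr scalerDr -scalerDl -rmorphD.
have -> : 2^-1 + 2^-1 = 1 :> R by lra.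
by rewrite scale1r.
Qed.

End CayleyInverse.

(** * Subspaces invariant under the semigroup or reduced by the cogenerator *)

Section InvariantSubspaces.
Context (U : R -> {linear E -> E}) (HU : unitary_one_parameter_group U).
Context (K : set E) (hK : closed_subspace K)
  (KU : forall t v, 0 <= t -> K v -> K (U t v)).

(** The resolvent is an average of [U s w] over positive times, so it stays in [K]. In weak form:
    for [z'] orthogonal to [K], the function [expR (- t) * re (U t x) z'] has derivative
    [- expR (- t) * re (U t w) z' = 0], and it decays. *)
Lemma resolvent_sub w : K w -> K (resolvent U w).
Proof.
move=> Kw; apply: mem_closed_subspace => // z hz; set x := resolvent U w.
have key z' : (forall u, K u -> inner z' u = 0) -> re x z' = 0.
  move=> hz'; pose f t := expR (- t) * re (U t x) z'.
  have df t : 0 <= t -> is_derive t (1 : R) f 0.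
    move=> t0; have D := generator_re HU z' t (resolvent_gen HU w); rewrite -/x in D.
    have D2 : is_derive t (1 : R) (fun s => expR (- s)) (- expR (- t)).
      by apply: trigger_derive; rewrite /GRing.scale /= mulrN1.
    apply: trigger_derive; rewrite /GRing.scale /= linearB reDl reNl.
    have -> : re (U t w) z' = 0 by rewrite reC /re hz'//; exact: KU.
    ring.
  have f0 : f 0 = re x z' by rewrite /f oppr0 expR0 mul1r (U_0 HU).
  have fb t : 0 <= t -> `|f 0| <= expR (- t) * (nrm x * nrm z').
    move=> t0; rewrite (derive0_eq t0 df) normrM ger0_norm ?expR_ge0//.
    by apply: ler_wpM2l; rewrite ?expR_ge0// -(U_nrm HU t x) cauchy_schwarz.
  rewrite -f0; apply: (@exp_dominated_eq0 _ _ (nrm x * nrm z')) => y.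
  (* For [y <= 0] the decay at time [- y] is used; for [y > 0] the bound at time 0 suffices because
     [expR y >= 1]. *)
  have [y0|y0] := leP y 0.
    by have := fb (- y); rewrite opprK mulrC oppr_ge0; apply.
  apply: le_trans (fb 0 (lexx _)) _; rewrite oppr0 expR0 mul1r.
  rewrite -[leLHS]mulr1; apply: ler_wpM2l; first by rewrite mulr_ge0 ?nrm_ge0.
  by rewrite -expR0 ler_expR ltW.
rewrite innerC (_ : inner z x = 0) ?conjc0//; rewrite innerC; apply/eqP.
rewrite conjc_eq0; apply/eqP/inner_eq0P; split; apply: key => // u Ku.
by rewrite innerZl hz ?mulr0.
Qed.

Lemma cayley_sub w : K w -> K (cayley U w).
Proof. by move=> Kw; have [h _] := hK; have := resolvent_sub Kw => Kr; apply: subspaceB => //; exact: subspaceD. Qed.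

(** Orthogonality of [m] to [cayley U (U s u)] reads [re (U s u) m = 2 * re (U s x) m] for the
    resolvent [x] of [u], whence [expR s * re (U s x) m] has derivative zero. Thus [m] is an
    eigenvector of the compressed adjoint semigroup. *)
Lemma eigen_of_cayley m : (forall u, K u -> re (cayley U u) m = 0) ->
  forall u t, K u -> 0 <= t -> re (U t u) m = expR (- t) * re u m.
Proof.
move=> hm u t Ku t0; set x := resolvent U u.
have psi s : 0 <= s -> re (U s u) m = 2 * re (U s x) m.
  move=> s0; have := hm _ (KU s0 Ku); rewrite cayley_U// /cayley -/x.
  rewrite linearB linearD !reE; lra.
pose f s := expR s * re (U s x) m.
have df s : 0 <= s -> is_derive s (1 : R) f 0.
  move=> s0; have D := generator_re HU m s (resolvent_gen HU u); rewrite -/x in D.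
  apply: trigger_derive; rewrite /GRing.scale /= linearB reDl reNl psi//; ring.
have f0 := derive0_eq t0 df.
have p0 := psi 0 (lexx _); rewrite !(U_0 HU) in p0; rewrite psi// p0.
have : re x m = f 0 by rewrite /f expR0 mul1r (U_0 HU).
rewrite f0 /f => ->.
by rewrite mulrCA [expR (- t) * _]mulrA -expRD addNr expR0 mul1r.
Qed.

(** Converse of [eigen_of_cayley]. The hypothesis makes [expR s * re (U s x) m] constant, while the
    generator gives it the derivative [- re (cayley U u) m] at each [s >= 0]. *)
Lemma cayley_of_eigen m :
  (forall u t, K u -> 0 <= t -> re (U t u) m = expR (- t) * re u m) ->
  forall u, K u -> re (cayley U u) m = 0.
Proof.
move=> hm u Ku; set x := resolvent U u; have Kx : K x := resolvent_sub Ku.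
(* [c] is [- re (cayley U u) m]; comparing [f] at 0 and 1 gives [c = 0]. *)
pose c := 2 * re x m - re u m.
pose f s := expR s * re (U s x) m - s * c.
have df s : 0 <= s -> is_derive s (1 : R) f 0.
  move=> s0; have D := generator_re HU m s (resolvent_gen HU u); rewrite -/x in D.
  apply: trigger_derive; rewrite /GRing.scale /= linearB reDl reNl !hm//.
  rewrite mulr1 mulr0 add0r /c.
  have e : expR s * expR (- s) = 1 by rewrite -expRD subrr expR0.
  have := congr1 (fun q => q * (2 * re x m - re u m)) e; lra.
have := derive0_eq ler01 df; rewrite /f expR0 (U_0 HU) hm// mulrA -expRD subrr expR0.
rewrite /cayley -/x !reE /c; lra.
Qed.

End InvariantSubspaces.

Section ReducingSubspace.
Context (U : R -> {linear E -> E}) (HU : unitary_one_parameter_group U).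
Context (K : set E) (hK : closed_subspace K).

(* The projection onto [K] commutes with the resolvents, hence preserves the
   domain of the generator; as the generator is skew,
   [re (P (U t x)) (U t z)] does not depend on [t]. *)
Lemma reduces_group : (forall v, K v -> K (cayley U v)) ->
  (forall v, K v -> K (cayley (reverse U) v)) -> forall t v, K v -> K (U t v).
Proof.
move=> K1 K2; have HUo := reverse_group HU.
have [lK _] := hK.
have KB v : K v -> K (resolvent U v).
  by move=> Kv; rewrite resolvent_cayley; apply: subspaceZ => //; apply: subspaceB => //; exact: K1.
have KB' v : K v -> K (resolvent (reverse U) v).
  by move=> Kv; rewrite resolvent_cayley; apply: subspaceZ => //; apply: subspaceB => //; exact: K2.
have /choice[P hP] v : exists p, K p /\ forall u, K u -> re (v - p) u = 0.
  by have [p Kp hp] := orthogonal_projection v hK; exists p; split => // u Ku; rewrite /re hp.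
have Puniq v p : K p -> (forall u, K u -> re (v - p) u = 0) -> P v = p.
  move=> Kp hp; apply/eqP; rewrite -subr_eq0; apply/eqP/re0_eq0.
  have KPp : K (P v - p) by apply: subspaceB => //; exact: (hP v).1.
  have := hp _ KPp; have := (hP v).2 _ KPp; rewrite !reE; lra.
have PB u v : P (u - v) = P u - P v.
  apply: Puniq; first by apply: subspaceB => //; [exact: (hP u).1|exact: (hP v).1].
  move=> k Kk; have := (hP u).2 k Kk; have := (hP v).2 k Kk; rewrite !reE; lra.
have PZ (a : R) u : P (a%:C *: u) = a%:C *: P u.
  apply: Puniq; first by apply: subspaceZ => //; exact: (hP u).1.
  by move=> k Kk; rewrite -scalerBr reZl (hP u).2// mulr0.
have Pself u v : re (P u) v = re u (P v).
  have := (hP u).2 _ (hP v).1; have := (hP v).2 _ (hP u).1.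
  rewrite !reE (reC v) (reC (P v)); lra.
have Pnrm u : nrm (P u) <= nrm u.
  have e : re u u = re (P u) (P u) + re (u - P u) (u - P u).
    by have := (hP u).2 _ (hP u).1; rewrite !reE (reC (P u) u); lra.
  by rewrite /nrm ler_wsqrtr// e lerDl re_ge0.
have Pres w : P (resolvent U w) = resolvent U (P w).
  apply: Puniq; first by apply: KB; exact: (hP w).1.
  move=> k Kk.
  have -> : resolvent U w - resolvent U (P w) = resolvent U (w - P w).
    by rewrite addrC -scaleN1r -resolvent_linear// scaleN1r addrC.
  by rewrite resolvent_adj// (hP w).2//; exact: KB'.
have Pgen x y : generator U x y -> generator U (P x) (P y).
  move=> g; have e := resolvent_gen_eq HU g.
  have -> : P y = P x - P (x - y) by rewrite PB opprB addrC subrK.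
  by rewrite -{1 2}e Pres; exact: resolvent_gen.
have Psder x y t : generator U x y -> strong_derive (fun s => P (U s x)) t (P (U t y)).
  move=> g e e0; have [d d0 hd] := generator_sder HU t g e0; exists d => // h hh.
  by rewrite -PZ -!PB; apply: le_trans (Pnrm _) _; exact: hd.
have main x y z y' t : generator U x y -> generator U z y' ->
    re (P (U t x)) (U t z) = re (P x) z.
  move=> g g'; pose f s := re (P (U s x)) (U s z).
  have -> : re (P (U t x)) (U t z) = f t by [].
  have -> : re (P x) z = f 0 by rewrite /f !(U_0 HU).
  apply: is_derive_0_is_cst => s.
  have D := strong_derive_re (Psder _ _ s g) (generator_sder HU s g').
  by rewrite (generator_skew HU (Pgen _ _ (generator_U HU s g)) (generator_U HU s g')) in D.
have PU t x y : generator U x y -> P (U t x) = U t (P x).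
  move=> g; rewrite -[LHS](U_KN HU t); congr (U t _).
  apply/eqP; rewrite -subr_eq0; apply/eqP/(resolvent_dense HU) => w.
  rewrite reDl reNl (U_readj HU) opprK (main _ _ _ _ _ g (resolvent_gen HU w)).
  by rewrite subrr.
move=> t v Kv; have Pv : P v = v by apply: Puniq => // u _; rewrite subrr re0l.
(* [PU] holds on the domain of the generator. Self-adjointness of [P] lets it act on the test
   vectors, which are resolvents and dense, and so reaches [v]. *)
suff <- : P (U t v) = U t v by exact: (hP _).1.
apply/eqP; rewrite -subr_eq0; apply/eqP/(resolvent_dense HU) => w.
rewrite reDl reNl Pself !(U_readj HU) -(PU _ _ _ (resolvent_gen HU w)) -Pself Pv.
by rewrite subrr.
Qed.

End ReducingSubspace.

End Cayley.

(** * Outgoing subspaces from reflection positivity *)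

Section Outgoing.
Context {R : realType} {E : hilbertType R}.
Implicit Types (U : R -> {linear E -> E}) (u v w x z : E) (s t : R) (S A Ep : set E).

Lemma dense_orth S z : dense S -> (forall x, S x -> re z x = 0) -> z = 0.
Proof.
move=> /dense_nrm dS h; apply: nrm0_eq0; apply/eqP; rewrite eq_le nrm_ge0 andbT.
apply/ler_addgt0Pr => e e0; have [x Sx zx] := dS z e e0; rewrite add0r.
have [->|z0] := eqVneq (nrm z) 0; first exact: ltW.
have zp : 0 < nrm z by rewrite lt_neqAle eq_sym z0 nrm_ge0.
have := re_le_nrm z (z - x); rewrite reDr reNr (h x Sx) oppr0 addr0 -nrm_sqr expr2 ler_pM2l// => q.
by apply: le_trans q _; exact: ltW.
Qed.

Lemma span_sub A S : linear_subspace S -> A `<=` S -> linear_span A `<=` S.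
Proof. by move=> lS AS x; apply. Qed.

Lemma orth_subspace z : linear_subspace [set x | inner z x = 0].
Proof.
split=> [|a u v /= hu hv] /=; first exact: inner0r.
by rewrite innerDr innerZr hu hv mulr0 addr0.
Qed.

Lemma span_dense_orth A z : dense (linear_span A) -> (forall x, A x -> inner z x = 0) -> z = 0.
Proof.
move=> dA h; apply: (dense_orth dA) => x Ax.
have := @span_sub A _ (orth_subspace z) h x Ax.
by rewrite /re /= => ->.
Qed.

Lemma doubling_le0 (a : R -> R) C : (forall t, a t <= C) ->
  (forall t, 2 * a t <= a (2 * t)) -> forall t, a t <= 0.
Proof.
move=> hC hd t; rewrite leNgt; apply/negP => a0.
have hn n : 2 ^+ n * a t <= a (2 ^+ n * t).
  elim: n => [|n IH]; first by rewrite expr0 !mul1r.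
  by rewrite exprS -!mulrA; apply: le_trans (hd _); rewrite ler_pM2l.
have [n hn'] : exists n : nat, C / a t < 2 ^+ n.
  exists (Num.bound `|C / a t|); apply: lt_le_trans (_ : (Num.bound `|C / a t|)%:R <= _).
    by apply: le_lt_trans (ler_norm _) _; exact: archi_boundP (normr_ge0 _).
  by rewrite -natrX ler_nat ltnW// ltn_expl.
by have := le_trans (hn n) (hC _); rewrite leNgt -ltr_pdivrMr// hn'.
Qed.

Section ReflectionPositive.
Context (Ep : set E) (theta : {linear E -> E}) (U : R -> {linear E -> E}).
Context (hspace : reflection_positive_space Ep theta)
  (hgroup : reflection_positive_group Ep theta U).

Let HU : unitary_one_parameter_group U. Proof. by case: hgroup. Qed.
Let lEp : linear_subspace Ep. Proof. by case: hspace => -[]. Qed.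

Lemma rp_forward t v : 0 <= t -> Ep v -> Ep (U t v).
Proof.
rewrite le_eqVlt => /predU1P[<-|t0] Ev; first by rewrite (U_0 HU).
by case: hgroup => _ /(_ t t0) h _; apply: h; exists v.
Qed.

Lemma theta_adj u v : re (theta u) v = re u (theta v).
Proof.
case: hspace => _ [h _] inv _.
by rewrite -[v in LHS]inv /re h.
Qed.

Lemma theta_U t v : theta (U t v) = U (- t) (theta v).
Proof. by case: hgroup => _ _ /(_ t (theta v)); case: hspace => _ _ -> _. Qed.

Let q u w := re u (theta w).

Let qC u w : q u w = q w u. Proof. by rewrite /q -theta_adj reC. Qed.

Let q_ge0 u : Ep u -> 0 <= q u u.
Proof. by case: hspace => _ _ _ h /h; rewrite lecE /= => /andP[]. Qed.

Let qU t u w : q (U t u) w = q u (U t w).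
Proof. by rewrite /q (U_readj HU) theta_U. Qed.

Let qD u v w : q (u + v) w = q u w + q v w. Proof. exact: reDl. Qed.
Let qZ (k : R) u w : q (k%:C *: u) w = k * q u w. Proof. exact: reZl. Qed.
Let qN u w : q (- u) w = - q u w. Proof. exact: reNl. Qed.

(** The degenerate case of the Cauchy-Schwarz inequality for the semidefinite form [q] on [Ep]. *)
Let q_null u w : Ep u -> q u u = 0 -> Ep w -> q u w = 0.
Proof.
move=> Eu qu Ew; apply: (@quadratic_eq0 _ _ (q w w)) => k.
have := q_ge0 (subspaceD lEp Eu (subspaceZ k%:C lEp Ew)).
by rewrite qD qZ !(qC _ (_ + _)) !qD !qZ qu (qC w u); lra.
Qed.

(** By forward invariance these vectors form the intersection in (LP2). *)
Let Einf v := forall t, Ep (U t v).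

Let q_le v t : Einf v -> q (U t v) v <= q v v.
Proof.
move=> Ev; rewrite -subr_le0.
apply: (@doubling_le0 (fun t => q (U t v) v - q v v) (nrm v * nrm v - q v v)).
  move=> s; rewrite lerD2r; apply: le_trans (re_le_nrm _ _) _.
  rewrite (U_nrm HU); apply: ler_wpM2l; first exact: nrm_ge0.
  by case: hspace => _ [h _] _ _; rewrite /nrm /re h.
move=> s; have Ed : Ep (U s v - v).
  by apply: subspaceB => //; rewrite -(U_0 HU v); exact: Ev.
have := q_ge0 Ed; rewrite qD qN !(qC _ (_ - _)) !qD !qN (qC v) (qU s v) -(U_D HU).
by rewrite (qC v (U (s + s) v)) (_ : 2 * s = s + s); [lra|ring].
Qed.

(** The reverse inequality is [q_le] at time [- t] for the vector [U (t / 2) v]: since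
    [q (U r v) (U s v)] depends only on [r + s], it reads [q v v <= q (U t v) v]. *)
Let q_cst v t : Einf v -> q (U t v) v = q v v.
Proof.
move=> Ev; have EU s : Einf (U s v) by move=> r; rewrite -(U_D HU); exact: Ev.
apply/eqP; rewrite eq_le q_le//=.
have := q_le (- t) (EU (t / 2)); rewrite -(U_D HU) qC qU -(U_D HU) qU -(U_D HU).
have -> : t / 2 + (- t + t / 2) = 0 by lra.
by have -> : t / 2 + t / 2 = t; [lra|rewrite (U_0 HU) (qC v)].
Qed.

Lemma reflection_positive_outgoing : cyclic_subspace Ep U -> fixed_vectors U = [set 0] ->
  outgoing Ep U.
Proof.
move=> hcyc hfix; split; [by case: hspace|by case: hgroup| |].
  apply/seteqP; split=> [v /= hv|_ -> t _]; last first.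
    by exists 0; [exact: subspace0 lEp|rewrite linear0].
  have Ev : Ep v.
    by have [w Ew <-] := hv 1 ltr01; apply: rp_forward.
  have Einfv : Einf v.
    move=> t; have [t0|t0] := leP 0 t; first exact: rp_forward.
    have [|w Ew <-] := hv (- t); first by rewrite /= oppr_gt0.
    by rewrite (U_KN HU).
  suff : fixed_vectors U v by rewrite hfix.
  move=> t; apply/eqP; rewrite -subr_eq0; apply/eqP.
  set u := U t v - v.
  (* All translates of [u] have to be null, since cyclicity tests [theta u] against [U s w], and
     [re (theta u) (U s w) = q (U s u) w]. *)
  have null w s : Ep w -> q (U s u) w = 0.
    move=> Ew; have EU r : Einf (U r v) by move=> r'; rewrite -(U_D HU).
    have uE : U s u = U t (U s v) - U s v by rewrite /u linearB (U_comm HU).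
    have Eu : Ep (U s u).
      rewrite uE; apply: subspaceB => //; first exact: (EU s t).
    apply: q_null => //; rewrite uE qD qN !(qC _ (_ - _)) !qD !qN.
    rewrite (qC (U s v) (U t _)) (qU t) -(U_D HU) (qC _ (U (t + t) _)).
    by rewrite !q_cst//; lra.
  have : theta u = 0.
    apply: (span_dense_orth hcyc) => _ [s _ [w Ew <-]].
    have key w' : Ep w' -> re (theta u) (U s w') = 0.
      by move=> Ew'; rewrite theta_adj theta_U -(U_readj HU); exact: null.
    apply/inner_eq0P; split; first exact: key.
    by rewrite -linearZZ; apply: key; exact: subspaceZ.
  by move=> tu; have [_ _ inv _] := hspace; rewrite -[u]inv tu linear0.
(* The images of [Ep] under [U t] increase as [t] decreases, so this union is already a subspace and
   contains the images for all real [t]; taking the span adds nothing. *)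
set T := \bigcup_(t in _) _.
have ET t w : Ep w -> T (U t w).
  move=> Ew; have [t0|t0] := leP 0 t.
    exists (-1); first by rewrite /= oppr_lt0.
    exists (U (t + 1) w); first by apply: rp_forward => //; lra.
    by rewrite -(U_D HU) addrC addrK.
  by exists t => //; exists w.
have lT : linear_subspace T.
  split; first by rewrite -(linear0 (U 0)); apply: ET; exact: subspace0 lEp.
  move=> a u v [s /= s0 [u' Eu <-]] [t /= t0 [v' Ev <-]].
  pose r := Num.min s t.
  have -> : a *: U s u' + U t v' = U r (a *: U (s - r) u' + U (t - r) v').
    by rewrite linearP -!(U_D HU) !subrKC.
  apply: ET; apply: subspaceD => //; first apply: subspaceZ => //; apply: rp_forward => //.
    by rewrite subr_ge0 ge_min lexx.
  by rewrite subr_ge0 ge_min lexx orbT.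
have sT : linear_span (\bigcup_(t in [set: R]) (U t @` Ep)) `<=` T.
  by apply: span_sub => // _ [t _ [w Ew <-]]; exact: ET.
move: hcyc; rewrite /cyclic_subspace => /dense_nrm hd; apply/dense_nrm => v e e0.
by have [x /sT Tx hx] := hd v e e0; exists x.
Qed.

End ReflectionPositive.

End Outgoing.

(** * Wold decomposition and exponential systems *)

Section Systems.
Context {R : realType} {E : hilbertType R}.
Implicit Types (U : R -> {linear E -> E}) (u v w x y z m : E) (s t : R) (S F K : set E).

(** The closed linear span of [F], encoded so that membership is a test against vectors and no
    approximating combinations appear. *)
Definition double_orth F : set E :=
  [set x | forall z, (forall y, F y -> inner z y = 0) -> inner z x = 0].

Lemma double_orth_closed F : closed_subspace (double_orth F).
Proof.
split; first split.
- by move=> z _; exact: inner0r.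
- move=> a u v hu hv z hz; rewrite innerDr innerZr hu// hv//.
  by rewrite mulr0 addr0.
apply/closed_nrm => v hv z hz.
have key z' : (forall y, F y -> inner z' y = 0) -> re z' v = 0.
  move=> hz'; apply/eqP; rewrite -normr_eq0; apply/eqP; apply/eqP.
  rewrite eq_le normr_ge0 andbT; apply/ler_addgt0Pr => e e0; rewrite add0r.
  have c0 : 0 < nrm z' + 1 by have := nrm_ge0 z'; lra.
  have [u hu uv] := hv _ (divr_gt0 e0 c0).
  have -> : re z' v = re z' (v - u).
    by rewrite reDr reNr /re [inner z' u](hu _ hz') /= oppr0 addr0.
  apply: le_trans (cauchy_schwarz _ _) _; move: uv; rewrite ltr_pdivlMr// => uv.
  apply: le_trans (ltW uv); rewrite mulrC; apply: ler_wpM2l; first exact: nrm_ge0.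
  by rewrite lerDl.
rewrite inner_re reC -(reC z) key//=.
have -> : re z ('i *: v) = re (- 'i *: z) v.
  by rewrite /re innerZr innerZl; case: (inner z v) => a b /=; ring.
by rewrite key// => y Fy; rewrite innerZl hz ?mulr0.
Qed.

Lemma double_orth_in F y : F y -> double_orth F y.
Proof. by move=> Fy z; apply. Qed.

Lemma inner_eq0C u v : inner u v = 0 -> inner v u = 0.
Proof. by move=> h; rewrite innerC h conjc0. Qed.

(** Carrier of the multiplicity space [M] of the theorem. *)
Definition wandering U Ep : set E :=
  [set m | Ep m /\ forall u, Ep u -> inner (cayley U u) m = 0].

Section OutgoingWandering.
Context (U : R -> {linear E -> E}) (HU : unitary_one_parameter_group U).
Let HUo := reverse_group HU.

Section Wold.
Context (Ep : set E) (hout : outgoing Ep U).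

Let cEp : closed_subspace Ep. Proof. by case: hout. Qed.
Let lEp : linear_subspace Ep. Proof. by case: cEp. Qed.

Let EU t v : 0 <= t -> Ep v -> Ep (U t v).
Proof.
rewrite le_eqVlt => /predU1P[<-|t0] Ev; first by rewrite (U_0 HU).
by case: hout => _ /(_ t t0) h _ _; apply: h; exists v.
Qed.

Lemma wandering_closed : closed_subspace (wandering U Ep).
Proof.
split; first split.
- by split=> [|u _]; [exact: subspace0 lEp|exact: inner0r].
- move=> a u v [Eu hu] [Ev hv]; split; first by apply: subspaceD => //; exact: subspaceZ.
  by move=> w Ew; rewrite innerDr innerZr hu// hv// mulr0 addr0.
apply/closed_nrm => v hv; split.
  case: cEp => _ /closed_nrm; apply => e e0; have [u [Eu _] uv] := hv e e0.
  by exists u.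
move=> u Eu; have [_ /closed_nrm] := double_orth_closed [set x | forall w, Ep w -> inner (cayley U w) x = 0].
move=> /(_ v) h; suff : double_orth [set x | forall w, Ep w -> inner (cayley U w) x = 0] v.
  by apply => y; exact.
by apply: h => e e0; have [w [Ew hw] wv] := hv e e0; exists w => //; exact: double_orth_in.
Qed.

Lemma wandering_eigen m n t : wandering U Ep m -> wandering U Ep n ->
  inner m (U t n) = (expR (- `|t|))%:C * inner m n.
Proof.
have key a b s : wandering U Ep a -> wandering U Ep b -> 0 <= s ->
    inner a (U s b) = (expR (- s))%:C * inner a b.
  move=> [Ea ha] [Eb hb] s0.
  have hr z : (forall u, Ep u -> inner (cayley U u) z = 0) ->
      forall u r, Ep u -> 0 <= r -> re (U r u) z = expR (- r) * re u z.
    by move=> hz; apply: (eigen_of_cayley HU EU) => u Eu; rewrite /re hz.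
  rewrite [inner a (U s b)]innerC [inner a b]innerC !inner_re.
  rewrite !(hr _ _ b s Eb s0)//; last first.
    by move=> u Eu; rewrite innerZr ha ?mulr0.
  by apply/eqP; rewrite eq_complex /=; apply/andP; split; apply/eqP; ring.
move=> wm wn; have [t0|t0] := leP 0 t; first by rewrite key// ger0_norm.
rewrite ltr0_norm// innerC U_adj// key//; last by rewrite oppr_ge0 ltW.
by rewrite rmorphM /= oppr0 -innerC.
Qed.

(** The intersection of the [V ^ n Ep] is reduced by [V], hence by [U], so it lies in every [U t Ep]
    and is zero by (LP2). A vector of [Ep] orthogonal to all [V ^ n m] belongs to it. Hence a vector
    orthogonal to all orbits is orthogonal to [Ep], to its translates, and to the dense union of
    (LP3). *)
Lemma wandering_total z : (forall t m, wandering U Ep m -> inner z (U t m) = 0) -> z = 0.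
Proof.
move=> hz.
(* The intersection of all [V ^ n Ep], written with the inverse of [V]. *)
pose K1 : set E := [set p | forall n, Ep (iter n (cayley (reverse U)) p)].
have opB n u v : iter n (cayley (reverse U)) (u - v) =
    iter n (cayley (reverse U)) u - iter n (cayley (reverse U)) v.
  by elim: n => //= n ->; rewrite cayleyB.
have opn n u : nrm (iter n (cayley (reverse U)) u) = nrm u.
  by elim: n => //= n <-; rewrite cayley_nrm.
have cK1 : closed_subspace K1.
  split; first split.
  - move=> n; suff -> : iter n (cayley (reverse U)) 0 = 0 by exact: subspace0 lEp.
    by apply: nrm0_eq0; rewrite opn nrm0.
  - move=> a u v hu hv n.
    have -> : iter n (cayley (reverse U)) (a *: u + v) =
        a *: iter n (cayley (reverse U)) u + iter n (cayley (reverse U)) v.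
      by elim: n => //= n ->; rewrite cayley_linear.
    by apply: subspaceD => //; exact: subspaceZ.
  apply/closed_nrm => v hv n; case: cEp => _ /closed_nrm; apply => e e0.
  by have [u hu uv] := hv e e0; exists (iter n (cayley (reverse U)) u); rewrite // -opB opn.
have K1E p : K1 p -> Ep p by move=> /(_ 0%N).
have K1U t v : K1 v -> K1 (U t v).
  apply: reduces_group => // {t}v Kv; last by move=> n; rewrite -iterSr; exact: Kv.
  case=> [|n]; first by apply: (cayley_sub HU cEp EU); exact: K1E.
  by rewrite iterSr cayleyK_op.
have K10 p : K1 p -> p = 0.
  move=> Kp; case: hout => _ _ h _; suff : [set 0] p by [].
  rewrite -h => t _; exists (U (- t) p); last by rewrite U_KN.
  exact/K1E/K1U.
pose V n : E -> E := iter n (cayley U).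
have back p : Ep p -> (forall n m, wandering U Ep m -> inner p (V n m) = 0) -> K1 p.
  move=> Epp hp n; elim: n p Epp hp => // n IH p Epp hp; rewrite iterSr.
  apply: IH; last first.
    move=> n' m wm; have := cayley_adj HUo p (V n' m); rewrite reverseK => ->.
    by rewrite -[cayley U _]/(V n'.+1 m) hp.
  (* [K2] is [V Ep]. A vector [w] orthogonal to it has a wandering projection [pw] on [Ep], to which
     [p] is orthogonal by hypothesis; so [p] is orthogonal to [w] and lies in [V Ep]. *)
  pose K2 : set E := [set x | Ep (cayley (reverse U) x)].
  have cK2 : closed_subspace K2.
    split; first split.
    - rewrite /K2 /= (_ : cayley (reverse U) 0 = 0); first exact: subspace0 lEp.
      by apply: nrm0_eq0; rewrite cayley_nrm// nrm0.
    - by move=> a u v hu hv; rewrite /K2 /= cayley_linear//; apply: subspaceD => //; exact: subspaceZ.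
    apply/closed_nrm => v hv; case: cEp => _ /closed_nrm; apply => e e0.
    by have [u hu uv] := hv e e0; exists (cayley (reverse U) u); rewrite // -cayleyB// cayley_nrm.
  apply: (mem_closed_subspace cK2) => w hw.
  have [pw Ew hpw] := orthogonal_projection w cEp.
  have hcay u : Ep u -> inner (cayley U u) pw = 0.
    move=> Eu; have Ec : Ep (cayley U u) := cayley_sub HU cEp EU Eu.
    have := hpw _ Ec; rewrite innerBl hw ?sub0r; last by rewrite /K2 /= cayleyK_op.
    by move=> /eqP; rewrite oppr_eq0 => /eqP; exact: inner_eq0C.
  have := hp 0%N pw (conj Ew hcay) => /= h0.
  by apply: inner_eq0C; have := hpw _ Epp; rewrite innerBl [inner pw p]inner_eq0C// subr0.
pose Z : set E := [set y | forall t m, wandering U Ep m -> inner y (U t m) = 0].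
have ZU t y : Z y -> Z (U t y).
  by move=> Zy s m wm; rewrite U_adj// -U_D//; exact: Zy.
have ZE y : Z y -> forall u, Ep u -> inner y u = 0.
  move=> Zy; have [p Epp hp] := orthogonal_projection y cEp.
  suff p0 : p = 0 by move=> u Eu; have := hp u Eu; rewrite p0 subr0.
  apply/K10/back => // n m wm.
  have hV k : Ep (V k m) by elim: k => [|k IH]; [case: wm|exact: (cayley_sub HU cEp EU IH)].
  suff : inner y (V n m) = 0.
    have := hp _ (hV n); rewrite innerBl => /eqP; rewrite subr_eq0 => /eqP <-.
    exact.
  (* The powers [V n m] lie in the closed span of the orbits, which is invariant under the semigroup
     and hence under [V]. *)
  have KF := double_orth_closed [set x | exists t, exists2 m', wandering U Ep m' & x = U t m'].
  have FU t v : 0 <= t -> double_orth [set x | exists t, exists2 m', wandering U Ep m' & x = U t m'] v ->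
      double_orth [set x | exists t, exists2 m', wandering U Ep m' & x = U t m'] (U t v).
    move=> _ hv w hw; rewrite innerC U_adj// -innerC; apply: hv => x [s [m' wm' ->]].
    by rewrite U_adj// opprK -U_D//; apply: hw; exists (t + s), m'.
  have : double_orth [set x | exists t, exists2 m', wandering U Ep m' & x = U t m'] (V n m).
    elim: (n) => [|k IH]; first by apply: double_orth_in; exists 0, m => //; rewrite U_0.
    exact: (cayley_sub HU KF FU).
  by apply => x [s [m' wm' ->]]; exact: Zy.
case: hout => _ _ _ hd; apply: (dense_orth hd) => _ [t _ [u Eu <-]].
by rewrite -[z](U_KN HU t) U_re// /re ZE//; exact: ZU.
Qed.

End Wold.

End OutgoingWandering.

(* In [L2], [A m] is the function [x |-> sqrt 2 * expR (- x) *: m] on [x >= 0]. *)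
Definition exp_system U (M : hilbertType R) (A : M -> E) : Prop :=
  [/\ forall (a : R[i]) (m n : M), A (a *: m + n) = a *: A m + A n,
      forall (m n : M) t, inner (A m) (U t (A n)) = (expR (- `|t|))%:C * inner m n
    & forall z, (forall t (m : M), inner z (U t (A m)) = 0) -> z = 0].

Section Orbit.
Context (U : R -> {linear E -> E}) (HU : unitary_one_parameter_group U).
Context (M : hilbertType R) (A : M -> E) (hA : exp_system U A).
Let HUo := reverse_group HU.

Lemma exp_inner (m n : M) : inner (A m) (A n) = inner m n.
Proof.
by case: hA => _ /(_ m n 0) h _; move: h; rewrite U_0// normr0 oppr0 expR0 mul1r.
Qed.

(** In place of an outgoing subspace stands the closed span [K] of the forward orbits. The
    exponential kernel makes [A m] an eigenvector in the sense of [cayley_of_eigen], so it is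
    orthogonal to [V K], which contains the positive powers. *)
Lemma exp_wandering (m m' : M) n : inner (A m) (iter n.+1 (cayley U) (A m')) = 0.
Proof.
case: hA => AZ Ae _.
pose F : set E := [set x | exists t (m' : M), 0 <= t /\ x = U t (A m')].
have hK := double_orth_closed F; set K := double_orth F in hK.
have KU t v : 0 <= t -> K v -> K (U t v).
  move=> t0 Kv z hz; rewrite innerC U_adj// -innerC; apply: Kv => y [s [p [s0 ->]]].
  by rewrite U_adj// opprK -U_D//; apply: hz; exists (t + s), p; rewrite addr_ge0.
have KA : K (A m') by apply: double_orth_in; exists 0, m'; rewrite U_0.
have KV : forall k, K (iter k (cayley U) (A m')).
  by elim=> //= k IH; exact: (cayley_sub HU hK KU).
have eig (q : M) u t : K u -> 0 <= t -> re (U t u) (A q) = expR (- t) * re u (A q).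
  (* The eigenvalue relation is orthogonality of [u] to one fixed vector, so it passes from the
     generating orbits to [K]. *)
  move=> Ku t0; suff h : inner (U (- t) (A q) - (expR (- t))%:C *: A q) u = 0.
    rewrite U_readj// reC [re u _]reC -reZl; apply/eqP; rewrite -subr_eq0 -reNl -reDl.
    by rewrite /re h.
  apply: Ku => y [s [p [s0 ->]]].
  rewrite innerBl innerZl U_adj// opprK -U_D// !Ae !ger0_norm ?addr_ge0//.
  by rewrite opprD expRD rmorphM mulrA subrr.
have key q : re (cayley U (iter n (cayley U) (A m'))) (A q) = 0.
  by apply: (cayley_of_eigen HU hK KU) => // u t; exact: eig.
apply: inner_eq0C; apply/inner_eq0P; split; first exact: key.
have -> : 'i *: A m = A ('i *: m).
  have A0 : A 0 = 0.
    have := AZ 1 0 0; rewrite !scale1r addr0 => /eqP.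
    by rewrite eq_sym -subr_eq0 addrK => /eqP.
  by have := AZ 'i m 0; rewrite A0 !addr0.
exact: key.
Qed.

(** The closed span of the [V ^ n A m] with [n] of either sign is reduced by [V], hence by [U], so
    it contains the orbits. Totality in continuous time thus becomes totality for the bilateral
    shift. *)
Lemma exp_total z :
  (forall n (m : M), inner z (iter n (cayley U) (A m)) = 0) ->
  (forall n (m : M), inner z (iter n (cayley (reverse U)) (A m)) = 0) -> z = 0.
Proof.
move=> h1 h2; case: hA => _ _; apply => t m.
pose F : set E := [set x | exists n (q : M),
  x = iter n (cayley U) (A q) \/ x = iter n (cayley (reverse U)) (A q)].
have hK := double_orth_closed F.
suff : double_orth F (U t (A m)) by apply => y [n [q [->|->]]].
apply: (reduces_group HU hK) => [v Kv w hw|v Kv w hw|]; last first.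
- by apply: double_orth_in; exists 0%N, m; left.
- rewrite innerC cayley_adj// reverseK -innerC; apply: Kv => y [n [q [->|->]]].
    by rewrite cayley_adj//; case: n => [|n] /=; apply: hw;
      [exists 1%N, q; right|exists n, q; left; rewrite cayleyK_op].
  by rewrite cayley_adj//; apply: hw; exists n.+1, q; right.
- rewrite innerC cayley_adj// -innerC; apply: Kv => y [n [q [->|->]]].
    by rewrite cayley_adj// reverseK; apply: hw; exists n.+1, q; left.
  rewrite cayley_adj// reverseK; case: n => [|n] /=; apply: hw.
    by exists 1%N, q; left.
  by exists n, q; right; rewrite cayley_opK.
Qed.

End Orbit.

End Systems.

(** * A closed subspace as a Hilbert space *)

Section SubspaceHilbert.
Context {R : realType} {E : hilbertType R}.
Context (S : set E) (hS : closed_subspace S).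

(** The proof of closedness is an argument of the type, so that the structures depending on it can
    be attached; [[<S x>]] makes membership boolean and its proofs unique. *)
Definition subspace_type & closed_subspace S := {x : E | `[<S x>]}.
Local Notation T := (subspace_type hS).

HB.instance Definition _ := [isSub of T for @sval _ _].
HB.instance Definition _ := [Choice of T by <:].

Lemma subspace_closed : GRing.subsemimod_closed (fun x : E => `[<S x>]).
Proof.
case: hS => lS _; split; first split.
- by apply/asboolP; exact: subspace0 lS.
- by move=> u v /asboolP Su /asboolP Sv; apply/asboolP; exact: subspaceD.
- by move=> a u /asboolP Su; apply/asboolP; exact: subspaceZ.
Qed.

HB.instance Definition _ :=
  GRing.SubChoice_isSubLmodule.Build R[i] E (fun x : E => `[<S x>]) T subspace_closed.

Lemma subspace_normD (x y : T) : `|val (x + y)| <= `|val x| + `|val y|.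
Proof. by rewrite raddfD; exact: ler_normD. Qed.

Lemma subspace_normZ (a : R[i]) (x : T) : `|val (a *: x)| = `|a| * `|val x|.
Proof. by rewrite linearZ normrZ. Qed.

Lemma subspace_norm0 (x : T) : `|val x| = 0 -> x = 0.
Proof. by move=> /normr0_eq0 h; apply: val_inj; rewrite raddf0. Qed.

HB.instance Definition _ := Lmodule_isNormed.Build R[i] T
  subspace_normD subspace_normZ subspace_norm0.

Lemma subspace_normE (x : T) : `|x| = `|val x|. Proof. by []. Qed.

Lemma subspace_complete (F : set_system T) : ProperFilter F -> cauchy F -> cvg F.
Proof.
move=> FF /cauchy_ballP Fc.
have Gc : cauchy (val @ F).
  apply/cauchy_ballP => e e0; have := Fc e e0.
  move=> -[[A B] /= [FA FB] AB].
  exists (val @` A, val @` B) => /=.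
    by split; [apply: filterS FA|apply: filterS FB] => x hx /=; exists x.
  move=> [_ _] /= [[x Ax <-] [y By <-]].
  have := AB (x, y) (conj Ax By); rewrite -!ball_normE /=.
  by rewrite subspace_normE raddfB.
have /cvg_ex[v Fv] : cvg (val @ F) by apply: cauchy_cvg.
have Sv : S v.
  apply: hS.2 => B /Fv FB; have /filter_ex[x Bx] : F (val @^-1` B) by [].
  by exists (val x); split => //; exact: asboolW (valP x).
pose w : T := Sub v (asboolT Sv).
apply/cvg_ex; exists w => B /nbhs_ballP[e /= e0 hB].
have : nbhs v (ball v e) by apply: nbhsx_ballx.
move=> /Fv h; have {}h : F (val @^-1` ball v e) by exact: h.
apply: filterS h => x /=; rewrite -ball_normE /= => h; apply: hB.
by rewrite -ball_normE /= subspace_normE raddfB /w /=.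
Qed.

HB.instance Definition _ := Uniform_isComplete.Build T subspace_complete.

Definition subspace_inner (x y : T) : R[i] := inner (val x) (val y).

Lemma subspace_inner_bilinear :
  bilinear_for (GRing.Scale.Law.clone _ _ *%R _)
    (GRing.Scale.Law.clone _ _ (@Num.conj R[i] \; *%R) _) subspace_inner.
Proof.
split=> u a x y; rewrite /subspace_inner [\val (_ + _)]linearP.
  by rewrite innerDl innerZl.
by rewrite innerDr innerZr.
Qed.

HB.instance Definition _ := bilinear_isBilinear.Build R[i] T T R[i] _ _
  subspace_inner subspace_inner_bilinear.

Lemma subspace_inner_herm (x y : T) :
  subspace_inner x y = (-1) ^+ false * Num.conj (subspace_inner y x).
Proof. exact: hermitian_subproof. Qed.

HB.instance Definition _ := isHermitianSesquilinear.Build R[i] T false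
  (@Num.conj R[i]) subspace_inner subspace_inner_herm.

Lemma subspace_inner_gt0 (x : T) : x != 0 -> 0 < subspace_inner x x.
Proof.
move=> x0; apply: neq0_dnorm_gt0; apply: contra_neq x0 => h.
by apply: val_inj; rewrite raddf0.
Qed.

HB.instance Definition _ := isDotProduct.Build R[i] T subspace_inner subspace_inner_gt0.

Lemma subspace_sqr_norm (x : T) : `|x| ^+ 2 = subspace_inner x x.
Proof. exact: sqr_normE. Qed.

HB.instance Definition _ := NormedModule_isHilbert.Build R T subspace_sqr_norm.

Lemma subspace_innerE (x y : T) : inner x y = inner (val x) (val y).
Proof. by []. Qed.

End SubspaceHilbert.

(** * The exponential system of an outgoing subspace *)

Section OutgoingSystem.
Context {R : realType} {E : hilbertType R}.

Lemma outgoing_exp_system (U : R -> {linear E -> E}) (HU : unitary_one_parameter_group U)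
  (Ep : set E) (hout : outgoing Ep U) :
  exp_system U (val : subspace_type (wandering_closed hout) -> E).
Proof.
split.
- by move=> a m n; rewrite linearP.
- move=> m n t; rewrite subspace_innerE; apply: (wandering_eigen HU hout).
    exact: asboolW (valP m).
  exact: asboolW (valP n).
move=> z hz; apply: (wandering_total HU hout) => t m wm.
exact: hz t (Sub m (asboolT wm)).
Qed.

End OutgoingSystem.

(** * Linear combinations and total families *)

Section Combinations.
Context {R : realType} {H : hilbertType R} {I : Type}.
Implicit Types (f : I -> H) (l : seq (R[i] * I)) (e : R).

(** A list with repetitions allowed: addition is concatenation, and [I] can be any type. *)
Definition lin_comb f l : H := \sum_(p <- l) p.1 *: f p.2.

Lemma lin_comb_cat f l l' : lin_comb f (l ++ l') = lin_comb f l + lin_comb f l'.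
Proof. by rewrite /lin_comb big_cat. Qed.

Lemma lin_comb_scale f a l : lin_comb f [seq (a * p.1, p.2) | p <- l] = a *: lin_comb f l.
Proof.
rewrite /lin_comb big_map scaler_sumr; apply: eq_bigr => p _ /=.
by rewrite scalerA.
Qed.

Definition total_family f := forall z, (forall i, inner z (f i) = 0) -> z = 0.

Lemma lin_comb_approx f : total_family f ->
  forall x e, 0 < e -> exists l, nrm (x - lin_comb f l) < e.
Proof.
move=> tf; pose S : set H := closure [set x | exists l, x = lin_comb f l].
have SE x : S x <-> forall e, 0 < e -> exists l, nrm (x - lin_comb f l) < e.
  split=> [/closure_nrm h e e0|h].
    by have [_ [l ->] hl] := h e e0; exists l.
  by apply/closure_nrm => e e0; have [l hl] := h e e0; exists (lin_comb f l) => //; exists l.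
suff h x : S x by move=> x e e0; apply: (SE x).1.
have cS : closed_subspace S.
  split; last exact: closed_closure.
  split; first by apply/SE => e e0; exists [::]; rewrite /lin_comb big_nil subrr nrm0.
  move=> a u v /SE hu /SE hv; apply/SE => e e0.
  have c0 : 0 <= Normc.normc a by case: a => *; exact: sqrtr_ge0.
  have c1 : 0 < 2 * (Normc.normc a + 1) by lra.
  have e2 : 0 < e / 2 by lra.
  have [l hl] := hu _ (divr_gt0 e0 c1); have [l' hl'] := hv _ e2.
  exists ([seq (a * p.1, p.2) | p <- l] ++ l').
  rewrite lin_comb_cat lin_comb_scale opprD addrACA -scalerBr.
  apply: le_lt_trans (nrmD _ _) _; rewrite nrmZ.
  have := hl; rewrite ltr_pdivlMr// => h1.
  have := ler_wpM2r (nrm_ge0 (u - lin_comb f l)) (_ : Normc.normc a <= Normc.normc a + 1).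
  by move=> /(_ ltac:(lra)); lra.
apply: (mem_closed_subspace cS) => w hw; suff -> : w = 0 by exact: inner0r.
apply: tf => i; apply: hw; apply/SE => e e0; exists [:: (1, i)].
by rewrite /lin_comb big_seq1 scale1r subrr nrm0.
Qed.

Lemma inner_lin_combr f z l : inner z (lin_comb f l) = \sum_(p <- l) p.1^*%C * inner z (f p.2).
Proof.
rewrite /lin_comb; elim: l => [|p l IH]; first by rewrite !big_nil inner0r.
by rewrite !big_cons innerDr innerZr IH.
Qed.

Lemma inner_lin_combl f z l : inner (lin_comb f l) z = \sum_(p <- l) p.1 * inner (f p.2) z.
Proof.
rewrite /lin_comb; elim: l => [|p l IH]; first by rewrite !big_nil inner0l.
by rewrite !big_cons innerDl innerZl IH.
Qed.

End Combinations.

(** * Isomorphisms from equal Gram matrices *)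

Section Isomorphism.
Context {R : realType} {I : Type}.

(** Equal Gram matrices make the passage from [lin_comb f l] to [lin_comb g l] isometric, so
    approximations of [x] become a Cauchy sequence with limit [y]. Applied in both directions this
    gives the isomorphism and its surjectivity. *)
Lemma isometric_partner (H K : hilbertType R) (f : I -> H) (g : I -> K) :
  (forall i j, inner (f i) (f j) = inner (g i) (g j)) -> total_family f ->
  forall x, exists y, nrm y = nrm x /\ forall i, inner y (g i) = inner x (f i).
Proof.
move=> fg tf x.
have cc l l' : inner (lin_comb f l) (lin_comb f l') = inner (lin_comb g l) (lin_comb g l').
  rewrite !inner_lin_combl; apply: eq_bigr => p _; congr (_ * _).
  by rewrite !inner_lin_combr; apply: eq_bigr => q _; rewrite fg.
have cgl l i : inner (lin_comb g l) (g i) = inner (lin_comb f l) (f i).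
  by rewrite !inner_lin_combl; apply: eq_bigr => p _; rewrite fg.
have dist l l' : nrm (lin_comb g l - lin_comb g l') = nrm (lin_comb f l - lin_comb f l').
  have eB (H' : hilbertType R) (h : I -> H') :
      lin_comb h l - lin_comb h l' = lin_comb h (l ++ [seq (-1 * p.1, p.2) | p <- l']).
    by rewrite lin_comb_cat lin_comb_scale scaleN1r.
  by rewrite !eB /nrm /re cc.
have nn l : nrm (lin_comb g l) = nrm (lin_comb f l) by rewrite /nrm /re cc.
have pos (n : nat) : (0 : R) < n.+1%:R^-1 by rewrite invr_gt0 ltr0n.
have /choice[s hs] (n : nat) : exists l, nrm (x - lin_comb f l) < n.+1%:R^-1.
  exact: lin_comb_approx.
have small (e : R) : 0 < e -> exists N, forall n, (N <= n)%N -> nrm (x - lin_comb f (s n)) < e.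
  move=> e0; have [N hN] := @ltr_add_invr _ 0 e e0.
  exists N => n Nn; apply: lt_trans (hs n) (le_lt_trans _ hN); rewrite add0r.
  by rewrite lef_pV2 ?posrE ?ltr0n// ler_nat.
have [|y hy] := @complete_nrm R K (fun n => lin_comb g (s n)).
  move=> e e0; have e2 : 0 < e / 2 by lra.
  have [N hN] := small _ e2; exists N => m n Nm Nn; rewrite dist.
  have := nrmD (x - lin_comb f (s n)) (lin_comb f (s m) - x).
  rewrite addrC addrA subrK [nrm (_ - x)]nrmB.
  by have := hN m Nm; have := hN n Nn; lra.
have both (e : R) : 0 < e -> exists l, nrm (x - lin_comb f l) < e /\ nrm (lin_comb g l - y) < e.
  move=> e0; have [N hN] := small e e0; have [M hM] := hy e e0.
  by exists (s (maxn N M)); split; [apply: hN; exact: leq_maxl|apply: hM; exact: leq_maxr].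
exists y; split.
  apply/eqP; rewrite -subr_eq0 -normr_eq0 eq_le normr_ge0 andbT.
  apply/ler_addgt0Pr => e e0; have e2 : 0 < e / 2 by lra.
  have [l [h1 h2]] := both _ e2; rewrite add0r ler_norml.
  have a1 := nrmD (x - lin_comb f l) (lin_comb f l); rewrite subrK in a1.
  have a2 := nrmD (lin_comb f l - x) x; rewrite subrK nrmB in a2.
  have b1 := nrmD (y - lin_comb g l) (lin_comb g l); rewrite subrK nrmB in b1.
  have b2 := nrmD (lin_comb g l - y) y; rewrite subrK in b2.
  move: b1 b2; rewrite nn => b1 b2; apply/andP; split; lra.
move=> i; have key (a : R[i]) : re y (a *: g i) = re x (a *: f i).
  apply/eqP; rewrite -subr_eq0 -normr_eq0 eq_le normr_ge0 andbT.
  apply/ler_addgt0Pr => e e0; rewrite add0r.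
  pose c := nrm (a *: g i) + nrm (a *: f i) + 1.
  have c0 : 0 < c.
    by rewrite /c; have := nrm_ge0 (a *: g i); have := nrm_ge0 (a *: f i); lra.
  have [l [h1 h2]] := both _ (divr_gt0 e0 c0).
  have -> : re y (a *: g i) - re x (a *: f i) =
      - re (lin_comb g l - y) (a *: g i) - re (x - lin_comb f l) (a *: f i).
    have : re (lin_comb g l) (a *: g i) = re (lin_comb f l) (a *: f i).
      by rewrite /re !innerZr cgl.
    by rewrite !reDl !reNl; lra.
  apply: le_trans (ler_normB _ _) _; rewrite normrN.
  have i1 := cauchy_schwarz (lin_comb g l - y) (a *: g i); have i2 := cauchy_schwarz (x - lin_comb f l) (a *: f i).
  have j1 := ler_wpM2r (nrm_ge0 (a *: g i)) (ltW h2).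
  have j2 := ler_wpM2r (nrm_ge0 (a *: f i)) (ltW h1).
  have : e / c * c = e by rewrite divfK// gt_eqF.
  have : 0 < e / c by exact: divr_gt0.
  rewrite {3}/c; lra.
rewrite !inner_re; have := key 1; rewrite !scale1r => ->.
by rewrite key.
Qed.

Lemma isomorphic_of_total (H K : hilbertType R) (f : I -> H) (g : I -> K) :
  (forall i j, inner (f i) (f j) = inner (g i) (g j)) ->
  total_family f -> total_family g -> hilbert_isomorphic H K.
Proof.
move=> fg tf tg.
(* Totality of [g] determines the image by its inner products, from which linearity is read off. *)
have uniq (u v : K) : (forall i, inner u (g i) = inner v (g i)) -> u = v.
  move=> h; apply/eqP; rewrite -subr_eq0; apply/eqP/tg => i.
  by rewrite innerBl h subrr.
have /choice[W hW] := isometric_partner fg tf.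
have Wlin : linear W.
  move=> a u v; apply: uniq => i; rewrite innerDl innerZl !(hW _).2.
  by rewrite innerDl innerZl.
pose WL : {linear H -> K} := HB.pack W (GRing.isLinear.Build _ _ _ _ W Wlin).
exists WL; split.
  have rW u v : re (WL u) (WL v) = re u v.
    have n w : re (WL w) (WL w) = re w w by rewrite -!nrm_sqr (hW w).1.
    have := n (u + v); rewrite linearD !reE !n (reC (WL v)) (reC v); lra.
  by move=> u v; rewrite !inner_re -linearZZ !rW.
move=> y; have [x [_ hx]] := @isometric_partner K H g f (fun i j => esym (fg i j)) tg y.
by exists x; apply: uniq => i; rewrite (hW x).2 hx.
Qed.

End Isomorphism.

(** * Orthonormal bases and Parseval's identity *)

Section OrthonormalBasis.
Context {R : realType}.

Definition orthonormal_family (H : hilbertType R) (I : eqType) (b : I -> H) :=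
  forall i j, inner (b i) (b j) = (i == j)%:R.

(** Zorn's lemma runs over orthonormal sets, ordered by inclusion; a maximal one, possibly
    uncountable, is indexed by itself. *)
Lemma basis_exists (H : hilbertType R) : exists (I : choiceType) (b : I -> H),
  orthonormal_family b /\ total_family b.
Proof.
pose P : set (set H) := [set A | forall u v, A u -> A v -> inner u v = (u == v)%:R].
have [A [PA mA]] : exists A, P A /\ forall B, A `<` B -> ~ P B.
  apply: Zorn_bigcup => F FP Ft u v [X FX Xu] [Y FY Yv].
  have [XY|YX] := Ft X Y FX FY.
    by apply: (FP Y FY) => //; exact: XY.
  by apply: (FP X FX) => //; exact: YX.
exists {x : H | `[<A x>]}, sval; split.
  by move=> [x Ax] [y Ay] /=; rewrite PA; [|exact: asboolW|exact: asboolW].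
move=> z hz; apply: contrapT => /eqP z0.
have n0 : nrm z != 0 by apply: contra_neq z0; exact: nrm0_eq0.
have n00 : (nrm z)%:C != 0 by apply: contra_neq n0 => /complexI.
have hz' x : A x -> inner z x = 0 by move=> Ax; have := hz (exist _ x (asboolT Ax)).
pose w := ((nrm z)^-1)%:C *: z.
have ww : inner w w = 1.
  rewrite inner_self nrmZr ger0_norm ?invr_ge0 ?nrm_ge0//.
  by rewrite mulVf// expr1n.
have wA x : A x -> inner w x = 0 by move=> Ax; rewrite innerZl hz' ?mulr0.
have nAw : ~ A w by move=> /wA; rewrite ww => /eqP; rewrite oner_eq0.
apply: (mA (A `|` [set w])).
  split; first by move=> x Ax; left.
  by move=> /(_ w (or_intror erefl)).
move=> u v [Au|->] [Av|->]; first exact: PA.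
- rewrite innerC wA// conjc0; case: eqP => // uw; by rewrite uw in Au.
- by rewrite wA//; case: eqP => // wv; rewrite -wv in Av.
- by rewrite eqxx ww.
Qed.

Lemma normc_sqrE (z : R[i]) : z^*%C * z = (Normc.normc z ^+ 2)%:C.
Proof. by rewrite mulrC -sqr_normc normc_def -rmorphXn; case: z. Qed.

(** [esum] is a supremum over finite subsets, which admits uncountable bases. The upper bound is
    Bessel's inequality; for the lower one, the projection on the indices of an approximating
    combination is at least as close to [v]. *)
Lemma parseval (H : hilbertType R) (I : choiceType) (b : I -> H) v :
  orthonormal_family b -> total_family b ->
  (\esum_(i in [set: I]) (Normc.normc (inner v (b i)) ^+ 2)%:E = (nrm v ^+ 2)%:E)%E.
Proof.
move=> ob tb; pose c i := inner v (b i).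
pose proj (X : seq I) := \sum_(i <- X) c i *: b i.
pose s (X : seq I) : R := \sum_(i <- X) Normc.normc (c i) ^+ 2.
have pb X i : uniq X -> inner (proj X) (b i) = if i \in X then c i else 0.
  rewrite /proj; elim: X => [|j X IH] /=; first by rewrite big_nil inner0l.
  move=> /andP[jX uX]; rewrite big_cons innerDl innerZl ob IH// in_cons.
  have [->|ij] := eqVneq i j; first by rewrite (negPf jX) mulr1 addr0.
  by rewrite mulr0 add0r.
have pv X : re (proj X) v = s X.
  rewrite /proj /s; elim: X => [|j X IH]; first by rewrite !big_nil re0l.
  rewrite !big_cons reDl IH; congr (_ + _).
  by rewrite /re innerZl (innerC v) -/(c j) mulrC normc_sqrE.
have pp X : uniq X -> re (proj X) (proj X) = s X.
  move=> uX; rewrite {2}/proj.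
  suff h (Y : seq I) : {subset Y <= X} -> re (proj X) (\sum_(i <- Y) c i *: b i) = s Y.
    exact: h.
  rewrite /s; elim: Y => [|j Y IH] sub; first by rewrite !big_nil re0r.
  rewrite !big_cons reDr IH; last by move=> x xY; apply: sub; rewrite in_cons xY orbT.
  by rewrite /re innerZr pb// sub ?in_cons ?eqxx// normc_sqrE.
have bessel X : uniq X -> s X <= nrm v ^+ 2.
  move=> uX; have := re_ge0 (v - proj X).
  by rewrite !reE (reC v) pv pp// nrm_sqr; lra.
apply/eqP; rewrite eq_le; apply/andP; split.
  apply: ge_ereal_sup => _ [X [fX _] <-].
  rewrite fsbig_finite//= sumEFin lee_fin; apply: bessel; exact: finmap.fset_uniq.
apply/lee_addgt0Pr => e e0.
have se0 : 0 < Num.sqrt e by rewrite sqrtr_gt0.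
have [l hl] := lin_comb_approx tb v se0.
(* Indices may repeat in [l], while [bessel] and [pp] need them distinct. *)
pose X := undup [seq p.2 | p <- l].
have uX : uniq X by exact: undup_uniq.
have ort : re (v - proj X) (proj X - lin_comb b l) = 0.
  have h i : i \in X -> inner (v - proj X) (b i) = 0.
    by move=> iX; rewrite innerBl pb// iX subrr.
  rewrite /re innerBr; have -> : inner (v - proj X) (lin_comb b l) = 0.
    rewrite inner_lin_combr big_seq big1// => p pl; rewrite h ?mulr0//.
    by rewrite mem_undup; apply/mapP; exists p.
  suff -> : inner (v - proj X) (proj X) = 0 by rewrite subr0.
  have -> : proj X = lin_comb b [seq (c i, i) | i <- X] by rewrite /lin_comb big_map.
  rewrite -[X in inner (v - X)](_ : proj X = _); last by rewrite /lin_comb big_map.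
  rewrite inner_lin_combr big_map big_seq big1// => i iX.
  by rewrite h ?mulr0.
have le_e : nrm v ^+ 2 <= s X + e.
  have : re (v - lin_comb b l) (v - lin_comb b l) <= e.
    rewrite -nrm_sqr -[leRHS](sqr_sqrtr (ltW e0)).
    by rewrite lerXn2r ?nnegrE ?nrm_ge0 ?sqrtr_ge0// ltW.
  have -> : v - lin_comb b l = (v - proj X) + (proj X - lin_comb b l) by rewrite addrA subrK.
  have pyth (x y : H) : re x y = 0 -> re (x + y) (x + y) = re x x + re y y.
    by move=> xy; rewrite !reE (reC y x) xy; lra.
  rewrite pyth//; have := re_ge0 (proj X - lin_comb b l).
  have : re (v - proj X) (v - proj X) = nrm v ^+ 2 - s X.
    by rewrite !reDl !reDr !reNl !reNr (reC v (proj X)) pv pp// nrm_sqr; lra.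
  by lra.
apply: le_trans (_ : ((s X)%:E + e%:E <= _)%E); first by rewrite -EFinD lee_fin.
rewrite leeD2r//; apply: esum_ge; exists [set` X].
  by split => //; exact: finite_seq.
by rewrite -fsbig_seq// sumEFin.
Qed.

End OrthonormalBasis.

(** * Doubly stochastic matrices *)

Section DoublyStochastic.
Context {R : realType}.
Local Open Scope ereal_scope.

Lemma esum_one_finite (T : choiceType) (A : set T) n :
  (A #= `I_n)%card -> \esum_(i in A) (1%R%:E : \bar R) = (n%:R)%:E.
Proof.
move=> An; have fA : finite_set A by apply/finite_setP; exists n.
rewrite esum_fset// fsbig_finite// sumEFin -(card_fset_set An).
by rewrite big_const_seq count_predT -Monoid.iteropE.
Qed.

Lemma esum_one_infinite (T : choiceType) (A : set T) :
  infinite_set A -> \esum_(i in A) (1%R%:E : \bar R) = +oo.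
Proof.
move=> iA; apply/eqyP => M M0.
have [B BA nB] := infinite_set_fset (Num.bound M) iA.
apply: esum_ge; exists [set` B]; first by split.
rewrite fsbig_finite//= sumEFin lee_fin set_fsetK.
apply: (@le_trans _ _ ((size (finmap.enum_fset B))%:R)%R).
  apply: le_trans (_ : ((Num.bound M)%:R <= _)%R); last by rewrite ler_nat.
  exact/ltW/archi_boundP/ltW.
by rewrite big_const_seq count_predT -Monoid.iteropE.
Qed.

(** The sum of ones separates finite cardinals but is [+oo] on every infinite set, so countability
    has to identify the infinite ones. Hence the work component by component below. *)
Lemma card_eq_esum (T1 T2 : choiceType) (A : set T1) (B : set T2) :
  countable A -> countable B ->
  \esum_(i in A) (1%R%:E : \bar R) = \esum_(i in B) 1%R%:E -> (A #= B)%card.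
Proof.
move=> cA cB; have [fA|iA] := pselect (finite_set A); have [fB|iB] := pselect (finite_set B).
- move: (fA) (fB) => /finite_setP[n An] /finite_setP[m Bm].
  rewrite (esum_one_finite An) (esum_one_finite Bm) => -[/eqP].
  rewrite eqr_nat => /eqP nm; apply: card_eq_trans An _.
  by rewrite nm card_eq_sym.
- move: (fA) => /finite_setP[n An].
  by rewrite (esum_one_finite An) esum_one_infinite.
- move: (fB) => /finite_setP[n Bn].
  by rewrite (esum_one_finite Bn) esum_one_infinite.
- move=> _; apply: card_eq_trans (_ : (A #= [set: nat])%card) _.
    exact: eq_card_nat.
  by rewrite card_eq_sym; exact: eq_card_nat.
Qed.

Lemma esum_countable (T : choiceType) (a : T -> \bar R) :
  (forall i, 0 <= a i) -> \esum_(i in [set: T]) a i <= 1 ->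
  countable [set i | a i != 0].
Proof.
move=> a0 a1.
have -> : [set i | a i != 0] = \bigcup_(n in [set: nat]) [set i | (n.+1%:R^-1)%:E <= a i].
  apply/seteqP; split=> [i /= ai|i [n _ /= h]]; last first.
    by rewrite gt_eqF// (lt_le_trans _ h)// lte_fin invr_gt0 ltr0n.
  have : 0 < a i by rewrite lt_neqAle eq_sym ai a0.
  case E : (a i) => [r| |//]; last by exists 0%N => //=; rewrite E leey.
  rewrite lte_fin => r0; have [N hN] := @ltr_add_invr _ 0%R r r0.
  by exists N => //=; rewrite E lee_fin ltW//; move: hN; rewrite add0r.
apply: bigcup_countable => // n _; apply: finite_set_countable.
(* [n.+2] entries of size at least [n.+1%:R^-1] already exceed the total 1. *)
apply: contrapT => iS; have [B BA nB] := infinite_set_fset n.+2 iS.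
have : (n.+2%:R / n.+1%:R)%:E <= 1 :> \bar R.
  apply: le_trans a1; apply: esum_ge; exists [set` B]; first by split.
  rewrite fsbig_finite//= set_fsetK.
  apply: (@le_trans _ _ (\sum_(i <- B) (n.+1%:R^-1)%:E)).
    rewrite sumEFin lee_fin big_const_seq count_predT iter_addr_0 -[leRHS]mulr_natl.
    by rewrite ler_wpM2r// ler_nat.
  by rewrite big_seq [leRHS]big_seq; apply: lee_sum => i iB; exact: BA.
by rewrite lee_fin ler_pdivrMr ?ltr0n// mul1r ler_nat ltnn.
Qed.

Lemma esum_swap (T1 T2 : choiceType) (A : set T1) (B : set T2) (a : T1 -> T2 -> \bar R) :
  (forall i j, 0 <= a i j) ->
  \esum_(i in A) \esum_(j in B) a i j = \esum_(j in B) \esum_(i in A) a i j.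
Proof.
move=> a0; rewrite !esum_esum//.
apply: (@reindex_esum R _ _ _ _ (fun p => (p.2, p.1)) (fun p => a p.1 p.2)); split.
- by move=> [i j] /= [].
- by move=> [i j] [i' j'] _ _ /= [-> ->].
- by move=> [i j] /= [Ai Bj]; exists (j, i).
Qed.

Lemma esum_restrict (T : choiceType) (B : set T) (a : T -> \bar R) :
  (forall i, ~ B i -> a i = 0) -> \esum_(i in [set: T]) a i = \esum_(i in B) a i.
Proof.
move=> h; rewrite [RHS]esum_mkcond; apply: eq_esum => i _.
by case: ifPn => // /negP iB; apply: h => Bi; apply: iB; rewrite inE.
Qed.

(* The links [a j k != 0] form a bipartite graph of countable degree; on each
   of its components summation over rows and over columns counts both sides. *)
Lemma doubly_stochastic_bij (J K : choiceType) (a : J -> K -> \bar R) :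
  (forall j k, 0 <= a j k) ->
  (forall j, \esum_(k in [set: K]) a j k = 1) ->
  (forall k, \esum_(j in [set: J]) a j k = 1) ->
  exists s : J -> K, injective s /\ forall k, exists j, s j = k.
Proof.
move=> a0 aJ aK.
have Jk k : exists j, a j k != 0.
  apply: contrapT => h; have := aK k; rewrite esum1.
    by move=> /eqP; rewrite eq_sym onee_eq0.
  by move=> j _; apply: contrapT => /eqP ajk; apply: h; exists j.
have Kj j : exists k, a j k != 0.
  apply: contrapT => h; have := aJ j; rewrite esum1.
    by move=> /eqP; rewrite eq_sym onee_eq0.
  by move=> k _; apply: contrapT => /eqP ajk; apply: h; exists k.
pose sat (S : set J) := forall j1 j2 k, S j1 -> a j1 k != 0 -> a j2 k != 0 -> S j2.
(* The component of [j] as the least saturated set containing it, where [sat] closes under two links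
   through a common column. *)
pose comp j := [set j' | forall S, S j -> sat S -> S j'].
have comp_self j : comp j j by move=> S.
have comp_sat j : sat (comp j).
  by move=> j1 j2 k c1 a1 a2 S Sj sS; apply: (sS j1 j2 k) => //; exact: c1.
have comp_sym j j' : comp j j' -> comp j' j.
  move=> h S Sj' sS; apply: contrapT => nS.
  apply: (h (~` S)) => // j1 j2 k /= n1 a1 a2 S2; apply: n1.
  exact: (sS j2 j1 k).
have comp_sub j j' : comp j j' -> comp j' `<=` comp j.
  by move=> h x hx; apply: hx.
have comp_eq j j' : comp j j' -> comp j' = comp j.
  by move=> h; apply/seteqP; split; apply: comp_sub => //; exact: comp_sym.
pose col (C : set J) := [set k | exists2 j, C j & a j k != 0].
have colE (C : set J) : col C = \bigcup_(j in C) [set k | a j k != 0].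
  by apply/seteqP; split=> [k [j Cj h]|k [j Cj h]]; exists j.
have ccol C : countable C -> countable (col C).
  move=> cC; rewrite colE; apply: bigcup_countable => // j _.
  by apply: esum_countable => //; rewrite aJ.
have ccomp j : countable (comp j).
  (* Iterating the passage to rows two links away exhausts a saturated set; it is countable at each
     stage because rows and columns have countable support. *)
  pose step (S : set J) := \bigcup_(k in col S) [set j | a j k != 0].
  pose T := \bigcup_(n in [set: nat]) iter n step [set j].
  have cT : countable T.
    apply: bigcup_countable => // n _; elim: n => [|n IH] /=; first exact: countable1.
    apply: bigcup_countable; first exact: ccol.
    by move=> k _; apply: esum_countable => //; rewrite aK.
  apply: sub_countable cT; apply: subset_card_le => x; apply; first by exists 0%N.
  move=> j1 j2 k [n _ hn] a1 a2; exists n.+1 => //=.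
  by exists k => //; exists j1.
have cardC j : (comp j #= col (comp j))%card.
  apply: card_eq_esum; [exact: ccomp|exact/ccol/ccomp|].
  (* The weight of a row of the component sits in [col (comp j)], and conversely, so the double sum
     counts rows in one order and columns in the other. *)
  transitivity (\esum_(i in comp j) \esum_(k in col (comp j)) a i k).
    apply: eq_esum => i ci; rewrite -[LHS](aJ i); apply: esum_restrict => k nk.
    by apply: contrapT => /eqP h; apply: nk; exists i.
  rewrite esum_swap//; apply: eq_esum => k [i ci aik].
  rewrite -[RHS](aK k); apply/esym/esum_restrict => i' ni'.
  by apply: contrapT => /eqP h; apply: ni'; exact: (comp_sat j i i' k).
(* [f] is indexed by the component as a set, so that all its members use the same bijection; other
   sets receive an arbitrary function. *)
have /choice[f hf] (C : set J) : exists f : J -> K,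
    (exists j, C = comp j) -> set_bij C (col C) f.
  have [[j ->]|h] := pselect (exists j, C = comp j); last first.
    have [[f _]|nf] := pselect (exists f : J -> K, True); first by exists f.
    exfalso; apply: nf; have [g _] := choice Kj; by exists g.
  have [k0 _] := Kj j.
  have /card_bijP[g [g' gK g'K]] := cardC j.
  exists (fun i => if pselect (comp j i) is left h then set_val (g (SigSub (mem_set h))) else k0).
  move=> _; split.
  - move=> i ci; case: pselect => // h; exact: set_valP.
  - move=> i i'; rewrite !inE => ci ci'; case: pselect => // h; case: pselect => // h' e.
    have := val_inj e => /(can_inj gK) /(congr1 val); exact.
  - move=> k ck; pose i := g' (SigSub (mem_set ck)).
    exists (set_val i); first exact: set_valP.
    case: pselect => [h|[]]; last exact: set_valP.
    have -> : SigSub (mem_set h) = i by apply: val_inj.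
    by rewrite /i g'K.
have hfc j : set_bij (comp j) (col (comp j)) (f (comp j)) by apply: hf; exists j.
exists (fun j => f (comp j) j); split.
  move=> j j' e; have [fun1 _ _] := hfc j; have [fun2 _ _] := hfc j'.
  have [i ci aik] := fun1 j (comp_self j); have [i' ci' aik'] := fun2 j' (comp_self j').
  have cji' : comp j i' by apply: (comp_sat j i i' _ ci aik); rewrite e.
  have cc : comp j' = comp j by rewrite -(comp_eq _ _ cji') (comp_eq _ _ ci').
  move: e; rewrite cc; case: (hfc j) => _ inj _; apply: inj; rewrite inE //.
  by rewrite -cc.
move=> k; have [j ajk] := Jk k; have [_ _ surj] := hfc j.
have [|i ci <-] := surj k; first by exists j.
by exists i; rewrite (comp_eq _ _ ci).
Qed.

End DoublyStochastic.

(** * Multiplicity of the bilateral shift *)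

Section Multiplicity.
Context {R : realType} {E : hilbertType R}.

Definition iterz (f g : E -> E) (p : int) : E -> E :=
  match p with Posz n => iter n f | Negz n => iter n.+1 g end.

(** Since [g] is the adjoint of [f], powers can be collected on one side; a nonzero power is killed
    by the wandering hypothesis or its conjugates, and power zero is orthonormality of [b]. *)
Lemma iterz_orthonormal (f g : E -> E) (I : eqType) (b : I -> E) :
  (forall x y, inner (f x) (f y) = inner x y) -> cancel f g -> cancel g f ->
  orthonormal_family b ->
  (forall i j n, inner (b i) (iter n.+1 f (b j)) = 0) ->
  orthonormal_family (fun q : I * int => iterz f g q.2 (b q.1)).
Proof.
move=> fI fg gf ob hw.
have gI x y : inner (g x) (g y) = inner x y by rewrite -fI !gf.
have fgadj x y : inner (f x) y = inner x (g y) by rewrite -gI fg.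
have itf n x y : inner (iter n f x) (iter n f y) = inner x y.
  by elim: n => //= n <-.
have itg n x y : inner (iter n g x) (iter n g y) = inner x y.
  by elim: n => //= n <-.
have itadj n x y : inner (iter n f x) y = inner x (iter n g y).
  by elim: n y => //= n IH y; rewrite fgadj IH -iterSr.
have hwC i j n : inner (iter n.+1 f (b i)) (b j) = 0.
  by rewrite innerC hw conjc0.
have hg i j n : inner (b i) (iter n.+1 g (b j)) = 0 by rewrite -itadj hwC.
have hgC i j n : inner (iter n.+1 g (b i)) (b j) = 0.
  by rewrite innerC hg conjc0.
have same (h : E -> E) i j n m :
    (forall n x y, inner (iter n h x) (iter n h y) = inner x y) ->
    (forall i j n, inner (b i) (iter n.+1 h (b j)) = 0) ->
    (forall i j n, inner (iter n.+1 h (b i)) (b j) = 0) ->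
    inner (iter n h (b i)) (iter m h (b j)) = ((i == j) && (n == m))%:R.
  move=> hI h1 h2; have [nm|mn|->] := ltngtP n m.
  - have e : m = (n + (m - n.+1).+1)%N by rewrite addnS -addSn subnKC.
    by rewrite e iterD hI h1 andbF.
  - have e : n = (m + (n - m.+1).+1)%N by rewrite addnS -addSn subnKC.
    by rewrite e iterD hI h2 andbF.
  - by rewrite hI ob andbT.
move=> [i p] [j q]; rewrite xpair_eqE /=.
case: p => n; case: q => m /=.
- exact: same.
- by rewrite itadj -iterS -iterD addnS hg andbF.
- by rewrite innerC itadj -iterS -iterD addnS hg conjc0 andbF.
- by rewrite -!iterS same// eqSS.
Qed.

(** Each power of [V] composed with [A] is a linear isometry, so orthogonality to the images of a
    total family extends by approximation to all [A m], where [exp_total] applies. *)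
Lemma exp_basis_total U (HU : unitary_one_parameter_group U) (M : hilbertType R)
    (A : M -> E) (I : Type) (b : I -> M) : exp_system U A -> total_family b ->
  forall z, (forall i p, inner z (iterz (cayley U) (cayley (reverse U)) p (A (b i))) = 0) -> z = 0.
Proof.
move=> hA tb z hz; have HUo := reverse_group HU.
have AE (F : E -> E) : (forall (a : R[i]) u v, F (a *: u + v) = a *: F u + F v) ->
    (forall u, nrm (F u) = nrm u) ->
    (forall i, inner z (F (A (b i))) = 0) -> forall m, inner z (F (A m)) = 0.
  move=> Fl Fn Fb m; have [AZ _ _] := hA.
  have FA a u v : F (A (a *: u + v)) = a *: F (A u) + F (A v) by rewrite AZ Fl.
  have F0 : F (A 0) = 0.
    have := FA 1 0 0; rewrite !scale1r addr0 => /eqP.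
    by rewrite eq_sym -subr_eq0 addrK => /eqP.
  have Ac l : inner z (F (A (lin_comb b l))) = 0.
    rewrite /lin_comb; elim: l => [|p l IH]; first by rewrite big_nil F0 inner0r.
    by rewrite big_cons FA innerDr innerZr IH Fb mulr0 addr0.
  have An u : nrm (F (A u)) = nrm u by rewrite Fn /nrm /re (exp_inner HU hA).
  have AB u v : F (A (u - v)) = F (A u) - F (A v).
    by rewrite addrC -scaleN1r FA scaleN1r addrC.
  have key (w : E) : (forall l, inner w (F (A (lin_comb b l))) = 0) -> re w (F (A m)) = 0.
    move=> hw; apply/eqP; rewrite -normr_eq0 eq_le normr_ge0 andbT.
    apply/ler_addgt0Pr => e e0; rewrite add0r.
    have c0 : 0 < nrm w + 1 by have := nrm_ge0 w; lra.
    have [l hl] := lin_comb_approx tb m (divr_gt0 e0 c0).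
    have -> : re w (F (A m)) = re w (F (A (m - lin_comb b l))).
      by rewrite AB reDr reNr {3}/re hw /= oppr0 addr0.
    apply: le_trans (cauchy_schwarz _ _) _; rewrite An; move: hl; rewrite ltr_pdivlMr// => hl.
    apply: le_trans (ltW hl); rewrite mulrC; apply: ler_wpM2l; first exact: nrm_ge0.
    by rewrite lerDl.
  apply/inner_eq0P; split; first exact: key.
  have -> : re z ('i *: F (A m)) = re (- 'i *: z) (F (A m)).
    by rewrite /re innerZr innerZl; case: (inner z _) => x y /=; ring.
  by apply: key => l; rewrite innerZl Ac mulr0.
have itl (V : R -> {linear E -> E}) n : unitary_one_parameter_group V ->
    (forall (a : R[i]) u v, iter n (cayley V) (a *: u + v) =
      a *: iter n (cayley V) u + iter n (cayley V) v) /\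
    (forall u, nrm (iter n (cayley V) u) = nrm u).
  move=> HV; elim: n => //= n [IH1 IH2]; split=> [a u v|u].
    by rewrite IH1 cayley_linear.
  by rewrite cayley_nrm.
apply: (exp_total HU hA) => n m.
  have [l1 l2] := itl U n HU.
  by apply: AE => // i; exact: (hz i n).
case: n => [|n]; first by apply: (AE id) => // i; exact: (hz i 0).
have [l1 l2] := itl (reverse U) n.+1 HUo.
by apply: AE => // i; exact: (hz i (Negz n)).
Qed.

Lemma exp_system_unique U (HU : unitary_one_parameter_group U) (M N : hilbertType R)
    (A : M -> E) (B : N -> E) :
  exp_system U A -> exp_system U B -> hilbert_isomorphic M N.
Proof.
move=> hA hB; have HUo := reverse_group HU.
have [I [b [ob tb]]] := basis_exists M; have [J [c [oc tc]]] := basis_exists N.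
have oA : orthonormal_family (A \o b).
  by move=> i j /=; rewrite (exp_inner HU hA) ob.
have oB : orthonormal_family (B \o c).
  by move=> i j /=; rewrite (exp_inner HU hB) oc.
have adjiter n x y : inner (iter n (cayley U) x) y = inner x (iter n (cayley (reverse U)) y).
  by elim: n y => //= n IH y; rewrite cayley_adj// IH -iterSr.
have oVB : orthonormal_family
    (fun q : J * int => iterz (cayley U) (cayley (reverse U)) q.2 ((B \o c) q.1)).
  apply: iterz_orthonormal => //.
  - exact: cayley_inner.
  - exact: cayleyK_op.
  - exact: cayley_opK.
  - by move=> i j n; exact: (exp_wandering HU hB).
(* The powers run in the opposite direction here: [V ^ p B c_j] against [A b_i] is, up to
   conjugation, [V ^ - p A b_i] against [B c_j], so row and column sums share the index [p]. *)
have oVA : orthonormal_family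
    (fun q : I * int => iterz (cayley (reverse U)) (cayley U) q.2 ((A \o b) q.1)).
  apply: iterz_orthonormal => //.
  - exact: cayley_inner.
  - exact: cayley_opK.
  - exact: cayleyK_op.
  - by move=> i j n; rewrite -adjiter innerC (exp_wandering HU hA) conjc0.
have tVB : total_family
    (fun q : J * int => iterz (cayley U) (cayley (reverse U)) q.2 ((B \o c) q.1)).
  move=> z hz; apply: (exp_basis_total HU hB tc) => j p; exact: (hz (j, p)).
have tVA : total_family
    (fun q : I * int => iterz (cayley (reverse U)) (cayley U) q.2 ((A \o b) q.1)).
  move=> z hz; apply: (exp_basis_total HU hA tb) => i [n|n].
    case: n => [|n]; first exact: (hz (i, 0)).
    exact: (hz (i, Negz n)).
  exact: (hz (i, Posz n.+1)).
pose t i j (p : int) : \bar R :=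
  (Normc.normc (inner (A (b i)) (iterz (cayley U) (cayley (reverse U)) p (B (c j)))) ^+ 2)%:E.
have t0 i j p : (0 <= t i j p)%E by rewrite lee_fin sqr_ge0.
pose a i j := (\esum_(p in [set: int]) t i j p)%E.
have pv (H : choiceType) (s : H -> int -> \bar R) : (forall i p, (0 <= s i p)%E) ->
    (\esum_(i in [set: H]) \esum_(p in [set: int]) s i p =
    \esum_(q in [set: H * int]) s q.1 q.2)%E.
  by move=> s0; rewrite esum_esum//; congr (esum _ _); apply/seteqP; split.
have [|i|j|s [si ss]] := @doubly_stochastic_bij R I J a.
- by move=> i j; apply: esum_ge0 => p _.
- rewrite /a pv//; have := parseval (A (b i)) oVB tVB => /= ->.
  by rewrite -(expr1n _ 2) /nrm /re oA eqxx /= sqrtr1.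
- rewrite /a pv//; have := parseval (B (c j)) oVA tVA => /= h.
  rewrite (_ : (nrm (B (c j)) ^+ 2)%:E = 1%E) in h; last first.
    by rewrite /nrm /re oB eqxx /= sqrtr1 expr1n.
  rewrite -h; apply: eq_esum => -[i p] _ /=; rewrite /t; congr (_ ^+ 2)%:E.
  rewrite innerC; have nJ (w : R[i]) : Normc.normc (w^*%C) = Normc.normc w.
    by case: w => x y; rewrite /= sqrrN.
  rewrite nJ; congr Normc.normc; case: p => n.
    by rewrite /= adjiter.
  by rewrite /iterz innerC -adjiter -innerC.
apply: (@isomorphic_of_total R I M N b (c \o s)) => //.
  by move=> i j /=; rewrite ob oc (inj_eq si).
move=> z hz; apply: tc => j; have [i <-] := ss j; exact: hz.
Qed.

End Multiplicity.

(** * Strong measurability *)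

Section StrongMeasurability.
Context {R : realType}.
Local Notation D := (measurableTypeR R).

(** [simple_map] with an arbitrary target, so that indices, booleans and pairs are covered. *)
Definition finitely_valued (T : Type) (s : R -> T) : Prop :=
  finite_set (range s) /\ forall y, measurable (s @^-1` [set y] : set D).

Lemma finitely_valued_preimage (T : Type) (s : R -> T) (Y : set T) :
  finitely_valued s -> measurable (s @^-1` Y : set D).
Proof.
move=> [fs ms].
have -> : s @^-1` Y = \bigcup_(y in range s `&` Y) (s @^-1` [set y]).
  apply/seteqP; split=> [x /= Yx|x [y [_ Yy] /= ->]//].
  by exists (s x) => //; split => //; exists x.
by apply: fin_bigcup_measurable => //; exact: finite_setIl.
Qed.

Lemma finitely_valued_comp (T U : Type) (F : T -> U) (s : R -> T) :
  finitely_valued s -> finitely_valued (F \o s).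
Proof.
move=> hs; split.
  rewrite (_ : range _ = F @` range s); first by apply: finite_image; case: hs.
  by apply/seteqP; split=> [_ [x _ <-]|_ [_ [x _ <-] <-]]; [exists (s x)|exists x].
by move=> y; exact: (finitely_valued_preimage (F @^-1` [set y]) hs).
Qed.

Lemma finitely_valued_pair (T U : Type) (s : R -> T) (r : R -> U) :
  finitely_valued s -> finitely_valued r -> finitely_valued (fun x => (s x, r x)).
Proof.
move=> [fs ms] [fr mr]; split.
  apply: sub_finite_set (finite_setX fs fr) => _ [x _ <-].
  by split; exists x.
move=> [y z].
have -> : (fun x => (s x, r x)) @^-1` [set (y, z)] = s @^-1` [set y] `&` r @^-1` [set z].
  by apply/seteqP; split=> [x /= [-> ->]|x /= [-> ->]].
exact: measurableI.
Qed.

Lemma finitely_valued_comp2 (T U V : Type) (F : T -> U -> V) (s : R -> T) (r : R -> U) :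
  finitely_valued s -> finitely_valued r -> finitely_valued (fun x => F (s x) (r x)).
Proof.
move=> hs hr.
exact: (finitely_valued_comp (fun p => F p.1 p.2) (finitely_valued_pair hs hr)).
Qed.

Lemma finitely_valued_measurable (s : R -> R) :
  finitely_valued s -> measurable_fun [set: D] s.
Proof. by move=> hs _ Y mY; rewrite setTI; exact: finitely_valued_preimage. Qed.

Context {M : hilbertType R}.
Implicit Types (f g : R -> M) (y : nat -> M).

Lemma tends_re2 (x y : nat -> M) u v : tends x u -> tends y v ->
  (re (x n) (y n)) @[n --> \oo] --> re u v.
Proof.
move=> xu yv; apply/cvgrPdist_lt => e e0.
pose c := nrm u + nrm v + 2.
have c0 : 0 < c by rewrite /c; have := nrm_ge0 u; have := nrm_ge0 v; lra.
have d0 : 0 < Num.min 1 (e / c) by rewrite lt_min ltr01 divr_gt0.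
have [N hN] := xu _ d0; have [K hK] := yv _ d0.
near=> n.
have /hN : (N <= n)%N by near: n; exact: nbhs_infty_ge.
have /hK : (K <= n)%N by near: n; exact: nbhs_infty_ge.
rewrite !lt_min => /andP[y1 y2] /andP[x1 x2].
have -> : re u v - re (x n) (y n) = - (re (x n - u) (y n) + re u (y n - v)).
  by rewrite !reE; ring.
rewrite normrN; apply: le_lt_trans (ler_normD _ _) _.
have i1 := cauchy_schwarz (x n - u) (y n); have i2 := cauchy_schwarz u (y n - v).
have ny : nrm (y n) <= nrm v + 1.
  by have := nrmD (y n - v) v; rewrite subrK; lra.
have j1 := ler_wpM2l (nrm_ge0 (x n - u)) ny.
have j0 : 0 <= nrm v + 1 by have := nrm_ge0 v; lra.
have j2 := ler_wpM2r j0 (ltW x2).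
have j3 := ler_wpM2l (nrm_ge0 u) (ltW y2).
have : e / c * c = e by rewrite divfK// gt_eqF.
have : 0 < e / c by exact: divr_gt0.
rewrite {3}/c; lra.
Unshelve. all: by end_near. Qed.

Lemma tends_lin (x y : nat -> M) (a : R[i]) u v : tends x u -> tends y v ->
  tends (fun n => a *: x n + y n) (a *: u + v).
Proof.
move=> xu yv e e0.
have c0 : 0 <= Normc.normc a by case: (a) => *; exact: sqrtr_ge0.
have c1 : 0 < 2 * (Normc.normc a + 1) by lra.
have e2 : 0 < e / 2 by lra.
have [N hN] := xu _ (divr_gt0 e0 c1); have [K hK] := yv _ e2.
exists (maxn N K) => n; rewrite geq_max => /andP[/hN + /hK].
rewrite ltr_pdivlMr// => h1 h2.
rewrite opprD addrACA -scalerBr; apply: le_lt_trans (nrmD _ _) _; rewrite nrmZ.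
have q : Normc.normc a <= Normc.normc a + 1 by lra.
have := ler_wpM2r (nrm_ge0 (x n - u)) q; lra.
Qed.

Lemma strongly_measurable_measurable_re f g : strongly_measurable f -> strongly_measurable g ->
  measurable_fun [set: D] (fun x => re (f x) (g x)).
Proof.
move=> [s [hs sf]] [r [hr rg]].
apply: (@measurable_fun_cvg _ D R setT (fun n x => re (s n x) (r n x))).
  move=> n; apply: finitely_valued_measurable.
  exact: (finitely_valued_comp2 re (hs n) (hr n)).
move=> x _; apply: tends_re2; apply/cvg_tends; [exact: sf|exact: rg].
Qed.

Lemma strongly_measurable_lin f g (a : R[i]) : strongly_measurable f -> strongly_measurable g ->
  strongly_measurable (fun x => a *: f x + g x).
Proof.
move=> [s [hs sf]] [r [hr rg]]; exists (fun n x => a *: s n x + r n x); split.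
  by move=> n; exact: (finitely_valued_comp2 (fun u v => a *: u + v) (hs n) (hr n)).
by move=> x; apply/cvg_tends/tends_lin; apply/cvg_tends; [exact: sf|exact: rg].
Qed.

Lemma strongly_measurable_cst (m : M) : strongly_measurable (fun _ : R => m).
Proof.
exists (fun n x => m); split; last by move=> x; exact: cvg_cst.
move=> _; split.
  by apply: sub_finite_set (finite_set1 m) => _ [x _ <-].
move=> y; have [->|my] := pselect (m = y).
  by rewrite (_ : _ @^-1` _ = setT)//; apply/seteqP; split.
by rewrite (_ : _ @^-1` _ = set0)//; apply/seteqP; split => // x /=.
Qed.

Lemma strongly_measurable_scale f (a : R[i]) : strongly_measurable f ->
  strongly_measurable (fun x => a *: f x).
Proof.
move=> hf; have := strongly_measurable_lin a hf (strongly_measurable_cst 0).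
by congr strongly_measurable; apply/funext => x; rewrite addr0.
Qed.

Lemma strongly_measurable_sub f g : strongly_measurable f -> strongly_measurable g ->
  strongly_measurable (fun x => f x - g x).
Proof.
move=> hf hg; have := strongly_measurable_lin (-1) hg hf.
by congr strongly_measurable; apply/funext => x; rewrite scaleN1r addrC.
Qed.

(** The simple approximants have together only countably many values; [y] enumerates them. *)
Lemma strongly_measurable_separable f : strongly_measurable f ->
  exists y, forall x e, 0 < e -> exists i, nrm (f x - y i) < e.
Proof.
move=> [s [hs sf]]; pose A := \bigcup_(n in [set: nat]) range (s n).
have cA : countable A.
  apply: bigcup_countable => // n _.
  by apply: finite_set_countable; case: (hs n).
have /countable_injP[j jinj] := cA.
have /choice[y hy] (i : nat) : exists u, forall v, A v -> j v = i -> u = v.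
  have [[v [Av <-]]|h] := pselect (exists v, A v /\ j v = i).
    by exists v => w Aw /jinj -> //; rewrite inE.
  by exists 0 => v Av jv; exfalso; apply: h; exists v.
exists y => x e e0; have /cvg_tends/(_ e e0)[N hN] := sf x.
have AN : A (s N x) by exists N => //; exists x.
exists (j (s N x)); rewrite (hy _ _ AN erefl) nrmB.
exact: hN.
Qed.

(** A form of Pettis's theorem. The approximant picks a point nearest to [f x] among
    [y 0, ..., y n]; measurable distances make the index measurable. *)
Lemma strongly_measurable_approx f y : (forall x e, 0 < e -> exists i, nrm (f x - y i) < e) ->
  (forall i, measurable_fun [set: D] (fun x => re (f x - y i) (f x - y i))) ->
  strongly_measurable f.
Proof.
move=> hy hm; pose q i x := re (f x - y i) (f x - y i).
pose idx := fix idx n x : nat := if n is k.+1 then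
  (if q n x < q (idx k x) x then n else idx k x) else 0%N.
have mq n : measurable_fun [set: D] (fun x => q (idx n x) x).
  elim: n => [|n IH] /=; first exact: hm.
  have -> : (fun x => q (if q n.+1 x < q (idx n x) x then n.+1 else idx n x) x) =
      (fun x => Num.min (q n.+1 x) (q (idx n x) x)).
    by apply/funext => x; rewrite minEle; case: ltgtP => // ->.
  by apply: measurable_minr => //; exact: hm.
have fi n : finitely_valued (idx n).
  elim: n => [|n IH] /=.
    split; first by apply: sub_finite_set (finite_set1 0%N) => _ [x _ <-].
    move=> [|i].
      by rewrite (_ : _ @^-1` _ = setT)//; apply/seteqP; split.
    by rewrite (_ : _ @^-1` _ = set0)//; apply/seteqP; split.
  apply: (finitely_valued_comp2 (fun (b : bool) k => if b then n.+1 else k)) => //.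
  split; first exact: finite_finset.
  move=> b; rewrite -[X in measurable X]setTI.
  by apply: measurable_fun_ltr => //; exact: hm.
have qle n i x : (i <= n)%N -> q (idx n x) x <= q i x.
  elim: n => [|n IH]; first by rewrite leqn0 => /eqP ->.
  rewrite leq_eqVlt => /predU1P[->|] /=; first by case: ltP => // /ltW.
  rewrite ltnS => /IH h; case: ltP => // /ltW h'; exact: le_trans h' h.
exists (fun n x => y (idx n x)); split.
  by move=> n; exact: (finitely_valued_comp y (fi n)).
move=> x; apply/cvg_tends => e e0; have [i hi] := hy x e e0.
exists i => n /(qle _ _ x) h; apply: le_lt_trans hi; rewrite nrmB.
exact: ler_wsqrtr.
Qed.

(** The approximating sequences of all [g n] together approximate [f], and distances from [f] to
    their points are limits of measurable functions. *)
Lemma strongly_measurable_limit (g : nat -> R -> M) f : (forall n, strongly_measurable (g n)) ->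
  (forall x, tends (g ^~ x) (f x)) -> strongly_measurable f.
Proof.
move=> hg gf; have /choice[Y hY] n := strongly_measurable_separable (hg n).
pose dec k : nat * nat := odflt (0%N, 0%N) (choice.unpickle k).
pose y k := Y (dec k).1 (dec k).2.
apply: (@strongly_measurable_approx f y).
  move=> x e e0; have e2 : 0 < e / 2 by lra.
  have [N hN] := gf x _ e2; have [i hi] := hY N x _ e2.
  exists (choice.pickle (N, i)); rewrite /y /dec choice.pickleK /=.
  have := nrmD (f x - g N x) (g N x - Y N i); rewrite addrA subrK.
  have := hN N (leqnn N); rewrite nrmB; lra.
move=> i; apply: (@measurable_fun_cvg _ D R setT
    (fun n x => re (g n x - y i) (g n x - y i))).
  by move=> n; apply: strongly_measurable_measurable_re; apply: strongly_measurable_sub => //; exact: strongly_measurable_cst.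
move=> x _; have t : tends (fun n => g n x - y i) (f x - y i).
  move=> e e0; have [N hN] := gf x e e0; exists N => n /hN.
  by rewrite opprB addrA subrK.
exact: tends_re2.
Qed.

Lemma strongly_measurable_scalar (h : R -> R) (m : M) : measurable_fun [set: D] h ->
  strongly_measurable (fun x => (h x)%:C *: m).
Proof.
(* Rational multiples of [m] approximate every value. *)
move=> mh; pose y k : M := (ratr (odflt 0 (choice.unpickle k)) : R)%:C *: m.
apply: (@strongly_measurable_approx _ y).
  move=> x e e0; have c0 : 0 < nrm m + 1 by have := nrm_ge0 m; lra.
  have d0 : 0 < e / (nrm m + 1) by exact: divr_gt0.
  have [r] := @rat_in_itvoo R (h x - e / (nrm m + 1)) (h x + e / (nrm m + 1)) ltac:(lra).
  rewrite in_itv /= => /andP[r1 r2]; exists (choice.pickle r).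
  rewrite /y choice.pickleK /= -scalerBl -rmorphB nrmZr.
  have hr : `|h x - ratr r| < e / (nrm m + 1) by rewrite ltr_norml; apply/andP; split; lra.
  move: hr; rewrite ltr_pdivlMr// => hr; apply: le_lt_trans hr.
  by apply: ler_wpM2l; rewrite ?normr_ge0 ?lerDl.
move=> i.
have -> : (fun x => re ((h x)%:C *: m - y i) ((h x)%:C *: m - y i)) =
    (fun x => (h x - ratr (odflt 0 (choice.unpickle i))) ^+ 2 * re m m).
  by apply/funext => x; rewrite /y -scalerBl -rmorphB !reE; ring.
apply: measurable_funM => //; apply: measurable_funX.
exact: measurable_funB.
Qed.

Lemma strongly_measurable_restrict (G : set R) f : measurable (G : set D) -> strongly_measurable f ->
  strongly_measurable (fun x => if x \in G then f x else 0).
Proof.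
move=> mG [s [hs sf]]; exists (fun n x => if x \in G then s n x else 0); split.
  move=> n; apply: (finitely_valued_comp2 (fun (b : bool) u => if b then u else 0) _ (hs n)).
  split; first exact: finite_finset.
  move=> [].
    rewrite (_ : _ @^-1` _ = G)//; apply/seteqP.
    by split=> x /=; [move/set_mem|move/mem_set].
  rewrite (_ : _ @^-1` _ = ~` G); first exact: measurableC.
  apply/seteqP; split=> x /=; first by move=> h /mem_set; rewrite h.
  by move=> h; apply/negP => /set_mem.
by move=> x; case: ifP => _; [exact: sf|exact: cvg_cst].
Qed.

Lemma measurable_subr (t : R) : measurable_fun [set: D] (fun x : D => x - t : D).
Proof. by apply: measurable_funB. Qed.

Lemma strongly_measurable_translation f (t : R) : strongly_measurable f -> strongly_measurable (translation t f).
Proof.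
move=> [s [hs sf]]; exists (fun n => translation t (s n)); split; last first.
  by move=> x; exact: sf.
move=> n; have [fs ms] := hs n; split.
  by apply: sub_finite_set fs => _ [x _ <-]; exists (x - t).
move=> y; have := measurable_subr t measurableT (ms y); rewrite setTI; exact.
Qed.

End StrongMeasurability.

(** * Translation invariance of Lebesgue measure *)

Section Translation.
Context {R : realType}.
Local Notation mu := (@lebesgue_measure R).
Local Notation D := (measurableTypeR R).

Definition subr_at (t : R) : D -> D := fun x => x - t.

HB.instance Definition _ (t : R) :=
  isMeasurableFun.Build _ _ D D (subr_at t) (measurable_subr t).

Lemma lebesgue_measure_translate (t : R) (A : set D) : measurable A ->
  pushforward mu (subr_at t) A = mu A.
Proof.
move=> mA; apply/esym/lebesgue_measure_unique => //= _ [[a b]] _ <-.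
rewrite /pushforward.
have -> : subr_at t @^-1` [set` `]a, b]] = [set` `](a + t), (b + t)]].
  by apply/seteqP; split=> x /=; rewrite !in_itv /= ltrBrDr lerBlDr.
rewrite !lebesgue_measure_itv /= !lte_fin ltrD2r.
by case: ifP => // _; rewrite -!EFinB; congr EFin; lra.
Qed.

Lemma ae_translate (t : R) (P : R -> Prop) :
  (\forall x \ae mu, P x) -> \forall x \ae mu, P (x - t).
Proof.
move=> [N [mN N0 PN]]; exists (subr_at t @^-1` N); split.
- by rewrite -[X in measurable X]setTI; exact: measurable_subr.
- have := lebesgue_measure_translate t mN; rewrite /pushforward N0; exact.
- by move=> x /= h; apply: PN.
Qed.

Lemma ae_imply (P Q : R -> Prop) : (forall x, P x -> Q x) ->
  (\forall x \ae mu, P x) -> \forall x \ae mu, Q x.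
Proof.
move=> PQ [N [mN N0 PN]]; exists N; split => // x /= h.
by apply: PN => /= Px; apply: h; exact: PQ.
Qed.

Lemma ae_imply2 (P Q S : R -> Prop) : (forall x, P x -> Q x -> S x) ->
  (\forall x \ae mu, P x) -> (\forall x \ae mu, Q x) -> \forall x \ae mu, S x.
Proof.
move=> PQS [N [mN N0 PN]] [K [mK K0 QK]]; exists (N `|` K); split => //.
- exact: measurableU.
- apply/eqP; rewrite -measure_le0; apply: le_trans (measureU2 mu mN mK) _.
  by rewrite [X in (X + _)%E]N0 [X in (_ + X)%E]K0 adde0.
move=> x /= h; apply: contrapT => /not_orP[nN nK]; apply: h; apply: PQS.
  by apply: contrapT => /PN.
by apply: contrapT => /QK.
Qed.

Lemma ge0_integral_translate (t : R) (h : R -> \bar R) : measurable_fun [set: D] h ->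
  (forall x, (0 <= h x)%E) ->
  (\int[mu]_x h (x - t)%R = \int[mu]_x h x)%E.
Proof.
move=> mh h0; have mp : measurable_fun [set: D] (subr_at t) := measurable_subr t.
have := ge0_integral_pushforward mp mu measurableT mh (fun x _ => h0 x).
rewrite preimage_setT => <-.
apply: eq_measure_integral => //= A mA _; exact: lebesgue_measure_translate.
Qed.

Lemma integral_translate (t : R) (h : R -> \bar R) : measurable_fun [set: D] h ->
  mu.-integrable setT (fun x => h (x - t)) ->
  (\int[mu]_x h (x - t)%R = \int[mu]_x h x)%E.
Proof.
move=> mh ih; have mp : measurable_fun [set: D] (subr_at t) := measurable_subr t.
have := @integral_pushforward _ _ D D R _ mp mu setT h mh.
rewrite preimage_setT => /(_ ih measurableT) <-.
apply: eq_measure_integral => //= A mA _; exact: lebesgue_measure_translate.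
Qed.

End Translation.

(** * Square-integrable functions *)

Section L2Theory.
Context {R : realType} {M : hilbertType R}.
Local Notation mu := (@lebesgue_measure R).
Local Notation D := (measurableTypeR R).
Implicit Types (f g h : R -> M).

(** Elements stay functions, with no quotient by null sets; uniqueness statements are therefore
    almost-everywhere equalities. *)
Definition L2_re f g : R := \int[mu]_x re (f x) (g x).

Lemma L2_sm f : L2 f -> strongly_measurable f. Proof. by case. Qed.

Lemma L2_sq_integrable f : L2 f -> mu.-integrable setT (EFin \o (fun x => re (f x) (f x))).
Proof.
move=> [sf intf]; apply/integrableP; split.
  by apply/measurable_EFinP; exact: strongly_measurable_measurable_re.
by under eq_integral do rewrite /= ger0_norm ?re_ge0//.
Qed.

Lemma L2_of_integrable f : strongly_measurable f ->
  mu.-integrable setT (EFin \o (fun x => re (f x) (f x))) -> L2 f.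
Proof.
move=> sf /integrableP[_ h]; split => //; move: h.
by under eq_integral do rewrite /= ger0_norm ?re_ge0//.
Qed.

Lemma re_absle (u v : M) : `|re u v| <= re u u + re v v.
Proof.
have := re_ge0 (u + v); have := re_ge0 (u - v); have := re_ge0 u; have := re_ge0 v.
by rewrite !reE (reC v u) ler_norml => *; apply/andP; split; lra.
Qed.

Lemma L2_integrable f g : L2 f -> L2 g ->
  mu.-integrable setT (EFin \o (fun x => re (f x) (g x))).
Proof.
move=> hf hg.
have := integrableD measurableT (L2_sq_integrable hf) (L2_sq_integrable hg).
apply: le_integrable => //.
  apply/measurable_EFinP; apply: strongly_measurable_measurable_re; exact: L2_sm.
by move=> x _ /=; rewrite lee_fin (le_trans (re_absle _ _))// ler_norm.
Qed.

Lemma L2_scale (a : R[i]) f : L2 f -> L2 (fun x => a *: f x).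
Proof.
move=> hf; apply: L2_of_integrable; first exact/strongly_measurable_scale/L2_sm.
have := integrableZl measurableT (Normc.normc a ^+ 2) (L2_sq_integrable hf).
by apply: eq_integrable => // x _ /=; rewrite -EFinM -!nrm_sqr nrmZ exprMn.
Qed.

Lemma L2_add f g : L2 f -> L2 g -> L2 (fun x => f x + g x).
Proof.
move=> hf hg; apply: L2_of_integrable.
  have := strongly_measurable_lin 1 (L2_sm hf) (L2_sm hg); congr strongly_measurable.
  by apply/funext => x; rewrite scale1r.
have i1 := L2_integrable hf hg.
have := integrableD measurableT (integrableD measurableT (L2_sq_integrable hf)
  (L2_sq_integrable hg)) (integrableD measurableT i1 i1).
apply: eq_integrable => // x _ /=.
by rewrite -!EFinD; congr EFin; rewrite !reE (reC (g x)); ring.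
Qed.

Lemma L2_lin (a : R[i]) f g : L2 f -> L2 g -> L2 (fun x => a *: f x + g x).
Proof. by move=> hf hg; apply: L2_add => //; exact: L2_scale. Qed.

Lemma L2_sub f g : L2 f -> L2 g -> L2 (fun x => f x - g x).
Proof.
move=> hf hg; have := L2_lin (-1) hg hf; congr L2.
by apply/funext => x; rewrite scaleN1r addrC.
Qed.

Lemma L2_0 : L2 (fun _ : R => 0 : M).
Proof.
split; first exact: strongly_measurable_cst.
by under eq_integral do rewrite inner0l /=; rewrite integral0.
Qed.

Lemma L2_innerE f g : L2_inner f g = L2_re f g +i* L2_re f (fun x => 'i *: g x).
Proof.
rewrite /L2_inner; congr (_ +i* _); apply: eq_Rintegral => x _.
exact: im_inner.
Qed.

Lemma L2_reC f g : L2_re f g = L2_re g f.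
Proof. by apply: eq_Rintegral => x _; rewrite reC. Qed.

Lemma L2_reDl f g h : L2 f -> L2 g -> L2 h ->
  L2_re (fun x => f x + g x) h = L2_re f h + L2_re g h.
Proof.
move=> hf hg hh; rewrite /L2_re -RintegralD//; [|exact: L2_integrable..].
by apply: eq_Rintegral => x _; rewrite reDl.
Qed.

Lemma L2_reZl (k : R) f h : L2 f -> L2 h -> L2_re (fun x => k%:C *: f x) h = k * L2_re f h.
Proof.
move=> hf hh; rewrite /L2_re -RintegralZl//; last exact: L2_integrable.
by apply: eq_Rintegral => x _; rewrite reZl.
Qed.

Lemma L2_reBl f g h : L2 f -> L2 g -> L2 h ->
  L2_re (fun x => f x - g x) h = L2_re f h - L2_re g h.
Proof.
move=> hf hg hh; rewrite /L2_re -RintegralB//; [|exact: L2_integrable..].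
by apply: eq_Rintegral => x _; rewrite reDl reNl.
Qed.

Lemma L2_re_ge0 f : 0 <= L2_re f f.
Proof. by apply: Rintegral_ge0 => x _; exact: re_ge0. Qed.

Lemma L2_re_ae f f' g : L2 f -> L2 f' -> L2 g -> f = f' %[ae mu] -> L2_re f g = L2_re f' g.
Proof.
move=> hf hf' hg e; rewrite /L2_re /Rintegral; congr fine.
apply: ae_eq_integral => //.
- by apply/measurable_EFinP; apply: strongly_measurable_measurable_re; exact: L2_sm.
- by apply/measurable_EFinP; apply: strongly_measurable_measurable_re; exact: L2_sm.
by apply: ae_imply e => x /(_ I) /= ->.
Qed.

(** A parametrized substitute for Cauchy-Schwarz, from positivity of the form at [g + k f] and
    [g - k f]; later [k] is [2 ^+ n] or a norm. *)
Lemma L2_re_young f g (k : R) : L2 f -> L2 g -> 0 < k ->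
  `|L2_re f g| <= k * L2_re f f + L2_re g g / k.
Proof.
move=> hf hg k0.
have pos (s : R) : 0 <= s ^+ 2 * L2_re f f + 2 * s * L2_re f g + L2_re g g.
  have hs : L2 (fun x => s%:C *: f x) := L2_scale s%:C hf.
  have hsum := L2_add hs hg.
  have := L2_re_ge0 (fun x => s%:C *: f x + g x); rewrite L2_reDl//.
  rewrite [L2_re _ (fun x => _ + _)]L2_reC L2_reDl//.
  rewrite [L2_re g (fun x => _ + _)]L2_reC L2_reDl// !L2_reZl//.
  rewrite [L2_re f (fun x => _ *: _)]L2_reC L2_reZl// [L2_re g _]L2_reC L2_reZl//; lra.
have h1 := pos k; have h2 := pos (- k).
rewrite sqrrN in h2.
have kk : 0 <= L2_re f f * k by rewrite mulr_ge0 ?L2_re_ge0// ltW.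
have gg : 0 <= L2_re g g / k by rewrite divr_ge0 ?L2_re_ge0// ltW.
rewrite -(ler_pM2l k0) mulrDr [k * (_ / k)]mulrCA divff ?mulr1 ?gt_eqF//.
have gg0 := L2_re_ge0 g; have ff0 : 0 <= k ^+ 2 * L2_re f f by rewrite mulr_ge0 ?sqr_ge0 ?L2_re_ge0.
have -> : k * `|L2_re f g| = `|k * L2_re f g| by rewrite normrM gtr0_norm.
rewrite mulrA -expr2 ler_norml; apply/andP; split; lra.
Qed.

Lemma translation_L2 f t : L2 f -> L2 (translation t f).
Proof.
move=> [sf intf]; split; first exact: strongly_measurable_translation.
rewrite /translation (ge0_integral_translate t (h := fun x => (complex.Re (inner (f x) (f x)))%:E))//.
  by apply/measurable_EFinP; exact: (strongly_measurable_measurable_re sf sf).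
by move=> x; rewrite lee_fin; exact: re_ge0.
Qed.

Lemma L2_re_translation f g t : L2 f -> L2 g -> L2_re (translation t f) (translation t g) = L2_re f g.
Proof.
move=> hf hg; rewrite /L2_re /Rintegral; congr fine.
apply: (integral_translate (h := fun x => (re (f x) (g x))%:E)).
  by apply/measurable_EFinP; apply: strongly_measurable_measurable_re; exact: L2_sm.
by apply: L2_integrable; exact: translation_L2.
Qed.

End L2Theory.

(** * Exponential functions in the model *)

Section Exponentials.
Context {R : realType}.
Local Notation mu := (@lebesgue_measure R).
Local Notation D := (measurableTypeR R).

(** The factor [Num.sqrt 2] gives unit norm, so that the Gram kernel is exactly that of the
    wandering orbits. *)
Definition exp_tail (t x : R) : R := Num.sqrt 2 * expR (t - x) * \1_`]t, +oo[ x.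

Lemma exp_tail_gt t x : t < x -> exp_tail t x = Num.sqrt 2 * expR (t - x).
Proof.
by move=> tx; rewrite /exp_tail indicE mem_set ?mulr1//= in_itv /= tx.
Qed.

Lemma exp_tail_le t x : x <= t -> exp_tail t x = 0.
Proof.
move=> tx; rewrite /exp_tail indicE memNset ?mulr0//= in_itv /= andbT.
by rewrite ltNge tx.
Qed.

Lemma exp_tail_measurable t : measurable_fun [set: D] (exp_tail t).
Proof.
apply: measurable_funM; last exact: measurable_indic.
apply: measurable_funM => //; apply: measurableT_comp; first exact: measurable_expR.
exact: measurable_funB.
Qed.

Lemma exp_tail_integral s t :
  (\int[mu]_x (exp_tail s x * exp_tail t x)%:E = (expR (- `|s - t|))%:E)%E.
Proof.
wlog st : s t / s <= t.
  move=> h; have [st|ts] := leP s t; first exact: h.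
  rewrite distrC -h ?ltW//; apply: eq_integral => x _; congr EFin; exact: mulrC.
have -> : - `|s - t| = s - t by rewrite distrC ger0_norm ?subr_ge0//; ring.
(* For [s <= t] the supports overlap in [x > t], where the product is [2 * expR (s + t - 2 * x)]. *)
have -> : (\int[mu]_x (exp_tail s x * exp_tail t x)%:E =
    \int[mu]_(x in `]t, +oo[) (2 * expR (s + t - 2 * x))%:E)%E.
  rewrite [RHS]integral_mkcond; apply: eq_integral => x _.
  rewrite patchE; case: ifPn => [|/negP] xt.
    move: xt; rewrite inE /= in_itv /= andbT => tx.
    rewrite !exp_tail_gt//; last exact: le_lt_trans tx.
    rewrite mulrACA -expr2 sqr_sqrtr// -expRD; congr (_ * expR _)%:E; ring.
  rewrite [exp_tail t x]exp_tail_le ?mulr0// leNgt; apply/negP => tx; apply: xt.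
  by rewrite inE /= in_itv /= tx.
have dF (x : R) : is_derive x (1 : R) (fun x => - expR (s + t - 2 * x))
    (2 * expR (s + t - 2 * x)).
  apply: trigger_derive; rewrite /GRing.scale /=; ring.
have cF : continuous (fun x : R => expR (s + t - 2 * x)).
  move=> x; have h : (s + t - 2 * y) @[y --> x] --> s + t - 2 * x.
    by apply: cvgB; [exact: cvg_cst|apply: cvgM; [exact: cvg_cst|exact: cvg_id]].
  exact: (cvg_comp _ _ h (@continuous_expR R _)).
have cF2 : continuous (fun x : R => 2 * expR (s + t - 2 * x)).
  by move=> x; exact: (cvgM (cvg_cst _) (cF x)).
rewrite integral_itv_obnd_cbnd; last first.
  apply/measurable_EFinP/measurable_funTS.
  by apply: continuous_measurable_fun; exact: cF2.
rewrite (@ge0_continuous_FTC2y _ _ (fun x => - expR (s + t - 2 * x)) _ 0).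
- rewrite sub0e EFinN oppeK; congr (expR _)%:E; ring.
- by move=> x _; rewrite mulr_ge0// expR_ge0.
- exact/continuous_subspaceT.
- rewrite -oppr0; apply: cvgN.
  have -> : (fun x : R => expR (s + t - 2 * x)) =
      (fun x => expR (s + t) * (expR (- x) * expR (- x))).
    by apply/funext => x; rewrite -!expRD; congr expR; ring.
  rewrite -(mulr0 (expR (s + t))) -(mulr0 0); apply: cvgM; first exact: cvg_cst.
  by apply: cvgM; exact: cvgr_expR.
- by move=> x _; exact: (@ex_derive _ _ _ _ _ _ _ (dF x)).
- by apply: cvg_at_right_filter; apply: cvgN; exact: cF.
- by move=> x _; rewrite derive1E (@derive_val _ _ _ _ _ _ _ (dF x)).
Qed.

Lemma exp_tail_integrable s t : mu.-integrable setT (EFin \o (fun x => exp_tail s x * exp_tail t x)).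
Proof.
have ge0 u x : 0 <= exp_tail u x.
  by rewrite /exp_tail mulr_ge0 ?indic_ge0// mulr_ge0 ?sqrtr_ge0 ?expR_ge0.
apply/integrableP; split.
  by apply/measurable_EFinP; apply: measurable_funM; exact: exp_tail_measurable.
under eq_integral do rewrite /= ger0_norm ?mulr_ge0//.
by rewrite exp_tail_integral ltry.
Qed.

Context {M : hilbertType R}.

Definition exp_vec (t : R) (m : M) : R -> M := fun x => (exp_tail t x)%:C *: m.

Lemma exp_vec_L2 t m : L2 (exp_vec t m).
Proof.
apply: L2_of_integrable; first exact: (strongly_measurable_scalar m (exp_tail_measurable t)).
have := integrableZl measurableT (re m m) (exp_tail_integrable t t).
by apply: eq_integrable => // x _ /=; rewrite -EFinM /exp_vec !reE; congr EFin; ring.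
Qed.

Lemma L2_re_exp_vec s t m n : L2_re (exp_vec s m) (exp_vec t n) = expR (- `|s - t|) * re m n.
Proof.
have e : \int[mu]_x (exp_tail s x * exp_tail t x) = expR (- `|s - t|).
  by rewrite /Rintegral exp_tail_integral.
rewrite -e mulrC -RintegralZl//; last exact: exp_tail_integrable.
by apply: eq_Rintegral => x _; rewrite /exp_vec !reE; ring.
Qed.

Lemma exp_vecZ (a : R[i]) t m : (fun x => a *: exp_vec t m x) = exp_vec t (a *: m).
Proof. by apply/funext => x; rewrite /exp_vec !scalerA mulrC. Qed.

Lemma L2_inner_exp_vec s t m n :
  L2_inner (exp_vec s m) (exp_vec t n) = (expR (- `|s - t|))%:C * inner m n.
Proof.
rewrite L2_innerE exp_vecZ !L2_re_exp_vec inner_re.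
by apply/eqP; rewrite eq_complex /=; apply/andP; split; apply/eqP; ring.
Qed.

Lemma exp_vec_translation s t m : translation t (exp_vec s m) = exp_vec (s + t) m.
Proof.
apply/funext => x; rewrite /translation /exp_vec; congr (_%:C *: _).
have [h|h] := ltP s (x - t).
  by rewrite !exp_tail_gt//; [congr (_ * expR _); ring|lra].
by rewrite !exp_tail_le//; lra.
Qed.

Lemma ae_forall_nat (P : nat -> R -> Prop) :
  (forall n, \forall x \ae mu, P n x) -> \forall x \ae mu, forall n, P n x.
Proof.
move=> h; have := negligible_bigcup h.
by apply: negligibleS => x /= /existsNP[n nP]; exists n.
Qed.

(* By differentiation of the vanishing primitives of [re (f x) n * expR (- x)]. *)
Lemma L2_re_exp_vec_eq0 (f : R -> M) n t0 : L2 f -> (forall t, L2_re f (exp_vec t n) = 0) ->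
  \forall x \ae mu, re (f x) (exp_vec t0 n x) = 0.
Proof.
move=> hf h; pose psi x := re (f x) (exp_vec t0 n x).
have ipsi : mu.-integrable setT (EFin \o psi) := L2_integrable hf (exp_vec_L2 t0 n).
have F0 x : \int[mu]_(y in `]-oo, x]) psi y = 0.
  rewrite Rintegral_mkcond; have [tx|xt] := leP t0 x; last first.
    have -> : psi \_ `]-oo, x] = cst 0.
      apply/funext => y; rewrite patchE; case: ifPn => //.
      rewrite inE /= in_itv /= => yx; rewrite /psi /exp_vec exp_tail_le ?scale0r ?re0r//.
      by apply: ltW; exact: le_lt_trans xt.
    by rewrite Rintegral_cst// mul0r.
  (* Beyond [x] the function [exp_vec t0 n] is [expR (t0 - x)] times [exp_vec x n], so cutting [psi]
     at [x] subtracts a function whose integral vanishes by hypothesis. *)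
  have -> : psi \_ `]-oo, x] = (fun y => psi y - expR (t0 - x) * re (f y) (exp_vec x n y)).
    apply/funext => y; rewrite patchE; case: ifPn => [|/negP].
      rewrite inE /= in_itv /= => yx.
      by rewrite /exp_vec (exp_tail_le yx) scale0r re0r mulr0 subr0.
    move=> yx; have xy : x < y.
      by rewrite ltNge; apply/negP => h'; apply: yx; rewrite inE /= in_itv /= h'.
    rewrite /psi /exp_vec !exp_tail_gt//; last exact: le_lt_trans xy.
    rewrite !reE (_ : t0 - y = (t0 - x) + (x - y)); last by ring.
    by rewrite expRD; transitivity (0 : R) => //; ring.
  have ix := L2_integrable hf (exp_vec_L2 x n).
  rewrite RintegralB//; last exact: (integrableZl measurableT (expR (t0 - x)) ix).
  rewrite RintegralZl// -/(L2_re f (exp_vec t0 n)) -/(L2_re f (exp_vec x n)) !h.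
  by rewrite mulr0 subr0.
have := @FTC1Ny R psi.
move=> /(_ _ _)[]; first by move=> y; exact: integrableS ipsi.
  by apply: open_integrable_locally => //; exact: openT.
move=> N [mN N0 NP]; exists N; split => // x /= nx; apply: NP => /= -[_].
rewrite (_ : (fun x => _) = cst 0); last by apply/funext => y; exact: F0.
by rewrite derive1_cst => /esym.
Qed.

(** Strong measurability supplies countably many [y i] approximating every value, and the starting
    points [- k] exhaust the line. Outside one null set [f x] is thus orthogonal to vectors
    arbitrarily close to it. *)
Lemma L2_total (f : R -> M) : L2 f -> (forall t n, L2_re f (exp_vec t n) = 0) ->
  f = (fun=> 0) %[ae mu].
Proof.
move=> hf h; have [y hy] := strongly_measurable_separable (L2_sm hf).
have : \forall x \ae mu, forall k i, re (f x) (exp_vec (- k%:R) (y i) x) = 0.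
  apply: ae_forall_nat => k; apply: ae_forall_nat => i.
  by apply: L2_re_exp_vec_eq0 => // t; exact: h.
apply: ae_imply => x hx _; pose k := Num.bound `|x|.
have kx : - k%:R < x.
  have := archi_boundP (normr_ge0 x); have := ler_norm (- x); rewrite normrN /k; lra.
have hi i : re (f x) (y i) = 0.
  have := hx k i; rewrite /exp_vec exp_tail_gt// reZr => /eqP; rewrite mulf_eq0.
  move=> /orP[|/eqP//]; rewrite mulf_eq0 gt_eqF ?sqrtr_gt0//=.
  by rewrite gt_eqF ?expR_gt0.
apply/nrm0_eq0/eqP; rewrite eq_le nrm_ge0 andbT; apply/ler_addgt0Pr => e e0.
have [i hie] := hy x e e0; rewrite add0r.
have [->|z0] := eqVneq (nrm (f x)) 0; first exact: ltW.
have zp : 0 < nrm (f x) by rewrite lt_neqAle eq_sym z0 nrm_ge0.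
have := re_le_nrm (f x) (f x - y i); rewrite reDr reNr hi oppr0 addr0 -nrm_sqr expr2.
rewrite ler_pM2l// => q; by apply: le_trans q _; exact: ltW.
Qed.

End Exponentials.

(** * Completeness of the square-integrable functions *)

Section RieszFischer.
Context {R : realType} {M : hilbertType R}.
Local Notation mu := (@lebesgue_measure R).
Local Notation D := (measurableTypeR R).

Lemma geometric_limit (u : nat -> M) (c : R) : 0 <= c ->
  (forall n, nrm (u n.+1 - u n) <= c * 2^-1 ^+ n) ->
  exists l, tends u l /\ forall n, nrm (l - u n) <= 2 * c * 2^-1 ^+ n.
Proof.
move=> c0 h.
have far n k : nrm (u (n + k)%N - u n) <= 2 * c * 2^-1 ^+ n - 2 * c * 2^-1 ^+ (n + k).
  elim: k => [|k IH]; first by rewrite addn0 !subrr nrm0.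
  have := nrmD (u (n + k).+1 - u (n + k)%N) (u (n + k)%N - u n).
  by rewrite addrA subrK addnS exprS; have := h (n + k)%N; lra.
have p0 n : 0 <= 2 * c * 2^-1 ^+ n by rewrite mulr_ge0 ?mulr_ge0// exprn_ge0.
have far' n k : (n <= k)%N -> nrm (u k - u n) <= 2 * c * 2^-1 ^+ n.
  by move=> nk; have := far n (k - n)%N; rewrite subnKC//; have := p0 k; lra.
have small (e : R) : 0 < e -> exists N, 2 * c * 2^-1 ^+ N < e.
  move=> e0; have [N hN] := @ltr_add_invr _ 0 (e / (2 * c + 1)) ltac:(apply: divr_gt0 => //; lra).
  exists N; move: hN; rewrite add0r ltr_pdivlMr; last lra.
  have pN : 2^-1 ^+ N <= N.+1%:R^-1 :> R.
    rewrite exprVn lef_pV2 ?posrE ?exprn_gt0 ?ltr0n// -natrX ler_nat.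
    exact: ltn_expl.
  have n0 : 0 <= N.+1%:R^-1 :> R by rewrite invr_ge0.
  have c20 : 0 <= 2 * c by lra.
  move=> hh; apply: le_lt_trans hh; have := ler_wpM2l c20 pN.
  by move: n0; set q := N.+1%:R^-1; lra.
have [|l hl] := @complete_nrm R M u.
  move=> e e0; have e2 : 0 < e / 2 by lra.
  have [N hN] := small _ e2; exists N => m n Nm Nn.
  have := nrmD (u m - u N) (u N - u n); rewrite addrA subrK [nrm (u N - u n)]nrmB.
  by have := far' N m Nm; have := far' N n Nn; lra.
exists l; split => // n; apply/ler_addgt0Pr => e e0.
have [N hN] := hl e e0; have := hN (maxn N n) (leq_maxl _ _).
have := far' n (maxn N n) (leq_maxr _ _).
have := nrmD (l - u (maxn N n)) (u (maxn N n) - u n).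
by rewrite addrA subrK nrmB; lra.
Qed.

(* The weights [4 ^+ n] make the increments dominated pointwise by
   [2 ^- n * sqrt c] with [c] integrable. *)
Lemma riesz_fischer (g : nat -> R -> M) : (forall n, L2 (g n)) ->
  (forall n, L2_re (fun x => g n.+1 x - g n x) (fun x => g n.+1 x - g n x) <= 8^-1 ^+ n) ->
  exists f, L2 f /\ forall n,
    L2_re (fun x => f x - g n x) (fun x => f x - g n x) <= 8 * 4^-1 ^+ n.
Proof.
move=> hg hd.
pose d n x := g n.+1 x - g n x.
have Ld n : L2 (d n) by exact: L2_sub.
pose w n x : \bar R := (4 ^+ n * re (d n x) (d n x))%:E.
have w0 n x : (0 <= w n x)%E by rewrite lee_fin mulr_ge0 ?re_ge0 ?exprn_ge0.
have mw n : measurable_fun [set: D] (w n).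
  apply/measurable_EFinP; apply: measurable_funM => //.
  by apply: strongly_measurable_measurable_re; exact: L2_sm.
pose C x : \bar R := (\sum_(n <oo) w n x)%E.
have C0 x : (0 <= C x)%E by apply: nneseries_ge0.
have mC : measurable_fun [set: D] C.
  by apply: ge0_emeasurable_sum.
have intC : (\int[mu]_x C x <= 2%:E)%E.
  rewrite integral_nneseries//.
  have iw n : (\int[mu]_x w n x = (4 ^+ n * L2_re (d n) (d n))%:E)%E.
    have id := L2_sq_integrable (Ld n).
    rewrite /w; under eq_integral do rewrite EFinM.
    rewrite ge0_integralZl//; last first.
    - by move=> x _; rewrite lee_fin re_ge0.
    - by case/integrableP: id.
    rewrite EFinM /L2_re /Rintegral fineK//; exact: integrable_fin_num id.
  (* Since [4 * 8^-1 = 2^-1], the weighted series is dominated by a geometric one with sum 2. *)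
  apply: (@le_trans _ _ (\sum_(n <oo) ((2^-1 ^+ n)%:E : \bar R))%E).
    apply: lee_nneseries => [n _ _|n _]; first by apply: integral_ge0 => x _; exact: w0.
    rewrite iw lee_fin; apply: le_trans (ler_wpM2l _ (hd n)) _; first exact: exprn_ge0.
    by rewrite -exprMn (_ : 4 * 8^-1 = 2^-1 :> R)//; field.
  apply: lime_le; first by apply: is_cvg_nneseries => n _ _; rewrite lee_fin exprn_ge0.
  near=> n; rewrite sumEFin lee_fin big_mkord.
  have -> : \sum_(i < n) 2^-1 ^+ i = 2 - 2 * 2^-1 ^+ n :> R.
    elim: (n) => [|k IH]; first by rewrite big_ord0 expr0; lra.
    by rewrite big_ord_recr /= IH exprS; lra.
  by rewrite gerBl mulr_ge0// exprn_ge0.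
pose G := [set x | (C x < +oo)%E].
have mG : measurable (G : set D).
  rewrite -[G]setTI; exact: emeasurable_fun_infty_o.
have wC n x : (w n x <= C x)%E.
  apply: le_trans (nneseries_lim_ge n.+1 (fun k _ _ => w0 k x)).
  rewrite big_nat_recr//= leeDr// sume_ge0//.
have e4 (n : nat) : (2^-1 ^+ n) ^+ 2 = 4^-1 ^+ n :> R.
  by rewrite -exprM mulnC exprM; congr (_ ^+ n); field.
(* Where [C] is infinite [f] is set to 0, which makes it an everywhere pointwise limit of
   restrictions of the [g n]. *)
have /choice[f hf] x : exists l, (x \in G -> tends (g ^~ x) l /\
      forall n, nrm (l - g n x) <= 2 * Num.sqrt (fine (C x)) * 2^-1 ^+ n) /\
      (x \notin G -> l = 0).
  have [xG|xG] := boolP (x \in G); last by exists 0.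
  have Cf : C x \is a fin_num by rewrite ge0_fin_numE//; move: xG; rewrite inE.
  suff step n : nrm (g n.+1 x - g n x) <= Num.sqrt (fine (C x)) * 2^-1 ^+ n.
    by have [l hl] := geometric_limit (u := g ^~ x) (sqrtr_ge0 _) step; exists l; split.
  have h1 : 4 ^+ n * re (d n x) (d n x) <= fine (C x) by rewrite -lee_fin fineK//; exact: wC.
  have p4 : (0 : R) < 4 ^+ n by rewrite exprn_gt0.
  have C1 : 0 <= fine (C x) by exact: fine_ge0.
  have r0 : 0 <= Num.sqrt (fine (C x)) * 2^-1 ^+ n by rewrite mulr_ge0 ?sqrtr_ge0 ?exprn_ge0.
  rewrite -(@ler_pXn2r _ 2) ?nnegrE ?nrm_ge0 // nrm_sqr exprMn sqr_sqrtr// e4 exprVn.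
  by rewrite ler_pdivlMr// mulrC.
have sf : strongly_measurable f.
  apply: (@strongly_measurable_limit _ _ (fun n x => if x \in G then g n x else 0)).
    by move=> n; apply: strongly_measurable_restrict => //; exact: L2_sm.
  move=> x e e0; have [h1 h2] := hf x; have [xG|xG] := boolP (x \in G).
    by have [N hN] := (h1 xG).1 e e0; exists N => n Nn /=; exact: hN.
  by exists 0%N => n _ /=; rewrite h2// subrr nrm0.
(* The square of the pointwise estimate is [q n * C x]; as [C] has integral at most 2, the constant
   8 results. *)
pose q (n : nat) : R := 4 * 4^-1 ^+ n.
have q0 n : 0 < q n by rewrite mulr_gt0// exprn_gt0// invr_gt0.
have bound n : (\int[mu]_x (re (f x - g n x) (f x - g n x))%:E <= (2 * q n)%:E)%E.
  apply: (@le_trans _ _ (\int[mu]_x ((q n)%:E * C x))%E).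
    apply: ge0_le_integral => //.
    - by move=> x _; rewrite lee_fin re_ge0.
    - by apply/measurable_EFinP; apply: strongly_measurable_measurable_re; apply: strongly_measurable_sub => //; exact: L2_sm.
    - exact: measurable_funeM.
    (* Off [G] the right-hand side is infinite, so the bound holds there as well. *)
    move=> x _; have [xG|xG] := boolP (x \in G); last first.
      have -> : C x = +oo%E.
        by apply/eqP; rewrite -leye_eq leNgt; apply: contra xG => h; rewrite inE.
      by rewrite gt0_muley ?lte_fin// leey.
    have Cf : C x \is a fin_num by rewrite ge0_fin_numE//; move: (xG); rewrite inE.
    rewrite -(fineK Cf) -EFinM lee_fin -nrm_sqr.
    have := ((hf x).1 xG).2 n => h1.
    have : nrm (f x - g n x) ^+ 2 <= (2 * Num.sqrt (fine (C x)) * 2^-1 ^+ n) ^+ 2.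
      by rewrite lerXn2r ?nnegrE ?nrm_ge0 ?mulr_ge0 ?sqrtr_ge0 ?exprn_ge0.
    rewrite exprMn e4 exprMn (sqr_sqrtr (fine_ge0 (C0 x))) /q => h2; apply: le_trans h2 _.
    by rewrite -natrX; lra.
  rewrite ge0_integralZl//; last by rewrite lee_fin ltW.
  have -> : (2 * q n)%:E = ((q n)%:E * 2%:E)%E by rewrite mulrC EFinM.
  by apply: lee_wpmul2l => //; rewrite lee_fin ltW.
have Lfg n : L2 (fun x => f x - g n x).
  split; first by apply: strongly_measurable_sub => //; exact: L2_sm.
  by apply: le_lt_trans (bound n) _; rewrite ltry.
exists f; split.
  have := L2_add (Lfg 0%N) (hg 0%N); congr L2.
  by apply/funext => x; rewrite subrK.
move=> n; rewrite -lee_fin /L2_re /Rintegral fineK.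
  apply: le_trans (bound n) _; rewrite lee_fin /q; lra.
exact: integrable_fin_num (L2_sq_integrable (Lfg n)).
Unshelve. all: by end_near. Qed.

End RieszFischer.

(** * Construction of the translation representation *)

Section Model.
Context {R : realType} {E : hilbertType R} (U : R -> {linear E -> E}).
Context (HU : unitary_one_parameter_group U).
Context {M : hilbertType R} (A : M -> E) (hA : exp_system U A).
Local Notation mu := (@lebesgue_measure R).
Implicit Types (u v w : E) (f g h : R -> M) (l : seq (R[i] * (R * M))).

(** [F] and [exp_vec] are families over [R * M] with the same Gram matrix. As [L2] is a set of
    functions and not a Hilbert space, [Fc] and [Gc] redo the extension argument of
    [isometric_partner]. *)
Let F (p : R * M) : E := U p.1 (A p.2).
Let Fc l : E := lin_comb F l.
Let Gc l : R -> M := fun x => lin_comb (fun p => exp_vec p.1 p.2 x) l.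

Let A_scale (a : R[i]) m : A (a *: m) = a *: A m.
Proof.
case: hA => lin _ _; have A0 : A 0 = 0.
  by have := lin (-1) 0 0; rewrite scaler0 addr0 scaleN1r addNr.
by have := lin a m 0; rewrite !addr0 A0 addr0.
Qed.

Let F_total : total_family F.
Proof. by case: hA => _ _ h z hz; apply: h => t m; exact: hz (t, m). Qed.

Let L2_re_exp s t m n : L2_re (exp_vec s m) (exp_vec t n) = re (U s (A m)) (U t (A n)).
Proof.
case: hA => _ h _; rewrite L2_re_exp_vec U_readj// -U_D// /re h (_ : `|- s + t| = `|s - t|).
  by case: (inner m n) => a b /=; rewrite mul0r subr0.
by rewrite -normrN opprD opprK.
Qed.

Let Gc_cons c p l : Gc ((c, p) :: l) = fun x => exp_vec p.1 (c *: p.2) x + Gc l x.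
Proof.
by apply/funext => x; rewrite /Gc /lin_comb big_cons /=; congr (_ + _); rewrite /exp_vec !scalerA mulrC.
Qed.

Let Fc_cons c p l : Fc ((c, p) :: l) = U p.1 (A (c *: p.2)) + Fc l.
Proof. by rewrite /Fc /lin_comb big_cons /= A_scale linearZ. Qed.

Let Gc_L2 l : L2 (Gc l).
Proof.
elim: l => [|[c p] l IH].
  by rewrite (_ : Gc [::] = fun=> 0); [exact: L2_0|apply/funext => x; rewrite /Gc /lin_comb big_nil].
by rewrite Gc_cons; apply: L2_add => //; exact: exp_vec_L2.
Qed.

Let L2_re_Gc h w : L2 h -> (forall t m, L2_re h (exp_vec t m) = re w (U t (A m))) ->
  forall l, L2_re (Gc l) h = re (Fc l) w.
Proof.
move=> Lh hw; elim=> [|[c p] l IH].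
  rewrite /Fc /lin_comb big_nil !reE /L2_re; under eq_Rintegral do rewrite /Gc /lin_comb big_nil reE.
  by rewrite /Rintegral integral0.
rewrite Gc_cons Fc_cons L2_reDl//; last exact: exp_vec_L2.
rewrite IH reE; congr (_ + _).
by rewrite L2_reC hw reC.
Qed.

Let L2_re_Gc_exp l t m : L2_re (Gc l) (exp_vec t m) = re (Fc l) (U t (A m)).
Proof. by apply: L2_re_Gc; [exact: exp_vec_L2|move=> s n; exact: L2_re_exp]. Qed.

Let L2_re_GcGc l l' : L2_re (Gc l) (Gc l') = re (Fc l) (Fc l').
Proof.
apply: L2_re_Gc; first exact: Gc_L2.
by move=> t m; exact: L2_re_Gc_exp.
Qed.

Let Gc_sub l l' : (fun x => Gc l x - Gc l' x) = Gc (l ++ [seq (-1 * p.1, p.2) | p <- l']).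
Proof. by apply/funext => x; rewrite /Gc lin_comb_cat lin_comb_scale scaleN1r. Qed.

Let Fc_sub l l' : Fc l - Fc l' = Fc (l ++ [seq (-1 * p.1, p.2) | p <- l']).
Proof. by rewrite /Fc lin_comb_cat lin_comb_scale scaleN1r. Qed.

Let geom_eq0 (x c : R) : 0 <= c -> (forall n, `|x| <= c * 2^-1 ^+ n) -> x = 0.
Proof.
move=> c0 h; apply/eqP; rewrite -normr_le0.
have h0 : (fun n => c * (2^-1 : R) ^+ n) @ \oo --> c * 0.
  apply: cvgM; first exact: cvg_cst.
  by apply: cvg_expr; rewrite ger0_norm ?invr_ge0//; lra.
rewrite -(mulr0 c) -(cvg_lim _ h0)//; apply: limr_ge; first by apply/cvg_ex; eexists; exact: h0.
by apply: nearW => n; exact: h.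
Qed.

(** [f] is the limit of [Gc (s n)], where [Fc (s n)] tends to [v]. It is characterized by pairings
    with a general [h], so that [h] may later be an exponential or another image. *)
Let model_ex v : exists f, L2 f /\ forall h w, L2 h ->
  (forall l, L2_re (Gc l) h = re (Fc l) w) -> L2_re f h = re v w.
Proof.
(* This rate bounds successive distances by [4^-1 ^+ n], whose square is below the [8^-1 ^+ n]
   required by [riesz_fischer]. *)
have i4 (n : nat) : (0 : R) < 2^-1 * 4^-1 ^+ n by rewrite mulr_gt0// exprn_gt0.
have /choice[s hs] n := lin_comb_approx F_total v (i4 n).
have le4 (n : nat) : (4^-1 : R) ^+ n.+1 <= 4^-1 ^+ n.
  by rewrite exprS ler_piMl ?exprn_ge0//; lra.
have [||f [Lf hf]] := @riesz_fischer R M (fun n => Gc (s n)).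
- by move=> n; exact: Gc_L2.
- move=> n; rewrite Gc_sub L2_re_GcGc -Fc_sub -nrm_sqr.
  have a1 := nrmD (v - Fc (s n)) (Fc (s n.+1) - v).
  rewrite addrC addrA subrK [nrm (_ - v)]nrmB in a1.
  have := hs n; have := hs n.+1; have := le4 n => *.
  apply: (@le_trans _ _ ((4^-1 ^+ n) ^+ 2)).
    rewrite lerXn2r ?nnegrE ?nrm_ge0 ?exprn_ge0//; rewrite -/(Fc _) in a1; lra.
  by rewrite -exprM mulnC exprM lerXn2r ?nnegrE ?exprn_ge0//; lra.
exists f; split => // h w Lh hw; apply/eqP; rewrite -subr_eq0; apply/eqP.
(* 8 comes from [riesz_fischer] and [L2_re h h] from [L2_re_young], used with the parameter
   [2 ^+ n]; [nrm w] comes from the error in [E]. *)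
apply: (@geom_eq0 _ (8 + L2_re h h + nrm w)); first by rewrite !addr_ge0 ?L2_re_ge0 ?nrm_ge0.
move=> n; have Lg := Gc_L2 (s n).
have e : L2_re f h = L2_re (fun x => f x - Gc (s n) x) h + re (Fc (s n)) w.
  by rewrite L2_reBl// hw subrK.
have p2 : (0 : R) < 2 ^+ n by rewrite exprn_gt0.
have := L2_re_young (L2_sub Lf Lg) Lh p2 => y1.
have y2 := cauchy_schwarz (v - Fc (s n)) w.
rewrite !reE in y2.
have y3 : nrm (v - Fc (s n)) * nrm w <= 2^-1 ^+ n * nrm w.
  apply: ler_wpM2r; first exact: nrm_ge0.
  apply: le_trans (ltW (hs n)) _; rewrite (_ : 4^-1 = 2^-1 * 2^-1 :> R); last by field.
  rewrite exprMn mulrA ler_piMl ?exprn_ge0//.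
  have : (2^-1 : R) ^+ n <= 1 by rewrite exprn_ile1//; lra.
  lra.
have y4 : 2 ^+ n * L2_re (fun x => f x - Gc (s n) x) (fun x => f x - Gc (s n) x) <=
    8 * 2^-1 ^+ n.
  apply: le_trans (ler_wpM2l (ltW p2) (hf n)) _.
  by rewrite mulrCA -exprMn (_ : 2 * 4^-1 = 2^-1 :> R)//; field.
rewrite e; rewrite -exprVn in y1.
have := ler_normD (L2_re (fun x => f x - Gc (s n) x) h) (- (re v w - re (Fc (s n)) w)).
rewrite normrN opprB [_ + (_ - _)]addrA; lra.
Qed.

Lemma exp_system_translation : equivalent_to_translation U M.
Proof.
have [W hW] := choice model_ex.
have LW v : L2 (W v) by case: (hW v).
have Wexp v t m : L2_re (W v) (exp_vec t m) = re v (U t (A m)).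
  by apply: (hW v).2; [exact: exp_vec_L2|move=> l; exact: L2_re_Gc_exp].
have Wip u v : L2_re (W u) (W v) = re u v.
  by apply: (hW u).2 => // l; apply: L2_re_Gc.
(* Pairings with exponentials determine a function almost everywhere; linearity, surjectivity and
   intertwining all reduce to computing them. *)
have Wuniq v f : L2 f -> (forall t m, L2_re f (exp_vec t m) = re v (U t (A m))) ->
    W v = f %[ae mu].
  move=> Lf hf; suff : (fun x => W v x - f x) = (fun=> 0) %[ae mu].
    by apply: ae_imply => x h xT; apply/eqP; rewrite -subr_eq0 h.
  apply: L2_total; first exact: L2_sub.
  by move=> t n; rewrite L2_reBl//; [rewrite Wexp hf subrr|exact: exp_vec_L2].
have ip_adj (a : R[i]) f g : L2_re (fun x => a *: f x) g = L2_re f (fun x => a^*%C *: g x).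
  by apply: eq_Rintegral => x _; rewrite /re innerZl innerZr conjCK.
have Wlin (a : R[i]) u v : W (a *: u + v) = (fun x => a *: W u x + W v x) %[ae mu].
  apply: Wuniq; first exact: L2_lin.
  move=> t m; have Le := exp_vec_L2 t m; rewrite L2_reDl//; last exact: L2_scale.
  rewrite ip_adj exp_vecZ !Wexp reDl A_scale linearZ /=; congr (_ + _).
  by rewrite /re innerZl innerZr conjCK.
have WexpE t m : W (U t (A m)) = exp_vec t m %[ae mu].
  by apply: Wuniq; [exact: exp_vec_L2|move=> s n; exact: L2_re_exp].
have ip_aer f g g' : L2 f -> L2 g -> L2 g' -> g = g' %[ae mu] -> L2_re f g = L2_re f g'.
  by move=> Lf Lg Lg' gg'; rewrite L2_reC (L2_re_ae Lg Lg' Lf gg') L2_reC.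
exists W; split => //.
- move=> u v; rewrite L2_innerE inner_re Wip; congr (_ +i* _).
  rewrite -Wip; apply: ip_aer => //; first exact: L2_scale.
  (* The second instance of linearity says that [W 0] vanishes almost everywhere. *)
  apply: ae_imply2 (Wlin 'i v 0) (Wlin (-1) 0 0) => x h1 h2 xT.
  move: (h1 xT) (h2 xT); rewrite /= !addr0 scaler0 scaleN1r addNr => -> ->.
  by rewrite addr0.
(* Surjectivity by Riesz representation in [E]: the [v] representing [l] has the same pairings with
   exponentials as [f]. *)
- move=> f Lf; pose l u := L2_re f (W u).
  have ll (k : R) u v : l (u + k%:C *: v) = l u + k * l v.
    rewrite addrC /l (ip_aer _ _ _ _ _ _ (Wlin k%:C v u))//; last exact: L2_lin.
    rewrite L2_reC L2_reDl//; last exact: L2_scale.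
    by rewrite L2_reZl// ![L2_re (W _) f]L2_reC addrC.
  have l0 : l 0 = 0 by have := ll 1 0 0; rewrite scaler0 addr0; lra.
  have lb u : `|l u| <= (L2_re f f + 1) * nrm u.
    have [u0|u0] := eqVneq (nrm u) 0.
      by rewrite (nrm0_eq0 u0) l0 normr0 -(nrm0_eq0 u0) u0 mulr0.
    have n0 : 0 < nrm u by rewrite lt_def u0 nrm_ge0.
    (* The choice [k = nrm u] makes the bound linear in [nrm u]. *)
    have := L2_re_young Lf (LW u) n0; rewrite Wip -nrm_sqr expr2 mulfK//; rewrite -/(l u); lra.
  have hT : linear_subspace [set: E] by split.
  have [v _ hv] := riesz_representation hT closedT (fun k u v _ _ => ll k u v) (fun u _ => lb u).
  exists v; apply: Wuniq => // t m; rewrite hv// /l.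
  by rewrite -(ip_aer _ _ _ _ _ _ (WexpE t m))//; exact: exp_vec_L2.
move=> t v; apply: Wuniq; first exact: translation_L2.
move=> s m; have -> : exp_vec s m = translation t (exp_vec (s - t) m) by rewrite exp_vec_translation subrK.
rewrite L2_re_translation//; last exact: exp_vec_L2.
by rewrite Wexp U_readj// -U_D// addrC.
Qed.
End Model.

(** * Uniqueness of the representation *)

Lemma translation_exp_system {R : realType} {E : hilbertType R} (U : R -> {linear E -> E})
  (HU : unitary_one_parameter_group U) (N : hilbertType R) : equivalent_to_translation U N -> exists B : N -> E, exp_system U B.
Proof.
set mu := @lebesgue_measure R.
move=> [W [LW Wlin Wip Wsurj Wtr]].
(* The exponential system of the model is pulled back along [W]. *)
have /choice[B hB] n : exists v, W v = exp_vec 0 n %[ae mu] by apply: Wsurj; exact: exp_vec_L2.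
have Wre u v : L2_re (W u) (W v) = re u v by have := Wip u v; rewrite L2_innerE inner_re => -[].
have WB t n : W (U t (B n)) = exp_vec t n %[ae mu].
  apply: ae_imply2 (Wtr t (B n)) (ae_translate t (hB n)) => x h1 h2 xT.
  rewrite h1// /translation h2//.
  by have := congr1 (fun f => f x) (exp_vec_translation 0 t n); rewrite add0r.
have BB (m n : N) s t : inner (U s (B m)) (U t (B n)) = (expR (- `|s - t|))%:C * inner m n.
  rewrite -Wip -L2_inner_exp_vec !L2_innerE.
  have Le r k := @exp_vec_L2 R N r k.
  rewrite (L2_re_ae (LW _) (Le s m) (LW _) (WB s m)).
  rewrite (L2_re_ae (LW _) (Le s m) (L2_scale 'i (LW _)) (WB s m)).
  congr (_ +i* _).
    by rewrite L2_reC (L2_re_ae (LW _) (Le t n) (Le s m) (WB t n)) L2_reC.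
  rewrite L2_reC [RHS]L2_reC; apply: L2_re_ae => //; try exact: L2_scale.
  by apply: ae_imply (WB t n) => x h xT; rewrite h.
have zeroP z : (forall t (n : N), inner z (U t (B n)) = 0) -> z = 0.
  move=> hz; apply: re0_eq0; rewrite -Wre.
  have Lz : L2 (fun _ : R => 0 : N) by exact: L2_0.
  rewrite (L2_re_ae (LW z) Lz (LW z)).
    by rewrite /L2_re; under eq_Rintegral do rewrite re0l; rewrite /Rintegral integral0.
  apply: L2_total => // t n.
  have Le := @exp_vec_L2 R N t n.
  by rewrite L2_reC -(L2_re_ae (LW _) Le (LW z) (WB t n)) L2_reC Wre /re hz.
have BU (m n : N) t : inner (B m) (U t (B n)) = (expR (- `|t|))%:C * inner m n.
  by rewrite -[B m](U_0 HU) BB sub0r normrN.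
(* [B] was obtained by choice; it is linear because the Gram relations fix its pairings with the
   total orbits. *)
exists B; split => // a m n; apply/eqP; rewrite -subr_eq0; apply/eqP.
apply: zeroP => t k; rewrite innerBl innerDl innerZl !BU innerDl innerZl; ring.
Qed.

Theorem proposition4p4p2 (R : realType) (E : hilbertType R) (Ep : set E)
    (theta : {linear E -> E}) (U : R -> {linear E -> E})
    (hspace : reflection_positive_space Ep theta)
    (hgroup : reflection_positive_group Ep theta U)
    (hcyclic : cyclic_subspace Ep U)
    (hfix : fixed_vectors U = [set 0]) :
  outgoing Ep U /\
  exists M : hilbertType R,
    equivalent_to_translation U M /\
    forall N : hilbertType R,
      equivalent_to_translation U N -> hilbert_isomorphic M N.
Proof.
have [HU _ _] := hgroup.
have hout := reflection_positive_outgoing hspace hgroup hcyclic hfix; split => //.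
have hA := outgoing_exp_system HU hout.
exists (subspace_type (wandering_closed hout)); split; first exact: exp_system_translation HU _ _ hA.
move=> N hN; have [B hB] := translation_exp_system HU hN.
exact: exp_system_unique HU _ _ _ _ hA hB.
Qed.
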